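(* Let $Q$ be an $s$-dimensional manifold, $H:T^{*}Q\to\mathbb{R}$ a Hamiltonian function, $\pi_Q:T^{*}Q\to Q$ the canonical projection, and $m\in T^{*}Q$ a point such that $X_H(m)\notin\mathsf{Ker}(\pi_Q)_{*,m}$. Then there exist an open neighborhood $U\subseteq T^{*}Q$ of $m$, another $s$-dimensional manifold $\Lambda$, and a family of functions $W_\lambda:\pi_Q(U)\to\mathbb{R}$, $\lambda\in\Lambda$, such that $$\mathsf{d}(H\circ\mathsf{d}W_\lambda)=0\quad\text{for all }\lambda\in\Lambda,$$ and the map $$(q,\lambda)\in\pi_Q(U)\times\Lambda\longmapsto\mathsf{d}W_\lambda(q)\in U$$ is a diffeomorphism. In other words, a complete family of Hamilton's characteristic functions exists around $m$.
   Context: All manifolds and maps are smooth ($C^\infty$) and finite-dimensional. $T^{*}Q$ carries its canonical symplectic form $\omega_Q$, and $X_H$ is the Hamiltonian vector field defined by $\mathfrak{i}_{X_H}\omega_Q=\mathsf{d}H$. The differential $\mathsf{d}W_\lambda$ is regarded as a map $\pi_Q(U)\to T^{*}Q$ (a section of $\pi_Q$ over $\pi_Q(U)$), so that $H\circ\mathsf{d}W_\lambda$ is a real function on $\pi_Q(U)$. A family $W_\lambda$ with the properties displayed in the claim is called a complete family of Hamilton's characteristic functions around $m$. *)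

(* Defs.v *)
From HB Require Import structures.
From mathcomp Require Import all_boot all_order all_algebra.
From mathcomp Require Import all_classical all_reals all_analysis.

Set Implicit Arguments.
Unset Strict Implicit.
Unset Printing Implicit Defensive.

Import Order.TTheory GRing.Theory Num.Theory.
Import numFieldNormedType.Exports.

Local Open Scope classical_set_scope.
Local Open Scope ring_scope.

Section Smoothness.
Context {R : realType}.

(* [D] is meant to be open. *)
Fixpoint Ck_on (k : nat) (E F : normedModType R) (D : set E) (f : E -> F) : Prop :=
  if k is k'.+1 then
    (forall x, D x -> differentiable f x) /\ (forall v, Ck_on k' D ('D_v f))
  else forall x, D x -> {for x, continuous f}.

Definition Coo_on (E F : normedModType R) (D : set E) (f : E -> F) : Prop :=
  forall k, Ck_on k D f.

End Smoothness.

(* A chart is given by raw data: a bijection [chart_map] from [chart_dom] onto an open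
   set [chart_cod] of the model space, with inverse [chart_inv]; [chart_map] and [chart_inv] are total
   functions, whose values outside [chart_dom] and [chart_cod] are irrelevant.  That they
   are mutually inverse is required in [smooth_manifold] below. *)
Record chart (R : realType) (M : Type) (E : normedModType R) := Chart {
  chart_dom : set M;
  chart_cod : set E;
  chart_map : M -> E;
  chart_inv : E -> M;
  open_chart_cod : open chart_cod }.

(* [chart_at x] is a preferred chart around [x]; it serves only to represent
   tangent vectors at [x] by coordinates. *)
Record charted_space (R : realType) (E : normedModType R) := ChartedSpace {
  carrier :> Type;
  atlas : set (chart carrier E);
  chart_at : carrier -> chart carrier E }.

Section AtlasTopology.
Context {R : realType} {E : normedModType R} (M : charted_space E).

(* The topology of a manifold is the one induced by its atlas: [A] is open when
   [A] is open in every chart. *)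
Definition atlas_open (A : set M) : Prop :=
  forall c, atlas c -> open (chart_cod c `&` chart_inv c @^-1` A).

Lemma atlas_openT : atlas_open setT.
Proof. by move=> c _; rewrite preimage_setT setIT; exact: open_chart_cod. Qed.

Lemma atlas_openI : setI_closed atlas_open.
Proof.
move=> A B oA oB c ac; rewrite preimage_setI setIIr.
by apply: openI; [exact: oA|exact: oB].
Qed.

Lemma atlas_open_bigU (I : Type) (f : I -> set M) :
  (forall i, atlas_open (f i)) -> atlas_open (\bigcup_i f i).
Proof.
move=> of_ c ac; rewrite preimage_bigcup setI_bigcupr.
by apply: bigcup_open => i _; exact: of_.
Qed.

HB.instance Definition _ := gen_eqMixin (carrier M).
HB.instance Definition _ := gen_choiceMixin (carrier M).
HB.instance Definition _ := isOpenTopological.Build (carrier M)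
  atlas_openT atlas_openI atlas_open_bigU.

End AtlasTopology.

Section Manifolds.
Context {R : realType}.

Definition is_chart (M : Type) (E : normedModType R) (c : chart M E) : Prop :=
  [/\ {homo chart_map c : x / chart_dom c x >-> chart_cod c x},
      {homo chart_inv c : y / chart_cod c y >-> chart_dom c y},
      forall x, chart_dom c x -> chart_inv c (chart_map c x) = x &
      forall y, chart_cod c y -> chart_map c (chart_inv c y) = y].

Definition compatible (M : Type) (E : normedModType R) (c d : chart M E) : Prop :=
  let D := chart_cod c `&` chart_inv c @^-1` chart_dom d in
  open D /\ Coo_on D (chart_map d \o chart_inv c).

Definition smooth_manifold (E : normedModType R) (M : charted_space E) : Prop :=
  [/\ forall x : M, atlas (chart_at x) /\ chart_dom (chart_at x) x,
      forall c : chart M E, atlas c -> is_chart c,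
      forall c d : chart M E, atlas c -> atlas d -> compatible c d,
      hausdorff_space M &
      @second_countable M].

(* For [A] open; openness of the domain of the local representative of [f]
   expresses the continuity of [f]. *)
Definition smooth_on (E F : normedModType R) (M : charted_space E)
    (N : charted_space F) (A : set M) (f : M -> N) : Prop :=
  forall (c : chart M E) (d : chart N F), atlas c -> atlas d ->
    let D := chart_cod c `&` chart_inv c @^-1` (A `&` f @^-1` chart_dom d) in
    open D /\ Coo_on D (chart_map d \o f \o chart_inv c).

Definition diffeomorphism (E F : normedModType R) (M : charted_space E)
    (N : charted_space F) (A : set M) (B : set N) (f : M -> N) : Prop :=
  [/\ smooth_on A f, set_bij A B f &
      exists g : N -> M, smooth_on B g /\ forall x, A x -> g (f x) = x].

Definition model_chart (E : normedModType R) : chart E E :=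
  @Chart R E E setT setT id id openT.

Definition model_space (E : normedModType R) : charted_space E :=
  @ChartedSpace R E E [set model_chart E] (fun=> model_chart E).

Definition real_line : charted_space (R^o : normedModType R) :=
  model_space (R^o : normedModType R).

Lemma open_setX (E F : normedModType R) (A : set E) (B : set F) :
  open A -> open B -> open (A `*` B : set (E * F)%type).
Proof.
move=> oA oB; rewrite openE => -[x y] [Ax By]; exists (A, B) => //=.
by split; exact: open_nbhs_nbhs.
Qed.

Definition prod_chart (E F : normedModType R) (M N : Type) (c : chart M E)
    (d : chart N F) : chart (M * N)%type (E * F)%type :=
  @Chart R (M * N)%type (E * F)%type (chart_dom c `*` chart_dom d) (chart_cod c `*` chart_cod d)
    (fun x => (chart_map c x.1, chart_map d x.2)) (fun y => (chart_inv c y.1, chart_inv d y.2))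
    (open_setX (open_chart_cod c) (open_chart_cod d)).

Definition prod_manifold (E F : normedModType R) (M : charted_space E)
    (N : charted_space F) : charted_space (E * F)%type :=
  @ChartedSpace R (E * F)%type (M * N)%type
    [set e | exists c d, [/\ atlas c, atlas d & e = prod_chart c d]]
    (fun x => prod_chart (chart_at x.1) (chart_at x.2)).

(* A tangent vector at [x] is represented by its coordinates in the preferred
   chart [chart_at x]. *)
Definition tangent_space (E : normedModType R) (M : charted_space E) (x : M) :
  normedModType R := E.

Definition tangent_map (E F : normedModType R) (M : charted_space E)
    (N : charted_space F) (f : M -> N) (x : M) :
    tangent_space x -> tangent_space (f x) :=
  'd (chart_map (chart_at (f x)) \o f \o chart_inv (chart_at x)) (chart_map (chart_at x) x).

Definition differential (E : normedModType R) (M : charted_space E)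
  (f : M -> R) (x : M) (v : tangent_space x) : R :=
  tangent_map (f : M -> real_line) v.

Definition one_form (E : normedModType R) (M : charted_space E) : Type :=
  forall x : M, tangent_space x -> R.

(* The coefficient of the one-form [theta] along the constant vector [v], in
   the coordinates [y] of the chart [c]. *)
Definition form_in_chart (E : normedModType R) (M : charted_space E)
    (theta : one_form M) (c : chart M E) (v : E) (y : E) : R^o :=
  let x := chart_inv c y in
  theta x ('d (chart_map (chart_at x) \o chart_inv c) y v).

(* d theta (u, v) = u (theta v) - v (theta u) for constant fields u and v in a
   chart. *)
Definition exterior_derivative (E : normedModType R) (M : charted_space E)
    (theta : one_form M) (x : M) (u v : tangent_space x) : R :=
  let c := chart_at x in
  'D_u (form_in_chart theta c v) (chart_map c x) -
  'D_v (form_in_chart theta c u) (chart_map c x).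

End Manifolds.

Section Cotangent.
Context {R : realType} {s : nat}.
Implicit Type Q : charted_space 'rV[R]_s.

(* A point of the cotangent bundle: a covector at [base_point] given by its components
   in the basis of the tangent space at [base_point] induced by [chart_at base_point]. *)
Record covector Q := Covector { base_point : Q; components : 'cV[R]_s }.

Definition pairing Q (a : covector Q) (v : tangent_space (base_point a)) : R :=
  ((v : 'rV[R]_s) *m components a) 0 0.

(* The chart of the cotangent bundle induced by a chart [c] of the base.  The
   components [p] of a covector in [c] satisfy  v *m p = (v *m J) *m components a,
   where J is the Jacobian of the change from [c] to [chart_at (base_point a)]. *)
Definition cotangent_chart Q (c : chart Q 'rV[R]_s) :
    chart (covector Q) ('rV[R]_s * 'cV[R]_s)%type :=
  @Chart R (covector Q) ('rV[R]_s * 'cV[R]_s)%type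
    [set a | chart_dom c (base_point a)] (chart_cod c `*` setT)
    (fun a => (chart_map c (base_point a),
       jacobian (chart_map (chart_at (base_point a)) \o chart_inv c) (chart_map c (base_point a))
         *m components a))
    (fun y => let q := chart_inv c y.1 in
       Covector q
         (jacobian (chart_map c \o chart_inv (chart_at q)) (chart_map (chart_at q) q)
           *m y.2))
    (open_setX (open_chart_cod c) openT).

Definition cotangent Q : charted_space ('rV[R]_s * 'cV[R]_s)%type :=
  @ChartedSpace R ('rV[R]_s * 'cV[R]_s)%type (covector Q)
    [set cotangent_chart c | c in @atlas R _ Q]
    (fun a => cotangent_chart (chart_at (base_point a))).

Definition cotangent_proj Q (a : cotangent Q) : Q := base_point a.

Definition tautological_form Q : one_form (cotangent Q) :=
  fun a v => @pairing Q a (tangent_map (@cotangent_proj Q) v).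

(* omega = - d theta, that is dq /\ dp in canonical coordinates. *)
Definition canonical_form Q (a : cotangent Q) (u v : tangent_space a) : R :=
  - exterior_derivative (@tautological_form Q) u v.

Definition hamiltonian_field Q (H : cotangent Q -> R) (a : cotangent Q) :
    tangent_space a :=
  xget 0 [set X : tangent_space a |
    forall v : tangent_space a, canonical_form X v = differential H v].

Definition diff_section Q (W : Q -> R) (q : Q) : cotangent Q :=
  Covector q (\col_i differential W (delta_mx 0 i : tangent_space q)).

Definition ker_tangent_proj Q (a : cotangent Q) : set (tangent_space a) :=
  [set v | tangent_map (@cotangent_proj Q) v = 0].

(* [W] is a complete family of Hamilton's characteristic functions over the
   parameter manifold [L], with values in the open set [U].  Only the values of
   [W l] on the (open) projection of [U] matter. *)
Definition complete_family Q (H : cotangent Q -> R) (U : set (cotangent Q))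
    (L : charted_space 'rV[R]_s) (W : L -> Q -> R) : Prop :=
  let V := @cotangent_proj Q @` U in
  [/\ forall l : L, smooth_on (N := real_line) V (W l),
      forall (l : L) (q : Q), V q ->
        forall v : tangent_space q, differential (H \o diff_section (W l)) v = 0 &
      diffeomorphism (M := prod_manifold Q L) (N := cotangent Q)
        (V `*` [set: L]) U (fun x => diff_section (W x.2) x.1)].

End Cotangent.

(* Main.v *)
(* Method of characteristics.  In a chart around m, transversality of X_H gives an
   index i0 with dH/dp_i0 <> 0 at m, so X_H crosses the hyperplane q_i0 = const.  Let
   phi_t be the flow of X_H and S the action, S' = p . dH/dp along trajectories.  The
   map Psi sends (t, initial data on the hyperplane) to the endpoint of the trajectory
   in T^*Q, and G sends the same data to (endpoint in Q, l), where l is the initial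
   momentum with component i0 replaced by the energy E.  Both are local
   diffeomorphisms, by the inverse function theorem.  Along the flow
   dS - p dq changes by t dE only, so with S = (q - q0) . p at time 0 the form
   dS - p dq is a combination of the differentials of the components of l.
   Hence W = S o G^-1 satisfies d_q W(q, l) = p, the energy H o dW_l is a
   component of l, and (q, l) |-> dW_l(q) is Psi o G^-1. *)
Require Import Defs.
From HB Require Import structures.
From mathcomp Require Import all_boot all_order all_algebra.
From mathcomp Require Import all_classical all_reals all_analysis.
From mathcomp Require Import ring lra.
Import Order.TTheory GRing.Theory Num.Theory.
Import numFieldNormedType.Exports.
Set Implicit Arguments.
Unset Strict Implicit.
Unset Printing Implicit Defensive.
Local Open Scope classical_set_scope.
Local Open Scope ring_scope.

(** * Linear identities *)

(** Two choices reduce the analysis to the smoothness of flows in all variables and the inverse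
    function theorem for a map of a space to itself. The action is an extra coordinate of the flow,
    so its smoothness comes with that of the trajectories. The data (time, point of the hyperplane,
    momentum) are packed into a single point [y] of phase space, component [i0] of [y.1 - q0]
    serving as the time. The condition dH/dp_i0 <> 0 acts twice: it makes trajectories leave the
    hyperplane, and it lets the energy replace p_i0 as a coordinate. With the energy among the
    components of l, the term t dE vanishes as soon as l is held fixed. The initial action
    contributes (q - q0) . dp; the differential dp_i0, the one lost in the exchange, has coefficient
    0, since q - q0 has no component [i0] on the hyperplane. Flows and their smooth dependence on
    initial data are built from Picard iteration and Gronwall's inequality; the variational equation
    obtained on the way also yields the formula for dS. *)

Section ModuleIdentities.
Variables (R : realType) (V : lmodType R).

Inductive mexp :=
  | MVar of nat | MZero | MAdd of mexp & mexp | MOpp of mexp | MScale of R & mexp.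

Fixpoint mexp_eval (env : seq V) (e : mexp) : V :=
  match e with
  | MVar n => nth 0 env n
  | MZero => 0
  | MAdd a b => mexp_eval env a + mexp_eval env b
  | MOpp a => - mexp_eval env a
  | MScale c a => c *: mexp_eval env a
  end.

Fixpoint mexp_coef (n : nat) (e : mexp) : R :=
  match e with
  | MVar k => if eqn n k then 1 else 0
  | MZero => 0
  | MAdd a b => mexp_coef n a + mexp_coef n b
  | MOpp a => - mexp_coef n a
  | MScale c a => c * mexp_coef n a
  end.

(** A recursive conjunction rather than a bounded quantifier: for a concrete environment it computes
    to finitely many scalar equations, each of which [ring] can close. *)
Fixpoint mexp_coefs_eq (n : nat) (e1 e2 : mexp) : Prop :=
  if n is n'.+1 then mexp_coef n' e1 = mexp_coef n' e2 /\ mexp_coefs_eq n' e1 e2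
  else True.

Lemma mexp_eval_sum env e :
  mexp_eval env e = \sum_(i < size env) mexp_coef i e *: nth 0 env i.
Proof.
elim: e => [k||a IHa b IHb|a IHa|c a IHa] /=; rewrite ?IHa ?IHb.
- have [ks|sk] := ltnP k (size env); last first.
    rewrite nth_default // big1 // => i _.
    case: eqnP => [ik|_]; last by rewrite scale0r.
    by move: (leq_trans (ltn_ord i) sk); rewrite ik ltnn.
  rewrite (bigD1 (Ordinal ks)) //= big1 ?addr0 => [|i].
    by case: eqnP => // _; rewrite scale1r.
  case: eqnP => [ik|_]; last by rewrite scale0r.
  by move=> /eqP []; apply: val_inj.
- by rewrite big1 // => i _; rewrite scale0r.
- by rewrite -big_split; apply: eq_bigr => i _; rewrite scalerDl.
- by rewrite -sumrN; apply: eq_bigr => i _; rewrite scaleNr.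
- by rewrite scaler_sumr; apply: eq_bigr => i _; rewrite scalerA.
Qed.

Lemma mexp_eq env e1 e2 :
  mexp_coefs_eq (size env) e1 e2 -> mexp_eval env e1 = mexp_eval env e2.
Proof.
move=> H; rewrite !mexp_eval_sum; apply: eq_bigr => -[i /= isz] _; congr (_ *: _).
elim: (size env) isz H => // n IH; rewrite ltnS leq_eqVlt => /orP[/eqP ->|]; first by case.
by move=> isz [_]; exact: IH.
Qed.

End ModuleIdentities.

Ltac mexp_index x env :=
  lazymatch env with
  | x :: _ => constr:(0%N)
  | _ :: ?t => let n := mexp_index x t in constr:(S n)
  end.

Ltac mexp_mem x env :=
  lazymatch env with
  | x :: _ => constr:(true)
  | _ :: ?t => mexp_mem x t
  | [::] => constr:(false)
  end.

Ltac mexp_atoms env t :=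
  lazymatch t with
  | @GRing.add _ ?a ?b => let e := mexp_atoms env a in mexp_atoms e b
  | @GRing.opp _ ?a => mexp_atoms env a
  | @GRing.scale _ _ ?c ?a => mexp_atoms env a
  | @GRing.zero _ => env
  | _ => lazymatch mexp_mem t env with true => env | false => constr:(t :: env) end
  end.

Ltac mexp_reify R env t :=
  lazymatch t with
  | @GRing.add _ ?a ?b => let x := mexp_reify R env a in
      let y := mexp_reify R env b in constr:(@MAdd R x y)
  | @GRing.opp _ ?a => let x := mexp_reify R env a in constr:(@MOpp R x)
  | @GRing.scale _ _ ?c ?a => let x := mexp_reify R env a in constr:(@MScale R c x)
  | @GRing.zero _ => constr:(@MZero R)
  | _ => let n := mexp_index t env in constr:(@MVar R n)
  end.

(* Proves identities between linear combinations of vectors over [R]; the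
   coefficients are compared by [ring]. *)
Ltac lmod R :=
  lazymatch goal with
  | |- @eq ?T ?u ?v =>
    let e0 := mexp_atoms (@nil T) u in
    let env := mexp_atoms e0 v in
    let x := mexp_reify R env u in
    let y := mexp_reify R env v in
    change (@mexp_eval R _ env x = @mexp_eval R _ env y);
    apply: mexp_eq; cbn [size mexp_coefs_eq mexp_coef eqn];
    repeat split; ring
  end.

(** * Functions of class C^k *)

Section FrechetBasics.
Context {R : realType}.
Implicit Types E F G : normedModType R.

(** Turns the little-o definition of the derivative into an explicit estimate, the form in which
    derivatives are exhibited by hand below. *)
Lemma differentiable_of E F (f : E -> F) (x : E) (df : {linear E -> F}) :
  continuous df ->
  (forall e : R, 0 < e -> \forall h \near 0, `|f (h + x) - f x - df h| <= e * `|h|) ->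
  differentiable f x /\ 'd f x = df :> (E -> F).
Proof.
move=> dfc dfP.
have dfE : f \o shift x = cst (f x) + df +o_ 0 id.
  apply/eqaddoP => _/posnumP[e]; near=> h.
  have -> : (f \o shift x - (cst (f x) + df)) h = f (h + x) - f x - df h.
    by rewrite !fctE /= opprD addrA.
  by near: h; exact: dfP.
have dE := diff_unique dfc dfE.
split=> //; apply/diff_locallyP; rewrite dE; split => //.
Unshelve. all: by end_near. Qed.

Lemma differentiable_near E F (f : E -> F) (x : E) : differentiable f x ->
  forall e : R, 0 < e -> \forall h \near 0, `|f (h + x) - f x - 'd f x h| <= e * `|h|.
Proof.
move=> /diff_locally/eqaddoP H e e0; near=> h.
have -> : f (h + x) - f x - 'd f x h = (f \o shift x - (cst (f x) + 'd f x)) h.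
  by rewrite !fctE /= opprD addrA.
by near: h; exact: H.
Unshelve. all: by end_near. Qed.

Lemma near_eq_differentiable E F (f g : E -> F) x : (\near x, f x = g x) ->
  differentiable f x -> differentiable g x /\ 'd g x = 'd f x :> (E -> F).
Proof.
move=> fg dfx; have dc : continuous ('d f x) by exact: diff_continuous.
apply: differentiable_of => // e e0.
have fgx : f x = g x by exact: nbhs_singleton fg.
have fg' : \forall h \near 0, f (h + x) = g (h + x).
  by move: fg; rewrite (near_shift 0) /=; apply: filterS => y /=; rewrite subr0.
near=> h; rewrite -fgx.
rewrite -(near fg' h) //.
by near: h; exact: differentiable_near.
Unshelve. all: by end_near. Qed.

Lemma Ck_on_subset k E F (D D' : set E) (f : E -> F) :
  D' `<=` D -> Ck_on k D f -> Ck_on k D' f.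
Proof.
elim: k f => [|k IH] f DD /=; first by move=> cf x /DD; exact: cf.
by case=> df Df; split=> [x /DD|v]; [exact: df | exact: IH].
Qed.

(** Openness makes [f] and [g] agree near each point of [D], not only at it; hence their directional
    derivatives agree on [D] as well, and the induction continues with these. *)
Lemma Ck_on_eq k E F (D : set E) (f g : E -> F) :
  open D -> (forall x, D x -> f x = g x) -> Ck_on k D f -> Ck_on k D g.
Proof.
move=> oD; have nD P : (forall x, D x -> P x) -> forall x, D x -> \near x, P x.
  by move=> DP x Dx; near=> y; apply: DP; near: y; exact: open_nbhs_nbhs.
elim: k f g => [|k IH] f g fg /=.
  move=> cf x Dx; rewrite /prop_for /continuous_at -(fg x Dx).
  by apply: cvg_trans (cf x Dx); apply: near_eq_cvg; apply: nD x Dx => y /fg.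
case=> df Df; split=> [x Dx|v].
  by apply: (near_eq_differentiable _ (df x Dx)).1; apply: nD x Dx.
apply: IH (Df v) => x Dx; apply: near_eq_derive; exact: nD x Dx.
Unshelve. all: by end_near. Qed.

(** The Leibniz and chain rules leave undifferentiated factors next to derivatives; this lemma
    brings both to the same order in the inductions on [k]. *)
Lemma Ck_onS k E F (D : set E) (f : E -> F) : Ck_on k.+1 D f -> Ck_on k D f.
Proof.
elim: k f => [|k IH] f /= [df Df].
  by move=> x Dx; exact/differentiable_continuous/df.
by split=> // v; exact/IH/Df.
Qed.

Lemma Ck_on_cst k E F (D : set E) (a : F) : Ck_on k D (cst a).
Proof.
elim: k a => [|k IH] a /=; first by move=> x _; exact: cst_continuous.
split=> [x _|v]; first exact: differentiable_cst.
by under [X in Ck_on _ _ X]eq_fun do rewrite derive_cst; exact: IH.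
Qed.

Lemma Ck_onD k E F (D : set E) (f g : E -> F) : open D ->
  Ck_on k D f -> Ck_on k D g -> Ck_on k D (f \+ g).
Proof.
move=> oD; elim: k f g => [|k IH] f g /=.
  by move=> cf cg x Dx; apply: cvgD; [exact: cf|exact: cg].
move=> [df Df] [dg Dg]; split=> [x Dx|v].
  by apply: differentiableD; [exact: df|exact: dg].
apply: Ck_on_eq (IH _ _ (Df v) (Dg v)) => // x Dx.
by rewrite deriveD //; apply: diff_derivable; [exact: df|exact: dg].
Qed.

Lemma Ck_on_lin k E F G (D : set E) (f : E -> F) (l : {linear F -> G}) :
  open D -> continuous l -> Ck_on k D f -> Ck_on k D (l \o f).
Proof.
move=> oD lc; elim: k f => [|k IH] f /=.
  move=> cf x Dx; apply: continuous_comp; [exact: cf|exact: lc].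
have dl y : differentiable l y by exact: linear_differentiable.
move=> [df Df]; split=> [x Dx|v].
  by apply: differentiable_comp; [exact: df|exact: dl].
apply: Ck_on_eq (IH _ (Df v)) => // x Dx /=.
rewrite deriveE; last exact: df.
rewrite deriveE; last by apply: differentiable_comp; [exact: df|exact: dl].
have dlE : 'd l (f x) = l :> (F -> G) by exact: diff_lin.
by rewrite (diff_comp (df x Dx) (dl _)) /= dlE.
Qed.

Lemma Ck_on_id_lin k E F (D : set E) (l : {linear E -> F}) :
  continuous l -> Ck_on k D l.
Proof.
move=> lc; case: k => [|k] /=; first by move=> x _; exact: lc.
split=> [x _|v]; first exact: linear_differentiable.
suff -> : 'D_v l = cst (l v) by exact: Ck_on_cst.
apply/funext => x; rewrite deriveE; last exact: linear_differentiable.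
by rewrite diff_lin.
Qed.

Lemma Ck_onM k E (D : set E) (a : E -> R^o) (f : E -> R^o) : open D ->
  Ck_on k D a -> Ck_on k D f -> Ck_on k D (fun x => a x * f x).
Proof.
move=> oD; elim: k a f => [|k IH] f g /=.
  by move=> cf cg x Dx; apply: cvgM; [exact: cf|exact: cg].
move=> Cf Cg; case: (Cf) (Cg) => df Df [dg Dg]; split=> [x Dx|v].
  by apply: differentiableM; [exact: df|exact: dg].
have C1 := IH _ _ (Ck_onS Cf) (Dg v); have C2 := IH _ _ (Ck_onS Cg) (Df v).
apply: Ck_on_eq (Ck_onD oD C1 C2) => // x Dx /=.
by rewrite [in RHS]deriveM //; apply: diff_derivable; [exact: df|exact: dg].
Qed.

Lemma Ck_on_pair k E F G (D : set E) (f : E -> F) (g : E -> G) : open D ->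
  Ck_on k D f -> Ck_on k D g -> Ck_on k D (fun x => (f x, g x)).
Proof.
move=> oD; elim: k f g => [|k IH] f g /=.
  by move=> cf cg x Dx; apply: cvg_pair; [exact: cf|exact: cg].
move=> [df Df] [dg Dg]; split=> [x Dx|v].
  by apply: differentiable_pair; [exact: df|exact: dg].
apply: Ck_on_eq (IH _ _ (Df v) (Dg v)) => // x Dx.
rewrite [RHS]deriveE; last by apply: differentiable_pair; [exact: df|exact: dg].
rewrite diff_pair /=; [|exact: df|exact: dg].
by rewrite !deriveE //; [exact: dg|exact: df].
Qed.

Lemma Ck_onV k E (D : set E) (f : E -> R^o) : open D ->
  (forall x, D x -> f x != 0) -> Ck_on k D f -> Ck_on k D (fun x => (f x)^-1).
Proof.
move=> oD f0; elim: k f f0 => [|k IH] f f0 /=.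
  by move=> cf x Dx; apply: cvgV; [exact: f0|exact: cf].
move=> Cf; case: (Cf) => df Df; split=> [x Dx|v].
  by apply: differentiableV; [exact: df|exact: f0].
have CV := IH f f0 (Ck_onS Cf).
have C1 := Ck_onM oD (Ck_onM oD CV CV) (Df v).
have C2 := Ck_onM oD (Ck_on_cst k D (-1 : R^o)) C1.
apply: Ck_on_eq C2 => // x Dx; rewrite [in RHS]deriveV ?f0 //=.
  by rewrite /cst mulN1r -mulNr -expr2 exprVn.
by apply: diff_derivable; exact: df.
Qed.

End FrechetBasics.

(** * Finite-dimensional normed spaces and the chain rule for C^k maps *)

Section Findim.
Context {R : realType}.
Implicit Types E F G : normedModType R.

Lemma mx_continuousP (T : topologicalType) m n (f : T -> 'M[R]_(m, n)) x :
  {for x, continuous f} <-> forall i j, {for x, continuous (fun y => f y i j : R^o)}.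
Proof.
split=> [cf i j|cf].
  exact: continuous_comp cf (@coord_continuous _ _ _ i j (f x)).
apply/cvgrPdist_le => /= e e0; near=> y.
rewrite /Num.Def.normr/= mx_normrE (bigmax_le _ (ltW e0))//= => i _.
rewrite !mxE/=.
move: i; near: y; apply: filter_forall => /= i.
exact: ((cvgrPdist_le _ _).1 (cf i.1 i.2)).
Unshelve. all: by end_near. Qed.

Lemma mx_entry_le m n (A : 'M[R]_(m, n)) i j : `|A i j| <= `|A|.
Proof.
rewrite [leRHS]/Num.Def.normr/= mx_normrE.
exact: (le_bigmax _ (fun ij : 'I_m * 'I_n => `|A ij.1 ij.2|) (i, j)).
Qed.

Lemma mx_norm_le m n (A : 'M[R]_(m, n)) (e : R) :
  0 <= e -> (forall i j, `|A i j| <= e) -> `|A| <= e.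
Proof.
move=> e0 Ae; rewrite /Num.Def.normr/= mx_normrE.
by rewrite (bigmax_le _ e0)//= => -[i j] _; exact: Ae.
Qed.

Lemma sum_continuous (T : topologicalType) E (I : Type) (r : seq I) (f : I -> T -> E) x :
  (forall i, {for x, continuous (f i)}) ->
  {for x, continuous (fun y => \sum_(i <- r) f i y)}.
Proof.
move=> cf; elim: r => [|i r IH].
  rewrite (_ : (fun y => _) = cst 0); first exact: cst_continuous.
  by apply/funext => y; rewrite big_nil.
rewrite (_ : (fun y => _) = fun y => f i y + \sum_(j <- r) f j y); last first.
  by apply/funext => y; rewrite big_cons.
by apply: cvgD; [exact: cf|exact: IH].
Qed.

Lemma mx_linear_continuous m n E (l : {linear 'M[R]_(m, n) -> E}) : continuous l.
Proof.
have -> : l = (fun A => \sum_i \sum_j (A i j) *: l (delta_mx i j)) :> (_ -> _).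
  apply/funext => A; rewrite {1}(matrix_sum_delta A) linear_sum.
  by apply: eq_bigr => i _; rewrite linear_sum; under eq_bigr do rewrite linearZ.
move=> A; apply: sum_continuous => i; apply: sum_continuous => j.
have c : {for A, continuous (fun B : 'M[R]_(m, n) => B i j)} by exact: coord_continuous.
exact: (cvgZr_tmp (s := fun B : 'M[R]_(m, n) => B i j) c).
Qed.

(* Finite dimension as extra structure on a given normed space: the smoothness
   predicates are stated over a [normedModType], which a [vectType] need not be. *)
Class findim E := Findim {
  fdim : nat;
  fcoord : {linear E -> 'rV[R]_fdim};
  fvec : {linear 'rV[R]_fdim -> E};
  fcoord_continuous : continuous fcoord;
  fcoordK : cancel fcoord fvec;
  fvecK : cancel fvec fcoord }.

#[global] Arguments fdim E {_}.

Lemma fvec_continuous E {h : findim E} : continuous (fvec (E := E)).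
Proof. exact: mx_linear_continuous. Qed.

Definition fbase E {h : findim E} (i : 'I_(fdim E)) : E := fvec (delta_mx 0 i).
Definition fcoef E {h : findim E} (i : 'I_(fdim E)) (x : E) : R := fcoord x 0 i.

Lemma fcoef_sum E {h : findim E} (x : E) :
  x = \sum_i fcoef i x *: fbase i.
Proof.
rewrite -{1}(fcoordK x) {1}(row_sum_delta (fcoord x)) linear_sum.
by apply: eq_bigr => i _; rewrite linearZ.
Qed.

Lemma findim_linear_continuous E F {h : findim E} (l : {linear E -> F}) : continuous l.
Proof.
have -> : l = (l \o fvec) \o fcoord :> (E -> F).
  by apply/funext => x /=; rewrite fcoordK.
move=> x; apply: continuous_comp; first exact: fcoord_continuous.
exact: (@mx_linear_continuous _ _ _ (l \o fvec)).
Qed.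

#[global] Instance findim_mx m n : findim 'M[R]_(m, n).
Proof.
apply: (@Findim 'M[R]_(m, n) _ mxvec vec_mx).
- exact: mx_linear_continuous.
- exact: mxvecK.
- exact: vec_mxK.
Defined.

Definition R_coord (x : R^o) : 'rV[R]_1 := const_mx x.
Definition R_vec (x : 'rV[R]_1) : R^o := x 0 0.

Lemma R_coord_linear : linear R_coord.
Proof. by move=> a x y; apply/matrixP => i j; rewrite !mxE. Qed.

Lemma R_vec_linear : linear R_vec.
Proof. by move=> a x y; rewrite /R_vec !mxE. Qed.

HB.instance Definition _ := GRing.isLinear.Build R R^o 'rV[R]_1 _ R_coord R_coord_linear.
HB.instance Definition _ := GRing.isLinear.Build R 'rV[R]_1 R^o _ R_vec R_vec_linear.

Lemma R_coord_continuous : continuous R_coord.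
Proof.
move=> x; apply/mx_continuousP => i j.
rewrite (_ : (fun y => _) = id); first exact: cvg_id.
by apply/funext => y; rewrite /= mxE.
Qed.

Lemma R_coordK : cancel R_coord R_vec.
Proof. by move=> x; rewrite /R_vec mxE. Qed.

Lemma R_vecK : cancel R_vec R_coord.
Proof. by move=> x; apply/matrixP => i j; rewrite mxE !ord1. Qed.

#[global] Instance findim_R : findim (R^o : normedModType R) :=
  Findim R_coord_continuous R_coordK R_vecK.

Section Prod.
Context {E F} {hE : findim E} {hF : findim F}.

Definition prod_coord (x : E * F) := row_mx (fcoord x.1) (fcoord x.2).
Definition prod_vec (x : 'rV[R]_(fdim E + fdim F)) : E * F :=
  (fvec (lsubmx x), fvec (rsubmx x)).

Lemma prod_coord_linear : linear prod_coord.
Proof.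
by move=> a x y; rewrite /prod_coord !linearP /= scale_row_mx add_row_mx.
Qed.

Lemma prod_vec_linear : linear prod_vec.
Proof. by move=> a x y; rewrite /prod_vec !linearP. Qed.

HB.instance Definition _ := GRing.isLinear.Build R (E * F)%type _ _ prod_coord prod_coord_linear.
HB.instance Definition _ := GRing.isLinear.Build R _ (E * F)%type _ prod_vec prod_vec_linear.

Lemma prod_coord_continuous : continuous prod_coord.
Proof.
move=> x; apply/mx_continuousP => i j /=.
case: (splitP j) => k jk.
  have -> : j = lshift _ k by exact/val_inj.
  rewrite (_ : (fun y => _) = fun y => fcoord y.1 i k); last first.
    by apply/funext => y; rewrite row_mxEl.
  apply: (@continuous_comp _ _ _ fst (fun z : E => fcoord z i k)).
    exact: cvg_fst.
  by have /mx_continuousP := @fcoord_continuous E hE x.1; apply.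
have -> : j = rshift _ k by exact/val_inj.
rewrite (_ : (fun y => _) = fun y => fcoord y.2 i k); last first.
  by apply/funext => y; rewrite row_mxEr.
apply: (@continuous_comp _ _ _ snd (fun z : F => fcoord z i k)).
  exact: cvg_snd.
by have /mx_continuousP := @fcoord_continuous F hF x.2; apply.
Qed.

Lemma prod_coordK : cancel prod_coord prod_vec.
Proof. by move=> [x y]; rewrite /prod_vec row_mxKl row_mxKr !fcoordK. Qed.

Lemma prod_vecK : cancel prod_vec prod_coord.
Proof. by move=> x; rewrite /prod_coord /= !fvecK hsubmxK. Qed.

#[global] Instance findim_prod : findim (E * F : normedModType R)%type :=
  Findim prod_coord_continuous prod_coordK prod_vecK.

End Prod.

Lemma scaler_is_bilinear E : bilinear_for
    (GRing.Scale.Law.clone _ _ *:%R _) (GRing.Scale.Law.clone _ _ *:%R _)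
    (fun (k : R^o) (x : E) => k *: x : E).
Proof.
split=> [u'|u] a x y /=; first by rewrite scalerDl scalerA.
by rewrite scalerDr !scalerA mulrC.
Qed.

(** Differentiating [b (f x) (g x)] gives two terms of the same shape, so the induction on [k] runs
    for all [f] and [g] at once. *)
Lemma Ck_on_bilin k E F F' G (b : {bilinear F -> F' -> G}) (D : set E)
    (f : E -> F) (g : E -> F') :
  open D -> continuous (fun p : F * F' => b p.1 p.2) ->
  Ck_on k D f -> Ck_on k D g -> Ck_on k D (fun x => b (f x) (g x)).
Proof.
move=> oD cb; elim: k f g => [|k IH] f g /=.
  move=> cf cg x Dx.
  apply: (@continuous_comp _ _ _ (fun x => (f x, g x)) (fun p : F * F' => b p.1 p.2)).
    by apply: cvg_pair; [exact: cf|exact: cg].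
  exact: cb.
move=> Cf Cg; case: (Cf) (Cg) => df Df [dg Dg].
have dfg x : D x -> differentiable (fun x => (f x, g x)) x.
  by move=> Dx; apply: differentiable_pair; [exact: df|exact: dg].
have db p : differentiable (fun p : F * F' => b p.1 p.2) p.
  exact: differentiable_bilin.
split=> [x Dx|v].
  exact: (differentiable_comp (dfg x Dx) (db _)).
have C1 := IH _ _ (Ck_onS Cf) (Dg v); have C2 := IH _ _ (Df v) (Ck_onS Cg).
apply: Ck_on_eq (Ck_onD oD C1 C2) => // x Dx /=.
rewrite [in RHS]deriveE; last exact: (differentiable_comp (dfg x Dx) (db _)).
rewrite (diff_comp (dfg x Dx) (db _)) /= diff_bilin //.
have -> : 'd (fun x => (f x, g x)) x v = ('D_v f x, 'D_v g x).
  rewrite diff_pair /=; [|exact: df|exact: dg].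
  by rewrite !deriveE //; [exact: dg|exact: df].
by [].
Qed.

Lemma Ck_onZ k E F (D : set E) (a : E -> R^o) (f : E -> F) : open D ->
  Ck_on k D a -> Ck_on k D f -> Ck_on k D (fun x => a x *: f x).
Proof.
move=> oD.
pose b : {bilinear R^o -> F -> F} := HB.pack (fun (k : R^o) (x : F) => k *: x : F)
  (bilinear_isBilinear.Build R R^o F F _ _ _ (@scaler_is_bilinear F)).
by apply: (@Ck_on_bilin k E R^o F F b) => //; exact: scale_continuous.
Qed.

Lemma Ck_on_sum k E F (D : set E) (I : Type) (r : seq I) (f : I -> E -> F) : open D ->
  (forall i, Ck_on k D (f i)) -> Ck_on k D (fun x => \sum_(i <- r) f i x).
Proof.
move=> oD Cf; elim: r => [|i r IH].
  under [X in Ck_on _ _ X]eq_fun do rewrite big_nil.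
  exact: Ck_on_cst.
under [X in Ck_on _ _ X]eq_fun do rewrite big_cons.
by apply: Ck_onD.
Qed.

Lemma Ck_on_prod k E (D : set E) (I : Type) (r : seq I) (f : I -> E -> R^o) : open D ->
  (forall i, Ck_on k D (f i)) -> Ck_on k D (fun x => \prod_(i <- r) f i x : R^o).
Proof.
move=> oD Cf; elim: r => [|i r IH].
  under [X in Ck_on _ _ X]eq_fun do rewrite big_nil.
  exact: Ck_on_cst.
under [X in Ck_on _ _ X]eq_fun do rewrite big_cons.
exact: (@Ck_onM _ _ _ _ (f i)).
Qed.

Lemma diff_sum_fbase E F {h : findim E} (f : E -> F) x v : differentiable f x ->
  'D_v f x = \sum_i fcoef i v *: 'D_(fbase i) f x.
Proof.
move=> df; rewrite deriveE // {1}(fcoef_sum v) linear_sum.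
by apply: eq_bigr => i _; rewrite linearZ /= deriveE.
Qed.

Lemma fcoef_linear E {h : findim E} i : linear (fcoef i : E -> R^o).
Proof. by move=> a x y; rewrite /fcoef linearP !mxE. Qed.

Lemma Ck_on_fcoef k E F {h : findim F} i (D : set E) (f : E -> F) :
  open D -> Ck_on k D f -> Ck_on k D (fun x => fcoef i (f x) : R^o).
Proof.
move=> oD Cf.
pose l : {linear F -> R^o} := HB.pack (fcoef i : F -> R^o)
  (GRing.isLinear.Build _ _ _ _ _ (fcoef_linear i)).
by apply: (@Ck_on_lin _ k E F R^o D f l) => //; exact: findim_linear_continuous.
Qed.

(** [Ck_on] speaks of derivatives in fixed directions, whereas the chain rule differentiates [g] in
    the moving direction ['D_v f x]. A basis of [F] separates the two: the moving direction enters
    through scalar coefficients, the derivatives of [g] through fixed basis vectors. *)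
Lemma Ck_on_comp k E F G {h : findim F} (D : set E) (D' : set F) (g : F -> G) (f : E -> F) :
  open D -> (forall x, D x -> D' (f x)) ->
  Ck_on k D' g -> Ck_on k D f -> Ck_on k D (g \o f).
Proof.
move=> oD DD'; elim: k g => [|k IH] g /=.
  by move=> cg cf x Dx; apply: continuous_comp; [exact: cf|apply/cg/DD'].
move=> [dg Dg] Cf; case: (Cf) => df Df; split=> [x Dx|v].
  by apply: differentiable_comp; [exact: df|exact/dg/DD'].
have C : Ck_on k D (fun x => \sum_i fcoef i ('D_v f x) *: ('D_(fbase i) g \o f) x).
  apply: Ck_on_sum => // i; apply: Ck_onZ => //; first exact: Ck_on_fcoef.
  exact: IH (Ck_onS Cf).
apply: Ck_on_eq C => // x Dx /=.
rewrite [in RHS]deriveE; last by apply: differentiable_comp; [exact: df|exact/dg/DD'].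
have dgx := dg _ (DD' _ Dx).
rewrite (diff_comp (df x Dx) dgx) /= -(deriveE v (df x Dx)).
by rewrite -deriveE // (diff_sum_fbase _ dgx).
Qed.

Lemma Ck_on_mx k E m n (D : set E) (f : E -> 'M[R]_(m, n)) : open D ->
  (forall i j, Ck_on k D (fun x => f x i j : R^o)) -> Ck_on k D f.
Proof.
move=> oD Cf.
have C : Ck_on k D (fun x => \sum_i \sum_j f x i j *: delta_mx i j : 'M[R]_(m, n)).
  apply: Ck_on_sum => // i; apply: Ck_on_sum => // j; apply: Ck_onZ => //.
  exact: Ck_on_cst.
by apply: Ck_on_eq C => // x _; rewrite -matrix_sum_delta.
Qed.

Lemma mx_entry_linear m n i j : linear (fun A : 'M[R]_(m, n) => A i j : R^o).
Proof. by move=> a x y; rewrite !mxE. Qed.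

Lemma Ck_on_entry k E m n i j (D : set E) (f : E -> 'M[R]_(m, n)) : open D ->
  Ck_on k D f -> Ck_on k D (fun x => f x i j : R^o).
Proof.
move=> oD Cf.
pose l : {linear 'M[R]_(m, n) -> R^o} := HB.pack (fun A : 'M[R]_(m, n) => A i j : R^o)
  (GRing.isLinear.Build _ _ _ _ _ (mx_entry_linear i j)).
by apply: (@Ck_on_lin _ k E _ R^o D f l) => //; exact: findim_linear_continuous.
Qed.

End Findim.

(** * The mean value inequality for vector-valued functions *)

Section MeanValue.
Context {R : realType}.
Implicit Types E F G : normedModType R.

Lemma is_deriveP E F (f : E -> F) x v d :
  is_derive x v f d <->
  forall e : R, 0 < e -> \forall h \near (0 : R), `|f (x + h *: v) - f x - h *: d| <= e * `|h|.
Proof.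
have eqv : is_derive x v f d <->
    (fun h : R => h^-1 *: (f (h *: v + x) - f x)) @ 0^' --> d.
  split=> [[dv dE]|H]; first by rewrite -dE; exact: dv.
  split; first by apply/cvg_ex; exists d.
  by rewrite /derive; apply: cvg_lim.
rewrite eqv; split=> [/cvgrPdist_le H e e0|H].
  have := H e e0; rewrite near_withinE => He.
  near=> h; have [->|h0] := eqVneq h 0.
    by rewrite !scale0r addr0 subrr subr0 !normr0 mulr0.
  have Hh : `|d - h^-1 *: (f (h *: v + x) - f x)| <= e by apply: (near He h).
  have -> : f (x + h *: v) - f x - h *: d =
      - (h *: (d - h^-1 *: (f (h *: v + x) - f x))).
    by rewrite scalerBr scalerA divff // scale1r opprB addrC [x + _]addrC [RHS]addrC.
  by rewrite normrN normrZ mulrC ler_wpM2r.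
apply/cvgrPdist_le => e e0; rewrite near_withinE.
near=> h => h0; rewrite -(@ler_pM2r _ `|h|) ?normr_gt0 //.
have -> : `|d - h^-1 *: (f (h *: v + x) - f x)| * `|h| =
    `|f (x + h *: v) - f x - h *: d|.
  rewrite mulrC -normrZ scalerBr scalerA divff // scale1r -normrN opprB.
  by rewrite [x + _]addrC.
by near: h; exact: H.
Unshelve. all: by end_near. Qed.

Lemma is_derive_line E F (f : E -> F) (x v : E) (s : R) d :
  is_derive (x + s *: v) v f d -> is_derive s 1 (fun t : R => f (x + t *: v)) d.
Proof.
move=> /is_deriveP H; apply/is_deriveP => e e0.
have := H e e0; apply: filterS => h.
have -> : x + s *: v + h *: v = x + (s + h%:A) *: v by rewrite [h%:A]mulr1; lmod R.
by [].
Qed.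

Lemma diff_is_derive E F (f : E -> F) x v :
  differentiable f x -> is_derive x v f ('d f x v).
Proof. by move=> df; split; [exact: diff_derivable|exact: deriveE]. Qed.

Lemma is_derive_continuous1 F (f : R -> F) (t : R) d :
  is_derive t 1 f d -> {for t, continuous f}.
Proof. by move=> [dv _]; apply/differentiable_continuous/derivable1_diffP. Qed.

(** Equality in the mean value theorem fails for vector values, so a continuation argument is used:
    the estimate with the slightly larger slope [C + e] holds up to a largest time, and
    differentiability there would extend it further unless that time is [b]. *)
Lemma mvt_norm_le F (f df : R -> F) (a b C : R) : a <= b ->
  (forall t, a <= t <= b -> is_derive t 1 f (df t)) ->
  (forall t, a <= t <= b -> `|df t| <= C) ->
  `|f b - f a| <= C * (b - a).
Proof.
move=> ab fd dC; apply/ler_addgt0Pr => _/posnumP[e0].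
(* Over the whole interval the extra slope costs at most [e0]; adding 1 keeps the denominator
   positive when [a = b]. *)
pose e : R := e0%:num / (b - a + 1).
have ba0 : 0 <= b - a by rewrite subr_ge0.
have e_gt0 : 0 < e by rewrite divr_gt0 // ltr_wpDl.
suff : `|f b - f a| <= (C + e) * (b - a).
  move=> /le_trans; apply; rewrite mulrDl lerD2l.
  rewrite /e mulrAC ler_pdivrMr ?ltr_wpDl // ler_wpM2l //.
  by rewrite lerDl.
pose A := [set t | a <= t <= b /\ forall s, a <= s <= t ->
   `|f s - f a| <= (C + e) * (s - a)].
have Aa : A a.
  split; first by rewrite lexx.
  by move=> s /le_anti ->; rewrite !subrr normr0 mulr0.
have hA : has_sup A by split; [exists a|exists b => t [/andP[]]].
pose c := sup A.
have ac : a <= c by apply: ub_le_sup => //; case: hA.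
have cb : c <= b by apply: ge_sup; [case: hA|move=> t [/andP[]]].
have cab : a <= c <= b by rewrite ac cb.
have below s : a <= s -> s < c -> `|f s - f a| <= (C + e) * (s - a).
  move=> as_ sc; have [t [_ At] st] := sup_adherent (eps := c - s) ltac:(by rewrite subr_gt0) hA.
  by apply: At; rewrite as_ /=; apply/ltW; rewrite (le_lt_trans _ st) // subKr.
have Ac : A c.
  split=> // s /andP[as_]; rewrite le_eqVlt => /orP[/eqP ->|]; last exact: below.
  have cf : {for c, continuous f} := is_derive_continuous1 (fd _ cab).
  move: ac; rewrite le_eqVlt => /orP[/eqP <-|ac'].
    by rewrite !subrr normr0 mulr0.
  have H1 : (fun s => `|f s - f a|) @ c^'- --> `|f c - f a|.
    apply: cvg_at_left_filter; apply: cvg_norm; apply: cvgB; [exact: cf|exact: cvg_cst].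
  have H2 : (fun s => (C + e) * (s - a)) @ c^'- --> (C + e) * (c - a).
    apply: cvg_at_left_filter; apply: cvgM; [exact: cvg_cst|apply: cvgB; [exact: cvg_id|exact: cvg_cst]].
  apply: ler_cvg_to H1 H2 _; near=> z; apply: below; last by near: z; exact: nbhs_left_lt.
  by near: z; exact: nbhs_left_ge.
move: cb; rewrite le_eqVlt => /orP[/eqP cbE|cb].
  by case: Ac => _; rewrite -cbE; apply; rewrite ac lexx.
exfalso; have /is_deriveP/(_ e e_gt0)/nbhs_ballP[d /= d0 dP] := fd c cab.
(* If [c < b], the estimate also holds on [[c, c + h]], where the derivative at [c] controls [f] up
   to the error [e]; then [c + h] lies in [A] beyond its supremum. *)
pose h := Num.min (d / 2) (b - c).
have h0 : 0 < h by rewrite lt_min divr_gt0 //= subr_gt0.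
suff : A (c + h).
  move=> /(ub_le_sup hA.2); by rewrite -/c gerDl leNgt h0.
split.
  rewrite (le_trans ac) ?lerDl ?(ltW h0) //= -lerBrDl.
  by rewrite ge_min lexx orbT.
move=> s /andP[as_ sch]; have [sc|cs] := leP s c.
  by case: Ac => _; apply; rewrite as_.
have dsc : ball (0 : R) d (s - c).
  rewrite /ball /= sub0r normrN ger0_norm ?subr_ge0 ?(ltW cs) //.
  rewrite ltrBlDl (le_lt_trans sch) // ltrD2l.
  have : h <= d / 2 by rewrite ge_min lexx.
  by move=> hd; rewrite (le_lt_trans hd) //; lra.
have csE : c + (s - c)%:A = s by rewrite [X in _ + X]mulr1 addrC subrK.
have := dP _ dsc; rewrite /= csE => H.
have -> : f s - f a = (f s - f c - (s - c) *: df c) + (s - c) *: df c + (f c - f a).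
  by rewrite subrK addrA subrK.
have cs0 : 0 <= s - c by rewrite subr_ge0 ltW.
rewrite (le_trans (ler_normD _ _)) //.
have -> : (C + e) * (s - a) = (C + e) * (s - c) + (C + e) * (c - a) by ring.
apply: lerD; last by case: Ac => _; apply; rewrite ac lexx.
rewrite (le_trans (ler_normD _ _)) // addrC mulrDl; apply: lerD.
  by rewrite normrZ ger0_norm // mulrC ler_wpM2r // dC.
by rewrite (le_trans H) // ger0_norm.
Unshelve. all: by end_near. Qed.

(** Subtracting [t *: w] reduces this to the previous inequality. The two conditions on [t] say that
    it lies between [a] and [b], whichever of the two is larger, so the endpoints can be
    exchanged. *)
Lemma mvt_norm F (f df : R -> F) (w : F) (a b C : R) :
  (forall t, `|t - a| <= `|b - a| -> `|t - b| <= `|b - a| -> is_derive t 1 f (df t)) ->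
  (forall t, `|t - a| <= `|b - a| -> `|t - b| <= `|b - a| -> `|df t - w| <= C) ->
  `|f b - f a - (b - a) *: w| <= C * `|b - a|.
Proof.
wlog ab : a b / a <= b => [H|].
  have [|/ltW ba] := leP a b; first exact: H.
  move=> fd dC; rewrite (distrC b a).
  have -> : f b - f a - (b - a) *: w = - (f a - f b - (a - b) *: w).
    by rewrite opprB opprB addrC -scaleNr opprB addrC.
  rewrite normrN; apply: H => // t H1 H2; [apply: fd|apply: dC]; by rewrite (distrC b a).
rewrite (ger0_norm (_ : 0 <= b - a)) ?subr_ge0 // => fd dC.
have Ht t : a <= t <= b -> `|t - a| <= b - a /\ `|t - b| <= b - a.
  move=> /andP[H1 H2]; rewrite ger0_norm ?subr_ge0 // distrC ger0_norm ?subr_ge0 //.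
  by rewrite lerD2r lerD2l lerN2.
have := @mvt_norm_le F (fun t => f t - t *: w) (fun t => df t - w) a b C ab.
have -> : f b - b *: w - (f a - a *: w) = f b - f a - (b - a) *: w.
  by lmod R.
apply => t /Ht [H1 H2]; last exact: dC.
apply: is_deriveB; first exact: fd.
apply/is_deriveP => e e0; near=> h.
have -> : (t + h%:A) *: w - t *: w - h *: w = 0 by rewrite [h%:A]mulr1; lmod R.
by rewrite normr0 mulr_ge0 // ltW.
Unshelve. all: by end_near. Qed.

Lemma mvt_seg E F (f : E -> F) (x y : E) (w : F) (C : R) :
  (forall s : R, 0 <= s <= 1 -> differentiable f (x + s *: (y - x))) ->
  (forall s : R, 0 <= s <= 1 -> `|'d f (x + s *: (y - x)) (y - x) - w| <= C) ->
  `|f y - f x - w| <= C.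
Proof.
move=> fd dC.
have := @mvt_norm F (fun s => f (x + s *: (y - x)))
  (fun s => 'd f (x + s *: (y - x)) (y - x)) w 0 1 C.
rewrite subr0 normr1 mulr1 !scale1r scale0r addr0 [x + (y - x)]addrC subrK.
move=> H; apply: H => t; rewrite subr0 => H1 H2.
  apply: is_derive_line; apply: diff_is_derive; apply: fd.
  by move: H1 H2; rewrite !ler_norml => /andP[? ?] /andP[? ?]; lra.
by apply: dC; move: H1 H2; rewrite !ler_norml => /andP[? ?] /andP[? ?]; lra.
Qed.

Lemma mvt_seg0 E F (f : E -> F) (x y : E) (C : R) :
  (forall s : R, 0 <= s <= 1 -> differentiable f (x + s *: (y - x))) ->
  (forall s : R, 0 <= s <= 1 -> `|'d f (x + s *: (y - x)) (y - x)| <= C) ->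
  `|f y - f x| <= C.
Proof.
move=> fd dC; rewrite -[_ - _]subr0; apply: mvt_seg => // s s01.
by rewrite subr0; exact: dC.
Qed.

Lemma fcoef_bound E {h : findim E} : exists2 K : R, 0 < K &
  forall (x : E) i, `|fcoef i x| <= K * `|x|.
Proof.
have [K K0 H] := linear_lipschitz (@fcoord_continuous R E h).
exists K => // x i; apply: le_trans (H x); exact: mx_entry_le.
Qed.

End MeanValue.

(** * Continuous partial derivatives and uniform bounds on compact sets *)

Section Partials.
Context {R : realType}.
Implicit Types E F G : normedModType R.

Lemma open_ball_sub E (D : set E) x : open D -> D x ->
  exists2 r : R, 0 < r & forall y, `|y - x| < r -> D y.
Proof.
move=> oD Dx; have /nbhs_ballP[r /= r0 rD] : nbhs x D by exact: open_nbhs_nbhs.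
by exists r => // y yx; apply: rD; rewrite -ball_normE /= distrC.
Qed.

Lemma open_norm_lt E (z : E) (d : R) : open [set y : E | `|y - z| < d].
Proof.
apply: (@open_comp _ _ (fun a : E => `|a - z|) [set x | x < d]); last exact: open_lt.
by move=> a _; apply: cvg_norm; apply: cvgB; [exact: cvg_id|exact: cvg_cst].
Qed.

Lemma cont_ball E F (f : E -> F) x (e : R) : {for x, continuous f} -> 0 < e ->
  exists2 d : R, 0 < d & forall y, `|y - x| < d -> `|f y - f x| <= e.
Proof.
move=> /cvgrPdist_le H e0; have /nbhs_ballP[d /= d0 dP] := H e e0.
exists d => // y yx; rewrite distrC; apply: dP.
by rewrite -ball_normE /= distrC.
Qed.

Lemma cont_of_ball E F (f : E -> F) x :
  (forall e : R, 0 < e -> exists2 d : R, 0 < d & forall y, `|y - x| < d -> `|f y - f x| <= e) ->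
  {for x, continuous f}.
Proof.
move=> H; apply/cvgrPdist_le => e e0; have [d d0 dP] := H e e0.
apply/nbhs_ballP; exists d => // y; rewrite -ball_normE /= distrC => /dP.
by rewrite distrC.
Qed.

Lemma fsum_norm_le E {h : findim E} : exists2 K : R, 0 < K &
  forall (x : E), \sum_i `|fcoef i x| * `|fbase (E := E) i| <= K * `|x|.
Proof.
have [K K0 HK] := fcoef_bound (E := E).
pose M := \sum_(i < @fdim R E h) `|fbase (h := h) i|.
have M0 : 0 <= M by exact: sumr_ge0.
exists (K * M + 1); first by rewrite ltr_wpDl // mulr_ge0 // ltW.
move=> x; apply: (@le_trans _ _ (K * M * `|x|)).
  rewrite mulrAC mulr_sumr; apply: ler_sum => i _; exact: ler_wpM2r.
by rewrite ler_wpM2r // lerDl.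
Qed.

(** The increment [v] is travelled one coordinate at a time. On each leg [mvt_norm] compares the
    change of [f] with the partial derivative at [x], and continuity of the partial derivatives
    makes the discrepancy small. *)
Lemma differentiable_partial E F {h : findim E} (f : E -> F) (D : set E) : open D ->
  (forall x i, D x -> derivable f x (fbase i)) ->
  (forall x i, D x -> {for x, continuous ('D_(fbase i) f)}) ->
  forall x, D x -> differentiable f x.
Proof.
move=> oD fd fc x Dx.
pose l (v : E) : F := \sum_i fcoef (h := h) i v *: 'D_(fbase (h := h) i) f x.
have ll : linear l.
  move=> a u v; rewrite /l scaler_sumr -big_split; apply: eq_bigr => i _ /=.
  by rewrite scalerA -scalerDl; congr (_ *: _); rewrite /fcoef linearP !mxE.
pose L : {linear E -> F} := HB.pack l (GRing.isLinear.Build _ _ _ _ _ ll).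
apply: (differentiable_of (df := L) _ _).1; first exact: findim_linear_continuous.
move=> e e0.
have [K K0 HK] := fcoef_bound (E := E).
have [r r0 rD] := open_ball_sub oD Dx.
have [M M0 HM] := fsum_norm_le (E := E).
have [C C0 HC] := fcoef_bound (E := E).
pose n := @fdim R E h.
(* Each of the [n] legs has coordinate length at most [C * |v|], so errors of rate [e'] add up to at
   most [e * |v|]. *)
pose e' := e / (n%:R * C + 1).
have nC : 0 < n%:R * C + 1 by rewrite ltr_wpDl // mulr_ge0 // ltW.
have e'0 : 0 < e' by rewrite divr_gt0.
have Hd i : exists2 d : R, 0 < d &
    forall y, `|y - x| < d -> `|'D_(fbase i) f y - 'D_(fbase i) f x| <= e'.
  by apply: cont_ball => //; exact: fc.
have [d d0 dP] : exists2 d : R, 0 < d & forall y i, `|y - x| < d ->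
    `|'D_(fbase i) f y - 'D_(fbase i) f x| <= e'.
  have H : \forall d \near 0^'+, forall i : 'I_n, forall y, `|y - x| < d ->
      `|'D_(fbase i) f y - 'D_(fbase i) f x| <= e'.
    apply: filter_forall => i; have [d d0 dP] := Hd i.
    near=> z => y yz; apply: dP; apply: lt_le_trans yz _.
    by near: z; exact: nbhs_right_le.
  near (0 : R)^'+ => d; exists d => //.
  by move=> y i; move: i y; near: d.
near=> v; rewrite [v + x]addrC.
have vs : M * `|v| < Num.min r d.
  rewrite mulrC -ltr_pdivlMr //; near: v; apply: nbhs0_lt.
  by rewrite divr_gt0 // lt_min r0.
pose c i := fcoef (h := h) i v.
(* The corner reached after the first [k] coordinates of [v] have been travelled. *)
pose p k : E := \sum_(i < n | (i < k)%N) c i *: fbase (h := h) i.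
have pE k (kn : (k < n)%N) : p k.+1 = p k + c (Ordinal kn) *: fbase (Ordinal kn).
  rewrite /p (bigD1 (Ordinal kn)) //= addrC; congr (_ + _); apply: eq_bigl => i.
  by rewrite ltnS -val_eqE /=; case: ltngtP.
(* Every point visited stays within [M * |v|] of [x]: the coordinates used so far are part of a sum
   that [M * |v|] dominates term by term. *)
have p_norm k (s : R) (kn : (k < n)%N) : `|s| <= `|c (Ordinal kn)| ->
    `|p k + s *: fbase (Ordinal kn)| <= M * `|v|.
  move=> sc; apply: le_trans (HM v).
  rewrite (bigID (fun i : 'I_n => (i < k)%N)) /=.
  apply: le_trans (ler_normD _ _) _; apply: lerD.
    apply: le_trans (ler_norm_sum _ _ _) _; apply: ler_sum => i _.
    by rewrite normrZ.
  rewrite (bigD1 (Ordinal kn)) /= -?leqNgt //.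
  rewrite normrZ ler_wpDr ?ler_wpM2r //.
  by apply: sumr_ge0 => i _; rewrite mulr_ge0.
have step k (kn : (k <= n)%N) :
    `|f (x + p k) - f x - \sum_(i < n | (i < k)%N) c i *: 'D_(fbase i) f x|
    <= k%:R * (C * `|v| * e').
  elim: k kn => [|k IH] kn.
    by rewrite /p !big_pred0 // addr0 subrr subr0 normr0 mul0r.
  set o := Ordinal kn.
  have -> : \sum_(i < n | (i < k.+1)%N) c i *: 'D_(fbase i) f x =
     \sum_(i < n | (i < k)%N) c i *: 'D_(fbase i) f x + c o *: 'D_(fbase o) f x.
    rewrite (bigD1 o) //= addrC; congr (_ + _); apply: eq_bigl => i.
    by rewrite ltnS -val_eqE /=; case: ltngtP.
  have mv : `|f (x + p k.+1) - f (x + p k) - c o *: 'D_(fbase o) f x| <= e' * `|c o|.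
    have := @mvt_norm _ F (fun s => f (x + p k + s *: fbase o))
      (fun s => 'D_(fbase o) f (x + p k + s *: fbase o)) ('D_(fbase o) f x) 0 (c o) e'.
    rewrite scale0r addr0 subr0 pE -/o addrA => H; apply: H => t t1 _.
      rewrite subr0 in t1.
      apply: is_derive_line; apply/derivableP; apply: fd; apply: rD.
      have -> : x + p k + t *: fbase (h := h) o - x = p k + t *: fbase (h := h) o by lmod R.
      by rewrite (le_lt_trans (p_norm _ _ kn t1)) // (lt_le_trans vs) // ge_min lexx.
    rewrite subr0 in t1; apply: dP; have -> : x + p k + t *: fbase (h := h) o - x = p k + t *: fbase (h := h) o by lmod R.
    by rewrite (le_lt_trans (p_norm _ _ kn t1)) // (lt_le_trans vs) // ge_min lexx orbT.
  set S := \sum_(i < n | _) _ in IH *.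
  have -> : f (x + p k.+1) - f x - (S + c o *: 'D_(fbase o) f x) =
     (f (x + p k) - f x - S) + (f (x + p k.+1) - f (x + p k) - c o *: 'D_(fbase o) f x).
    by lmod R.
  rewrite (le_trans (ler_normD _ _)) // -natr1 mulrDl mul1r; apply: lerD.
    by apply: IH; exact: ltnW.
  by apply: le_trans mv _; rewrite mulrC; apply: ler_wpM2r; [exact: ltW|exact: HC].
have := step n (leqnn n).
have -> : p n = v.
  by rewrite [RHS]fcoef_sum; apply: eq_bigl => i; rewrite ltn_ord.
have -> : \sum_(i < n | (i < n)%N) c i *: 'D_(fbase i) f x = L v.
  by apply: eq_bigl => i; rewrite ltn_ord.
move=> /le_trans; apply.
have -> : n%:R * (C * `|v| * e') = e' * (n%:R * C) * `|v| by ring.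
rewrite ler_wpM2r // /e' mulrAC ler_pdivrMr // ler_wpM2l ?(ltW e0) //.
by rewrite lerDl.
Unshelve. all: by end_near. Qed.

(** [Ck_on] quantifies over all directions; the basis directions suffice, since the others are
    combinations of them with constant coefficients. *)
Lemma Ck_on_partial k E F {h : findim E} (f : E -> F) (D : set E) : open D ->
  (forall x i, D x -> derivable f x (fbase i)) ->
  (forall i, Ck_on k D ('D_(fbase i) f)) -> Ck_on k.+1 D f.
Proof.
move=> oD fd fc.
have df : forall x, D x -> differentiable f x.
  apply: (@differentiable_partial E F h f D) => // x i Dx.
  move: (fc i); case: (k) => [|k'] /=; first exact.
  by move=> [dd _]; exact/differentiable_continuous/dd.
split => // v.
have C : Ck_on k D (fun x => \sum_i fcoef i v *: 'D_(fbase i) f x).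
  apply: Ck_on_sum => // i; apply: Ck_onZ => //; exact: Ck_on_cst.
apply: Ck_on_eq C => // x Dx; rewrite [RHS](diff_sum_fbase _ (df x Dx)) //.
Qed.

(** The ball is a closed part of the image under [fvec] of a ball of row vectors, and closed bounded
    sets of row vectors are compact. *)
Lemma findim_ball_compact E {h : findim E} (r : R) : compact [set x : E | `|x| <= r].
Proof.
have [K K0 HK] := linear_lipschitz (@fcoord_continuous R E h).
pose B := [set v : 'rV[R]_(@fdim R E h) | `|v| <= K * r].
have cB : compact B.
  apply: bounded_closed_compact.
    exists (K * r); split; first exact: num_real.
    by move=> x rx v /le_trans; apply; exact: ltW.
  apply: (@closed_comp _ _ (fun v : 'rV[R]_(fdim E) => `|v|) [set x | x <= K * r]).
    by move=> v _; exact: norm_continuous.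
  exact: closed_le.
have cI : compact (fvec (E := E) @` B).
  apply: continuous_compact => //; apply: continuous_subspaceT; exact: fvec_continuous.
apply: subclosed_compact cI _.
  apply: (@closed_comp _ _ (fun v : E => `|v|) [set x | x <= r]).
    by move=> v _; exact: norm_continuous.
  exact: closed_le.
move=> x /= xr; exists (fcoord x); last by rewrite fcoordK.
by rewrite /B /= (le_trans (HK x)) // ler_wpM2l // ltW.
Qed.

Lemma findim_closed_ball_compact E {h : findim E} (x0 : E) (r : R) :
  compact [set x : E | `|x - x0| <= r].
Proof.
have -> : [set x | `|x - x0| <= r] = (fun y => x0 + y) @` [set y : E | `|y| <= r].
  apply/seteqP; split=> [x /= xr|_ [y /= yr <-]]; last by rewrite /= addrC addKr.
  by exists (x - x0) => //; rewrite addrC subrK.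
apply: continuous_compact; last exact: findim_ball_compact.
apply: continuous_subspaceT => y; apply: cvgD; [exact: cvg_cst|exact: cvg_id].
Qed.

(** Convexity, written with the points at which [mvt_seg] evaluates the derivative. *)
Definition segment_closed E (B : set E) :=
  forall x y (s : R), B x -> B y -> 0 <= s <= 1 -> B (x + s *: (y - x)).

Lemma ball_segment_closed E (x : E) (r : R) : segment_closed [set y | `|y - x| <= r].
Proof.
move=> y z s /= yx zx /andP[s0 s1].
have -> : y + s *: (z - y) - x = (1 - s) *: (y - x) + s *: (z - x) by lmod R.
rewrite (le_trans (ler_normD _ _)) // !normrZ !ger0_norm ?subr_ge0 //.
have -> : r = (1 - s) * r + s * r by ring.
by apply: lerD; rewrite ler_wpM2l // subr_ge0.
Qed.

Lemma compact_cont_bound E F (B : set E) (f : E -> F) : compact B ->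
  (forall x, B x -> {for x, continuous f}) ->
  exists2 C : R, 0 < C & forall x, B x -> `|f x| <= C.
Proof.
move=> cB fc.
have : compact (f @` B).
  apply: continuous_compact => //; apply: continuous_in_subspaceT => x.
  by rewrite inE; exact: fc.
move=> /compact_bounded [M [_ HM]].
exists (`|M| + 1); first by rewrite ltr_wpDl.
move=> x Bx; apply: HM; last by exists x.
by rewrite ltr_pwDr // ler_norm.
Qed.

Lemma compact_cont_bound_fin E F (I : finType) (B : set E) (f : I -> E -> F) : compact B ->
  (forall i x, B x -> {for x, continuous (f i)}) ->
  exists2 C : R, 0 < C & forall i x, B x -> `|f i x| <= C.
Proof.
move=> cB fc.
have H i := compact_cont_bound cB (fc i).
exists (1 + \sum_i sval (cid2 (H i))).
  rewrite ltr_pwDl // sumr_ge0 // => i _; case: cid2 => /= C C0 _; exact: ltW.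
move=> i x Bx; rewrite ler_wpDl // (bigD1 i) //= ler_wpDr //.
  rewrite sumr_ge0 // => j _; case: cid2 => /= C C0 _; exact: ltW.
by case: cid2 => /= C C0; exact.
Qed.

Lemma C1_compact_bound E F {h : findim E} (D B : set E) (f : E -> F) : compact B ->
  B `<=` D -> Ck_on 1 D f ->
  exists2 K : R, 0 < K & forall x w, B x -> `|'d f x w| <= K * `|w|.
Proof.
move=> cB BD [df Df].
have [C C0 HC] := @compact_cont_bound_fin E F _ B (fun i => 'D_(fbase i) f) cB
  (fun i x Bx => Df (fbase i) x (BD x Bx)).
have [M M0 HM] := fcoef_bound (E := E).
exists (C * M * (fdim E)%:R + 1); first by rewrite ltr_wpDl // !mulr_ge0 // ltW.
move=> x w Bx; rewrite -deriveE; last exact/df/BD.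
rewrite diff_sum_fbase; last exact/df/BD.
rewrite (le_trans (ler_norm_sum _ _ _)) //.
apply: (@le_trans _ _ (\sum_(i < fdim E) C * M * `|w|)).
  apply: ler_sum => i _; rewrite normrZ -mulrA mulrC ler_pM //; exact: HC.
rewrite sumr_const card_ord -[_ *+ fdim E]mulr_natr mulrDl mul1r mulrAC.
by rewrite lerDl.
Qed.

Lemma C1_lipschitz E F {h : findim E} (D B : set E) (f : E -> F) : compact B ->
  segment_closed B -> B `<=` D -> Ck_on 1 D f ->
  exists2 K : R, 0 < K & forall x y, B x -> B y -> `|f y - f x| <= K * `|y - x|.
Proof.
move=> cB sB BD Cf; have [K K0 HK] := C1_compact_bound cB BD Cf.
exists K => // x y Bx By; apply: mvt_seg0 => s s01.
  by apply: Cf.1; apply/BD/sB.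
by apply: HK; exact: sB.
Qed.

Lemma C2_lipschitz_diff E F {h : findim E} (D B : set E) (f : E -> F) : compact B ->
  segment_closed B -> B `<=` D -> Ck_on 2 D f ->
  exists2 K : R, 0 < K & forall x y w, B x -> B y ->
    `|'d f y w - 'd f x w| <= K * `|y - x| * `|w|.
Proof.
move=> cB sB BD [df Df].
have H i := C1_lipschitz (h := h) cB sB BD (Df (fbase (h := h) i)).
have [C C0 HC] : exists2 C : R, 0 < C & forall i x y, B x -> B y ->
    `|'D_(fbase i) f y - 'D_(fbase i) f x| <= C * `|y - x|.
  exists (1 + \sum_i sval (cid2 (H i))).
    rewrite ltr_pwDl // sumr_ge0 // => i _; case: cid2 => /= C C0 _; exact: ltW.
  move=> i x y Bx By; rewrite (bigD1 i) //=.
  case: cid2 => /= C C0 HC.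
  apply: le_trans (HC _ _ Bx By) _; rewrite ler_wpM2r // ler_wpDl // lerDl.
  rewrite sumr_ge0 // => j _; case: cid2 => /= C' C'0 _; exact: ltW.
have [M M0 HM] := fcoef_bound (E := E).
exists (C * M * (fdim E)%:R + 1); first by rewrite ltr_wpDl // !mulr_ge0 // ltW.
move=> x y w Bx By.
rewrite -!deriveE; [|by apply/df/BD|by apply/df/BD].
rewrite !diff_sum_fbase; [|by apply/df/BD|by apply/df/BD].
rewrite -sumrB (le_trans (ler_norm_sum _ _ _)) //.
apply: (@le_trans _ _ (\sum_(i < fdim E) C * M * (`|y - x| * `|w|))).
  apply: ler_sum => i _; rewrite -scalerBr normrZ.
  apply: le_trans (ler_pM _ _ (HM w i) (HC i x y Bx By)) _ => //.
  by rewrite le_eqVlt; apply/orP; left; apply/eqP; ring.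
rewrite sumr_const card_ord -[_ *+ fdim E]mulr_natr.
rewrite [leRHS](_ : _ = C * M * (`|y - x| * `|w|) * (fdim E)%:R + `|y - x| * `|w|).
  by rewrite lerDl mulr_ge0.
by ring.
Qed.

Lemma C2_taylor E F {h : findim E} (D B : set E) (f : E -> F) : compact B ->
  segment_closed B -> B `<=` D -> Ck_on 2 D f ->
  exists2 K : R, 0 < K & forall x y, B x -> B y ->
    `|f y - f x - 'd f x (y - x)| <= K * `|y - x| ^+ 2.
Proof.
move=> cB sB BD Cf; have [K K0 HK] := C2_lipschitz_diff cB sB BD Cf.
exists K => // x y Bx By; apply: mvt_seg => s s01.
  by apply: Cf.1; apply/BD/sB.
apply: le_trans (HK _ _ _ Bx (sB _ _ _ Bx By s01)) _.
have -> : x + s *: (y - x) - x = s *: (y - x) by lmod R.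
rewrite normrZ expr2 [leRHS]mulrA ler_wpM2r // ler_wpM2l ?(ltW K0) //.
case/andP: s01 => s0 s1; rewrite ger0_norm //.
by rewrite ler_piMl.
Qed.

End Partials.

(** * Ordinary differential equations *)

Section Picard.
Context {R : realType}.
Implicit Types E F G : normedModType R.

Lemma near0_ltR (e : R) : 0 < e -> \forall s \near (0 : R), `|s| < e.
Proof.
by move=> e0; apply/nbhs_ballP; exists e => // s; rewrite /ball /= sub0r normrN.
Qed.

(** The radius [2 * c * 2^-1 ^+ n] is the total of all increments still to come, so the intervals
    around [z n] are nested and the supremum of their left ends lies in each of them. *)
Lemma real_geometric_limit (z : nat -> R) (c : R) :
  (forall n, `|z n.+1 - z n| <= c * 2^-1 ^+ n) ->
  exists l, forall n, `|z n - l| <= 2 * c * 2^-1 ^+ n.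
Proof.
move=> zc.
have c0 : 0 <= c.
  by have := le_trans (normr_ge0 _) (zc 0%N); rewrite expr0 mulr1.
have eS n : (2^-1 : R) ^+ n = 2 * 2^-1 ^+ n.+1 by rewrite exprS mulrA divff ?mul1r.
pose a n := z n - 2 * c * 2^-1 ^+ n; pose b n := z n + 2 * c * 2^-1 ^+ n.
have aS n : a n <= a n.+1.
  rewrite /a; have := zc n; rewrite ler_norml => /andP[]; rewrite eS; lra.
have bS n : b n.+1 <= b n.
  rewrite /b; have := zc n; rewrite ler_norml => /andP[]; rewrite eS; lra.
have ab n : a n <= b n.
  by rewrite lerD2l -subr_ge0 opprK addr_ge0 // !mulr_ge0 // ltW.
have aD n k : a n <= a (n + k)%N.
  by elim: k => [|k IH]; rewrite ?addn0 // addnS (le_trans IH).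
have bD n k : b (n + k)%N <= b n.
  by elim: k => [|k IH]; rewrite ?addn0 // addnS (le_trans _ IH).
have abnm n m : a n <= b m.
  by rewrite (le_trans (aD n m)) // (le_trans (ab _)) // addnC.
pose A := range a.
have hA : has_sup A by split; [exists (a 0%N), 0%N|exists (b 0%N) => _ [n _ <-]].
exists (sup A) => n.
have H1 : a n <= sup A by apply: ub_le_sup; [case: hA|exists n].
have H2 : sup A <= b n by apply: ge_sup; [case: hA|move=> _ [m _ <-]].
by rewrite ler_norml; move: H1 H2; rewrite /a /b; lra.
Qed.

(** Replaces completeness of [E]: the limit is taken coordinate by coordinate, and the rate is kept
    because later steps use it explicitly. *)
Lemma geometric_limit E {h : findim E} : exists2 k : R, 0 < k &
  forall (y : nat -> E) (c : R), (forall n, `|y n.+1 - y n| <= c * 2^-1 ^+ n) ->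
  exists l, forall n, `|y n - l| <= k * c * 2^-1 ^+ n.
Proof.
have [K K0 HK] := fcoef_bound (E := E).
pose M := \sum_(i < @fdim R E h) `|fbase (h := h) i|.
have M0 : 0 <= M by exact: sumr_ge0.
exists (2 * K * M + 1); first by rewrite ltr_wpDl // !mulr_ge0 // ltW.
move=> y c yc.
have c0 : 0 <= c.
  by have := le_trans (normr_ge0 _) (yc 0%N); rewrite expr0 mulr1.
have fB i u v : fcoef (h := h) i u - fcoef (h := h) i v = fcoef (h := h) i (u - v).
  by rewrite /fcoef linearB !mxE.
have H i : exists l, forall n, `|fcoef (h := h) i (y n) - l| <= 2 * (K * c) * 2^-1 ^+ n.
  apply: real_geometric_limit => n; rewrite fB.
  by rewrite (le_trans (HK _ _)) // -mulrA ler_wpM2l // ltW.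
have [l Hl] := choice H.
exists (\sum_i l i *: fbase (h := h) i) => n.
rewrite {1}(fcoef_sum (y n)) -sumrB.
rewrite (le_trans (ler_norm_sum _ _ _)) //.
apply: (@le_trans _ _ (\sum_(i < fdim E) 2 * (K * c) * 2^-1 ^+ n * `|fbase (h := h) i|)).
  by apply: ler_sum => i _; rewrite -scalerBl normrZ ler_wpM2r.
rewrite -mulr_sumr -/M [leRHS](_ : _ = 2 * (K * c) * 2^-1 ^+ n * M + c * 2^-1 ^+ n).
  by rewrite lerDl mulr_ge0 // exprn_ge0 // invr_ge0.
by ring.
Qed.

Lemma local_primitive (u : R -> R) (T : R) : 0 < T -> continuous u ->
  exists U : R -> R, U 0 = 0 /\ forall t : R, `|t| < T -> is_derive t 1 U (u t).
Proof.
move=> T0 cu.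
pose mu := @lebesgue_measure R.
(* Starting the integral at [- T] makes 0 an interior point, so that the fundamental theorem gives a
   two-sided derivative at 0 too. *)
pose V (x : R) : R := (\int[mu]_(t in `[- T, x]) u t)%R.
have H (t : R) : `|t| < T -> is_derive t 1 V (u t).
  rewrite ltr_norml => /andP[Tt tT].
  have ui : mu.-integrable `[- T, T] (EFin \o u).
    apply: continuous_compact_integrable; first exact: segment_compact.
    by apply: continuous_subspaceT => x; exact: cu.
  have [dV VE] := @continuous_FTC1_closed R u (- T) t T tT ui Tt (cu t).
  by split; [exact: dV|rewrite -derive1E].
exists (fun t => V t - V 0); split; first by rewrite subrr.
move=> t tT; rewrite -[u t]subr0; apply: is_deriveB; exact: H.
Qed.

Lemma is_derive_eq0 E (f g df : R -> E) (T t : R) : f 0 = g 0 ->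
  (forall t : R, `|t| < T -> is_derive t 1 f (df t)) ->
  (forall t : R, `|t| < T -> is_derive t 1 g (df t)) -> `|t| < T -> f t = g t.
Proof.
move=> fg0 fd gd tT.
have := @mvt_norm R E (fun t => f t - g t) (fun t => df t - df t) 0 0 t 0.
rewrite subr0 scaler0 subr0 fg0 subrr subr0 mul0r normr_le0 subr_eq0 => H.
apply/eqP; apply: H => s; rewrite subr0 => st _.
  by apply: is_deriveB; [apply: fd|apply: gd]; exact: le_lt_trans st tT.
by rewrite subrr subr0 normr0.
Qed.

(** Primitives on different intervals that vanish at 0 agree wherever both are defined, so the
    diagonal [V t t] is a single primitive on the whole line. *)
Lemma primitive (u : R -> R) : continuous u ->
  exists U : R -> R, U 0 = 0 /\ forall t : R, is_derive t 1 U (u t).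
Proof.
move=> cu.
have T1 (T : R) : 0 < `|T| + 1 by rewrite ltr_wpDl.
have [V HV] := choice (fun T => local_primitive (T1 T) cu).
have VE S T t : `|t| < `|S| + 1 -> `|t| < `|T| + 1 -> V S t = V T t.
  move=> tS tT; pose m := Num.min (`|S| + 1) (`|T| + 1).
  apply: (@is_derive_eq0 _ _ _ u m); first by rewrite (HV S).1 (HV T).1.
  - by move=> s; rewrite lt_min => /andP[sS sT]; apply: (HV S).2.
  - by move=> s; rewrite lt_min => /andP[sS sT]; apply: (HV T).2.
  - by rewrite lt_min tS.
exists (fun t => V t t); split; first by rewrite (HV 0).1.
move=> t; have Ht : is_derive t 1 (V t) (u t) by apply: (HV t).2; rewrite ltrDl.
apply: near_eq_is_derive Ht; near=> s; apply: VE; last by rewrite ltrDl.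
rewrite -[s](subrK t) addrC (le_lt_trans (ler_normD _ _)) // ltrD2l.
rewrite distrC; near: s; apply/nbhs_ballP; exists 1 => //=.
Unshelve. all: by end_near. Qed.

Lemma fcoef_is_derive E {h : findim E} i (f : R -> E) (t : R) d :
  is_derive t 1 f d -> is_derive t 1 (fun s => fcoef (h := h) i (f s) : R) (fcoef (h := h) i d).
Proof.
move=> /is_deriveP H; apply/is_deriveP => e e0.
have [K K0 HK] := fcoef_bound (E := E).
have eK : 0 < e / K by rewrite divr_gt0.
have := H _ eK; apply: filterS => s Hs.
have -> : fcoef (h := h) i (f (t + s%:A)) - fcoef (h := h) i (f t) - s *: fcoef (h := h) i d
   = fcoef (h := h) i (f (t + s%:A) - f t - s *: d).
  have fE : fcoord (f (t + s%:A) - f t - s *: d) =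
      fcoord (f (t + s%:A)) - fcoord (f t) - s *: fcoord d by rewrite 2!linearB linearZ.
    by rewrite /fcoef fE !mxE.
rewrite (le_trans (HK _ _)) // mulrC -ler_pdivlMr // (le_trans Hs) //.
by rewrite mulrAC.
Qed.

Lemma is_derive_fsum E {h : findim E} (f df : 'I_(fdim E) -> R -> R) (t : R) :
  (forall i, is_derive t 1 (f i) (df i t)) ->
  is_derive t 1 (fun s => \sum_i f i s *: fbase (h := h) i) (\sum_i df i t *: fbase (h := h) i).
Proof.
move=> H.
have -> : (fun s => \sum_i f i s *: fbase (h := h) i) =
  \sum_(i < fdim E) (fun s => f i s *: fbase (h := h) i).
  by apply/funext => s; rewrite fct_sumE.
apply: is_derive_sum => i; apply/is_deriveP => e e0.
pose b := `|fbase (h := h) i| + 1.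
have b0 : 0 < b by rewrite ltr_wpDl.
have eb : 0 < e / b by rewrite divr_gt0.
have /is_deriveP/(_ _ eb) := H i; apply: filterS => s Hs.
rewrite scalerA -!scalerBl normrZ.
apply: (@le_trans _ _ (e / b * `|s| * b)).
  by apply: ler_pM => //; rewrite /b lerDl.
by rewrite mulrAC divfK ?gt_eqF.
Qed.

Lemma primitive_findim E {h : findim E} (u : R -> E) : continuous u ->
  exists U : R -> E, U 0 = 0 /\ forall t : R, is_derive t 1 U (u t).
Proof.
move=> cu.
have H i : exists U : R -> R, U 0 = 0 /\
    forall t : R, is_derive t 1 U (fcoef (h := h) i (u t)).
  apply: primitive => t; apply: continuous_comp; first exact: cu.
  by have /mx_continuousP := @fcoord_continuous R E h (u t); apply.
have [U HU] := choice H.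
exists (fun t => \sum_i U i t *: fbase (h := h) i); split.
  by rewrite big1 // => i _; rewrite (HU i).1 scale0r.
move=> t; rewrite [X in is_derive _ _ _ X](fcoef_sum (u t)).
apply: (@is_derive_fsum _ _ _ (fun i s => fcoef (h := h) i (u s))) => i; exact: (HU i).2.
Qed.

(** Serves both for Picard iterates and for difference quotients of a flow. The slope error [e] is
    fixed first; for a given increment [s] the approximation [g] can then be taken as close to [F]
    as desired, so the distance between [g] and [F] disappears from the estimate. *)
Lemma is_derive_uniform_limit E (F G : R -> E) (t0 r : R) : 0 < r ->
  {for t0, continuous G} ->
  (forall e : R, 0 < e -> exists g dg : R -> E, forall t, `|t - t0| < r ->
    [/\ is_derive t 1 g (dg t), `|g t - F t| <= e & `|dg t - G t| <= e]) ->
  is_derive t0 1 F (G t0).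
Proof.
move=> r0 cG H; apply/is_deriveP => e e0.
have e20 : 0 < e / 2 by rewrite divr_gt0.
have [d d0 dP] := cont_ball cG e20.
have m0 : 0 < Num.min d r by rewrite lt_min d0.
near=> s; rewrite [s%:A]mulr1.
have sm : `|s| < Num.min d r by near: s; exact: near0_ltR.
have [->|s0] := eqVneq s 0.
  by rewrite addr0 scale0r subrr subr0 !normr0 mulr0.
apply/ler_addgt0Pr => _/posnumP[e1].
pose e2 : R := Num.min (e / 2) (e1%:num / 2).
have e2_0 : 0 < e2 by rewrite lt_min e20 divr_gt0.
have [g [dg Hg]] := H _ e2_0.
have ts t : `|t - t0| <= `|t0 + s - t0| -> `|t - t0| < d /\ `|t - t0| < r.
  rewrite (_ : t0 + s - t0 = s); last by ring.
  by move=> /le_lt_trans/(_ sm); rewrite lt_min => /andP.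
have := @mvt_norm R E g dg (G t0) t0 (t0 + s) e.
rewrite (_ : t0 + s - t0 = s) in ts *; last by ring.
move=> Hm; have {}Hm : `|g (t0 + s) - g t0 - s *: G t0| <= e * `|s|.
  apply: Hm => t /ts[td tr] _; first by case: (Hg t tr).
  have [_ _ H1] := Hg t tr.
  rewrite -(subrK (G t) (dg t)) -addrA (le_trans (ler_normD _ _)) // [e]splitr.
  by apply: lerD; [rewrite (le_trans H1) // ge_min lexx|exact: dP].
have Ht0 : `|t0 - t0| < r by rewrite subrr normr0.
have Hts : `|t0 + s - t0| < r.
  rewrite (_ : t0 + s - t0 = s); last by ring.
  by move: sm; rewrite lt_min => /andP[].
have [_ H1 _] := Hg _ Ht0; have [_ H2 _] := Hg _ Hts.
have -> : F (t0 + s) - F t0 - s *: G t0 = (g (t0 + s) - g t0 - s *: G t0)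
   + ((g t0 - F t0) - (g (t0 + s) - F (t0 + s))) by lmod R.
rewrite (le_trans (ler_normD _ _)) // lerD //.
rewrite (le_trans (ler_normB _ _)) //.
have e2e : e2 <= e1%:num / 2 by rewrite ge_min lexx orbT.
by rewrite [leRHS]splitr lerD // (le_trans _ e2e).
Unshelve. all: by end_near. Qed.

Section GlobalLipschitz.
Context (E : normedModType R) {h : findim E} (f : E -> E) (M K T : R).
Hypotheses (fM : forall x, `|f x| <= M) (fK : forall x y, `|f y - f x| <= K * `|y - x|)
  (K0 : 0 < K) (T0 : 0 < T) (KT : K * T <= 2^-1).

Let f_continuous : continuous f.
Proof.
move=> x; apply: cont_of_ball => e e0; exists (e / K); first by rewrite divr_gt0.
move=> y yx; rewrite (le_trans (fK _ _)) // mulrC -ler_pdivlMr //; exact: ltW.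
Qed.

Let M0 : 0 <= M. Proof. exact: le_trans (normr_ge0 _) (fM 0). Qed.

Let prim (u : R -> E) : R -> E :=
  xget (fun=> 0) [set U : R -> E | U 0 = 0 /\ forall t : R, is_derive t 1 U (u t)].

Let primP u : continuous u -> prim u 0 = 0 /\ forall t : R, is_derive t 1 (prim u) (u t).
Proof. by move=> /primitive_findim; apply: xgetPex. Qed.

Fixpoint picard (n : nat) (a : E) : R -> E :=
  if n is n'.+1 then fun t => a + prim (fun s => f (picard n' a s)) t else cst a.

Lemma picard_spec n a : continuous (picard n a) /\
  forall t : R, is_derive t 1 (picard n.+1 a) (f (picard n a t)).
Proof.
have S k : continuous (picard k a) ->
    forall t : R, is_derive t 1 (picard k.+1 a) (f (picard k a t)).
  move=> ck t.
  have cfk : continuous (fun s => f (picard k a s)).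
    by move=> s; apply: continuous_comp; [exact: ck|exact: f_continuous].
  rewrite -[X in is_derive _ _ _ X]add0r.
  by apply: is_deriveD; exact: (primP cfk).2.
elim: n => [|n [cn dn]].
  have c0 : continuous (picard 0 a) by move=> x; exact: cst_continuous.
  by split=> //; exact: S.
have cS : continuous (picard n.+1 a).
  by move=> t; exact: is_derive_continuous1 (dn t).
by split=> //; exact: S.
Qed.

Lemma picard0 n a : picard n a 0 = a.
Proof.
case: n => [//|n] /=; rewrite (primP _).1 ?addr0 // => s.
by apply: continuous_comp; [exact: (picard_spec n a).1|exact: f_continuous].
Qed.

Lemma picard_time_lipschitz n a s t : `|picard n a t - picard n a s| <= M * `|t - s|.
Proof.
case: n => [|n]; first by rewrite /= subrr normr0 mulr_ge0.
have := @mvt_norm R E (picard n.+1 a) (fun t => f (picard n a t)) 0 s t M.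
rewrite scaler0 subr0; apply=> r _ _; first exact: (picard_spec n a).2.
by rewrite subr0; exact: fM.
Qed.

(** The factor 2 reproduces itself: one iteration turns it into at most [1 + K * T * 2], which is at
    most 2 because [K * T <= 2^-1]. *)
Lemma picard_lipschitz n a b t : `|t| <= T ->
  `|picard n b t - picard n a t| <= 2 * `|b - a|.
Proof.
elim: n t => [|n IH] t tT.
  by rewrite /= ler_peMl // ler1n.
pose d := `|b - a|.
have := @mvt_norm R E (fun t => picard n.+1 b t - picard n.+1 a t)
  (fun t => f (picard n b t) - f (picard n a t)) 0 0 t (K * (2 * d)).
rewrite scaler0 !subr0 !picard0 => H.
have {}H : `|picard n.+1 b t - picard n.+1 a t - (b - a)| <= K * (2 * d) * `|t|.
  apply: H => r; rewrite subr0 => rt _.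
    by apply: is_deriveB; exact: (picard_spec n _).2.
  rewrite subr0 (le_trans (fK _ _)) // ler_wpM2l ?(ltW K0) //.
  by apply: IH; exact: le_trans rt tT.
rewrite -(subrK (b - a) (_ - _)) (le_trans (ler_normD _ _)) // mulr_natl mulr2n lerD //.
apply: le_trans H _.
rewrite mulrAC (_ : K * `|t| * (2 * d) = 2 * (K * `|t|) * d); last by ring.
have Kt : K * `|t| <= 2^-1 by rewrite (le_trans _ KT) // ler_wpM2l // ltW.
have {}Kt : 2 * (K * `|t|) <= 1 by lra.
by rewrite /d ler_piMl.
Qed.

(** The first step has length at most [M * T], and [K * T <= 2^-1] halves each subsequent one. *)
Lemma picard_step n a t : `|t| <= T ->
  `|picard n.+1 a t - picard n a t| <= M * T * 2^-1 ^+ n.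
Proof.
elim: n t => [|n IH] t tT.
  rewrite expr0 mulr1 -[picard 0 a t]/a -{2}(picard0 1 a).
  by rewrite (le_trans (picard_time_lipschitz _ _ _ _)) // subr0 ler_wpM2l.
have := @mvt_norm R E (fun t => picard n.+2 a t - picard n.+1 a t)
  (fun t => f (picard n.+1 a t) - f (picard n a t)) 0 0 t (K * (M * T * 2^-1 ^+ n)).
rewrite scaler0 !subr0 !picard0 subrr subr0 => H.
apply: le_trans (H _ _) _ => [r|r|].
- by move=> _ _; apply: is_deriveB; exact: (picard_spec _ _).2.
- rewrite subr0 => rt _; rewrite subr0 (le_trans (fK _ _)) // ler_wpM2l ?(ltW K0) //.
  by apply: IH; exact: le_trans rt tT.
rewrite exprS [leLHS](_ : _ = (K * `|t|) * (M * T * 2^-1 ^+ n)); last by ring.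
rewrite [leRHS](_ : _ = 2^-1 * (M * T * 2^-1 ^+ n)); last by ring.
apply: ler_wpM2r; first by rewrite !mulr_ge0 ?exprn_ge0 ?invr_ge0 // ltW.
by rewrite (le_trans _ KT) // ler_wpM2l // ltW.
Qed.

Lemma global_flow : exists phi : R -> E -> E,
  [/\ forall a, phi 0 a = a,
      forall (t : R) a, `|t| < T -> is_derive t 1 (fun s => phi s a) (f (phi t a)),
      forall t a, `|t| <= T -> `|phi t a - a| <= M * `|t| &
      forall t a b, `|t| <= T -> `|phi t b - phi t a| <= 2 * `|b - a| ].
Proof.
have [k k0 Hk] := geometric_limit (E := E).
have H (ta : R * E) : exists l, `|ta.1| <= T ->
    forall n, `|picard n ta.2 ta.1 - l| <= k * (M * T) * 2^-1 ^+ n.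
  case: (boolP (`|ta.1| <= T)) => [tT|_]; last by exists 0.
  have [l Hl] := Hk (fun n => picard n ta.2 ta.1) (M * T) (fun n => picard_step n _ tT).
  by exists l.
have [phi' Hphi'] := choice H.
pose phi t a := phi' (t, a).
have Hphi t a n : `|t| <= T -> `|picard n a t - phi t a| <= k * (M * T) * 2^-1 ^+ n.
  by move=> tT; exact: (Hphi' (t, a) tT n).
pose c := k * (M * T).
have c0 : 0 <= c by rewrite !mulr_ge0 // ltW.
have small (e : R) : 0 < e -> exists n, c * 2^-1 ^+ n <= e.
  move=> e0.
  have : (fun n => c * 2^-1 ^+ n : R) @ \oo --> (0 : R).
    by apply: cvg_geometric; rewrite ger0_norm ?invr_ge0 // invf_lt1 // ltr1n.
  move=> /cvgrPdist_le/(_ _ e0)[N _ HN]; exists N.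
  by have := HN N (leqnn _); rewrite sub0r normrN; apply: le_trans; rewrite ler_norm.
(* Bounds between iterates that are uniform in [n] survive in the limit; the estimates of the flow
   in time and in the initial point are both obtained in this way. *)
have lim2 t a s b (C : R) : `|t| <= T -> `|s| <= T ->
    (forall n, `|picard n b s - picard n a t| <= C) -> `|phi s b - phi t a| <= C.
  move=> tT sT HC; apply/ler_addgt0Pr => _/posnumP[e].
  have [n Hn] := small (e%:num / 2) ltac:(by []).
  have -> : phi s b - phi t a = (picard n b s - picard n a t)
    + ((picard n a t - phi t a) - (picard n b s - phi s b)) by lmod R.
  rewrite (le_trans (ler_normD _ _)) // lerD // (le_trans (ler_normB _ _)) //.
  by rewrite [leRHS]splitr lerD // (le_trans _ Hn) // Hphi.
have T00 : `|0 : R| <= T by rewrite normr0 ltW.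
have phi0 a : phi 0 a = a.
  apply/eqP; rewrite -subr_eq0 -normr_le0; apply/ler_addgt0Pr => e e0; rewrite add0r.
  have [n Hn] := small _ e0.
  by rewrite distrC -{1}(picard0 n a) (le_trans (Hphi _ _ _ _)).
have phit s t a : `|t| <= T -> `|s| <= T -> `|phi s a - phi t a| <= M * `|s - t|.
  by move=> tT sT; apply: lim2 => // n; exact: picard_time_lipschitz.
exists phi; split=> //.
- move=> t a tT.
  have r0 : 0 < T - `|t| by rewrite subr_gt0.
  have inT s : `|s - t| < T - `|t| -> `|s| <= T.
    move=> st; rewrite -(subrK t s) (le_trans (ler_normD _ _)) // -lerBrDr.
    exact: ltW.
  apply: (@is_derive_uniform_limit E (fun s => phi s a) (fun s => f (phi s a)) t _ r0).
    apply: cont_of_ball => e e0.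
    have MK : 0 < K * (M + 1) by rewrite mulr_gt0 // ltr_wpDl.
    exists (Num.min (T - `|t|) (e / (K * (M + 1)))).
      by rewrite lt_min r0 divr_gt0.
    move=> s; rewrite lt_min => /andP[/inT sT se].
    rewrite (le_trans (fK _ _)) //.
    apply: (@le_trans _ _ (K * (M + 1) * `|s - t|)).
      rewrite -mulrA ler_wpM2l ?(ltW K0) // (le_trans (phit _ _ _ _ _)) ?(ltW tT) //.
      by rewrite ler_wpM2r // lerDl.
    by rewrite mulrC -ler_pdivlMr // ltW.
  move=> e e0.
  have e20 : 0 < Num.min e (e / K) by rewrite lt_min e0 divr_gt0.
  have [n Hn] := small _ e20.
  (* The shift of index is that of Picard's scheme: the derivative of iterate [n.+1] is [f] along
     iterate [n]. *)
  exists (picard n.+1 a), (fun s => f (picard n a s)) => s /inT sT; split.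
  - exact: (picard_spec n a).2.
  - rewrite (le_trans (Hphi _ _ _ _)) // -/c.
    apply: le_trans (_ : _ <= c * 2^-1 ^+ n) _.
      rewrite ler_wpM2l // exprS ler_piMl ?exprn_ge0 ?invr_ge0 //.
      by rewrite invf_le1 // ler1n.
    by rewrite (le_trans Hn) // ge_min lexx.
  - rewrite (le_trans (fK _ _)) // mulrC -ler_pdivlMr //.
    rewrite distrC distrC (le_trans (Hphi _ _ _ _)) // (le_trans Hn) //.
    by rewrite ge_min lexx orbT.
- move=> t a tT; rewrite -{2}(phi0 a) (le_trans (phit _ _ _ _ _)) // subr0.
  by [].
- by move=> t a b tT; apply: lim2 => // n; exact: picard_lipschitz.
Qed.

End GlobalLipschitz.
End Picard.

(** * Gronwall's inequality and extension of a local field *)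

Section Gronwall.
Context {R : realType}.
Implicit Types E F G P : normedModType R.

(** For positive times [v s * expR (- C * s)] does not increase; negative times follow by reversing
    time. *)
Lemma gronwall_scalar (u du : R -> R) (C T : R) : 0 <= C ->
  (forall t : R, `|t| < T -> is_derive t 1 u (du t)) ->
  (forall t, `|t| < T -> `|du t| <= C * u t) ->
  forall t, `|t| < T -> u t <= u 0 * expR (C * T).
Proof.
move=> C0.
have pos (v dv : R -> R) :
  (forall t : R, `|t| < T -> is_derive t 1 v (dv t)) ->
  (forall t, `|t| < T -> `|dv t| <= C * v t) ->
  forall t, 0 <= t -> `|t| < T -> v t <= v 0 * expR (C * T).
  move=> vd dv_le t t0 tT.
  have T0 : 0 < T by exact: le_lt_trans tT.
  have v0 : 0 <= C * v 0.
    by rewrite (le_trans _ (dv_le 0 _)) // normr0.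
  pose w (s : R) := v s * expR (- C * s).
  pose dw (s : R) := (dv s - C * v s) * expR (- C * s).
  have wd (s : R) : `|s| < T -> is_derive s 1 w (dw s).
    move=> sT; have Hv := vd s sT.
    have He : is_derive s 1 (fun s : R => expR (- C * s)) (expR (- C * s) * - C).
      have : is_derive s 1 (fun s : R => - C * s) (- C).
        by have := @is_deriveZ R _ _ id (- C) s 1 1 _; rewrite /= [_ *: 1]mulr1; apply.
      move=> Hl; have := @is_derive1_comp R expR (fun s : R => - C * s) s _ _ _ Hl.
      by apply.
    have := @is_deriveM R _ v (fun s : R => expR (- C * s)) s 1 _ _ Hv He.
    move=> H; apply: (is_derive_eq H).
    by rewrite /dw /GRing.scale /=; ring.
  have H : w t <= w 0.
    have [->|tn0] := eqVneq t 0; first by [].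
    have t_gt0 : 0 < t by rewrite lt_def tn0.
    have inT s : 0 <= s <= t -> `|s| < T.
      by move=> /andP[s0 st]; rewrite ger0_norm // (le_lt_trans st) // -(ger0_norm t0).
    have [||c /andP[c0 ct] E] := @MVT R w dw 0 t t_gt0.
    - by move=> s /andP[s0 st]; apply: wd; apply: inT; rewrite !ltW.
    - apply: derivable_within_continuous => s; rewrite in_itv /= => /inT/wd [].
      by [].
    - rewrite -subr_le0 E; rewrite pmulr_lle0 ?subr_gt0 // /dw.
      rewrite pmulr_lle0 ?expR_gt0 // subr_le0.
      apply: le_trans (ler_norm _) _; apply: dv_le; apply: inT; by rewrite !ltW.
  move: H; rewrite /w mulr0 expR0 mulr1 => H.
  have -> : v t = (v t * expR (- C * t)) * expR (C * t).
    by rewrite -mulrA -expRD mulNr addNr expR0 mulr1.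
  apply: le_trans (_ : _ <= v 0 * expR (C * t)) _.
    by rewrite ler_wpM2r // expR_ge0.
  (* Only [C * v 0] is known to be nonnegative. For [C = 0] the sign of [v 0] is open, but then both
     exponentials equal 1. *)
  have [->|Cn0] := eqVneq C 0; first by rewrite !mul0r.
  have C_gt0 : 0 < C by rewrite lt_def Cn0.
  rewrite ler_wpM2l //; first by move: v0; rewrite pmulr_rge0.
  by rewrite ler_expR ler_wpM2l // ltW // -(ger0_norm t0).
move=> ud du_le t tT; have [t0|t0] := leP 0 t; first exact: (pos u du).
have := @pos (fun s => u (- s)) (fun s => - du (- s)).
rewrite oppr0 => H; rewrite -(opprK t); apply: H.
- move=> s sT.
  have Hu : is_derive (- s) 1 u (du (- s)) by apply: ud; rewrite normrN.
  have := @is_derive1_comp R u -%R s _ _ Hu (is_deriveNid s 1).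
  by rewrite /= mulrN1; apply.
- by move=> s sT; rewrite normrN; apply: du_le; rewrite normrN.
- by rewrite oppr_ge0 ltW.
- by rewrite normrN.
Qed.

Definition sqnorm E {h : findim E} (x : E) : R := \sum_i fcoef (h := h) i x ^+ 2.

Lemma sqnorm_equiv E {h : findim E} : exists2 C : R, 0 < C &
  forall x : E, sqnorm x <= C * `|x| ^+ 2 /\ `|x| ^+ 2 <= C * sqnorm x.
Proof.
have [K K0 HK] := fcoef_bound (E := E).
pose n := @fdim R E h.
pose M := \sum_(i < n) `|fbase (h := h) i|.
have M0 : 0 <= M by exact: sumr_ge0.
exists (n%:R * K ^+ 2 + M ^+ 2 + 1).
  by rewrite ltr_wpDl // addr_ge0 // mulr_ge0 // exprn_ge0 // ltW.
have S0 (x : E) : 0 <= sqnorm x by apply: sumr_ge0 => i _; exact: sqr_ge0.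
move=> x; split.
  apply: (@le_trans _ _ (n%:R * K ^+ 2 * `|x| ^+ 2)).
    rewrite /sqnorm; apply: (@le_trans _ _ (\sum_(i < n) (K ^+ 2 * `|x| ^+ 2))).
      apply: ler_sum => i _; rewrite -real_normK ?num_real // -exprMn.
      by rewrite lerXn2r ?nnegrE // mulr_ge0 // ltW.
    by rewrite sumr_const card_ord -[_ *+ n]mulr_natl mulrA.
  by rewrite ler_wpM2r ?sqr_ge0 // -addrA lerDl addr_ge0 ?sqr_ge0.
have xM : `|x| <= M * Num.sqrt (sqnorm x).
  rewrite {1}(fcoef_sum x) (le_trans (ler_norm_sum _ _ _)) // mulr_suml.
  apply: ler_sum => i _; rewrite normrZ mulrC ler_wpM2l //.
  rewrite -sqrtr_sqr ler_wsqrtr // /sqnorm (bigD1 i) //= lerDl sumr_ge0 // => j _.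
  exact: sqr_ge0.
apply: (@le_trans _ _ (M ^+ 2 * sqnorm x)).
  rewrite -[sqnorm x in leRHS]sqr_sqrtr // -exprMn lerXn2r ?nnegrE // mulr_ge0 //.
by rewrite ler_wpM2r // addrAC lerDr addr_ge0 // mulr_ge0 // sqr_ge0.
Qed.

Lemma sqnorm_is_derive E {h : findim E} (F : R -> E) (t : R) d : is_derive t 1 F d ->
  is_derive t 1 (fun s => sqnorm (F s) : R)
    (\sum_i 2 * fcoef (h := h) i (F t) * fcoef (h := h) i d).
Proof.
move=> Fd.
have -> : (fun s => sqnorm (F s) : R) =
    \sum_(i < fdim E) (fun s => fcoef (h := h) i (F s) ^+ 2).
  by apply/funext => s; rewrite fct_sumE.
apply: is_derive_sum => i; have Hi := fcoef_is_derive i Fd.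
have := @is_deriveM R _ _ _ t 1 _ _ Hi Hi.
move=> H; apply: (is_derive_eq H).
by rewrite /GRing.scale /=; ring.
Qed.

(* The norm of [E] need not be differentiable, so the scalar inequality is
   applied to the squared Euclidean norm in coordinates. *)
Lemma gronwall E {h : findim E} (K T : R) : 0 <= K -> exists2 C : R, 0 < C &
  forall (F dF : R -> E) (e : R), 0 <= e ->
  (forall t : R, `|t| < T -> is_derive t 1 F (dF t)) ->
  (forall t, `|t| < T -> `|dF t| <= K * `|F t| + e) ->
  forall t, `|t| < T -> `|F t| <= C * (`|F 0| + e).
Proof.
move=> K0; have [k k0 Hk] := fcoef_bound (E := E).
have [c c0 Hc] := sqnorm_equiv (E := E).
pose n := @fdim R E h.
pose C1 := n%:R * (2 * k * k) * (K + 1) * (c + 1).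
have C10 : 0 <= C1 by rewrite !mulr_ge0 // ?addr_ge0 // ltW.
pose X := expR (C1 * T).
have X0 : 0 < X by exact: expR_gt0.
exists (Num.sqrt (c * (c + 1) * X + 1)).
  by rewrite sqrtr_gt0 ltr_wpDl // !mulr_ge0 // ?addr_ge0 // ltW.
move=> F dF e e0 Fd dFe t tT.
have S0 (x : E) : 0 <= sqnorm x by apply: sumr_ge0 => i _; exact: sqr_ge0.
(* Adding [e ^+ 2] absorbs the inhomogeneous term: [|F s| * (K * |F s| + e)] is at most
   [(K + 1) * (|F s| ^+ 2 + e ^+ 2)], so the scalar inequality applies to the sum. *)
have H : sqnorm (F t) + e ^+ 2 <= (sqnorm (F 0) + e ^+ 2) * X.
  apply: (@gronwall_scalar (fun s => sqnorm (F s) + e ^+ 2)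
    (fun s => \sum_i 2 * fcoef (h := h) i (F s) * fcoef (h := h) i (dF s) + 0) C1 T) => //.
    move=> s sT; apply: is_deriveD; apply: sqnorm_is_derive; exact: Fd.
  move=> s sT; rewrite addr0 (le_trans (ler_norm_sum _ _ _)) //.
  have Fs : `|F s| * (K * `|F s| + e) <= (K + 1) * (c + 1) * (sqnorm (F s) + e ^+ 2).
    have H1 : `|F s| * (K * `|F s| + e) <= (K + 1) * (`|F s| ^+ 2 + e ^+ 2).
      have : 0 <= (`|F s| - e) ^+ 2 by exact: sqr_ge0.
      have : 0 <= K * e ^+ 2 by rewrite mulr_ge0 // sqr_ge0.
      have : 0 <= `|F s| ^+ 2 by exact: sqr_ge0.
      have : 0 <= e ^+ 2 by exact: sqr_ge0.
      by rewrite !expr2; nra.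
    rewrite (le_trans H1) // -mulrA ler_wpM2l ?addr_ge0 //.
    have := (Hc (F s)).2; have := S0 (F s); have := sqr_ge0 e.
    by move: (ltW c0); nra.
  apply: (@le_trans _ _ (\sum_(i < n) 2 * k * k * (`|F s| * (K * `|F s| + e)))).
    apply: ler_sum => i _; rewrite !normrM [`|2|]ger0_norm //.
    rewrite -!mulrA ler_wpM2l // (mulrCA k) [X in _ <= X]mulrA.
    rewrite [leRHS](_ : _ = (k * `|F s|) * (k * (K * `|F s| + e))); last by ring.
    apply: ler_pM => //.
    by rewrite (le_trans (Hk _ _)) // ler_wpM2l ?(ltW k0) // dFe.
  rewrite sumr_const card_ord -[_ *+ n]mulr_natl /C1 -!mulrA ler_wpM2l //.
  by do 3! (rewrite ler_wpM2l ?(ltW k0) //); rewrite (le_trans Fs) // mulrA.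
have Ft : `|F t| ^+ 2 <= (c * (c + 1) * X + 1) * (`|F 0| + e) ^+ 2.
  apply: le_trans (Hc (F t)).2 _.
  apply: (@le_trans _ _ (c * ((c + 1) * (`|F 0| + e) ^+ 2 * X))).
    rewrite ler_wpM2l ?(ltW c0) //.
    apply: le_trans (_ : _ <= sqnorm (F t) + e ^+ 2) _; first by rewrite lerDl sqr_ge0.
    rewrite (le_trans H) // ler_wpM2r ?(ltW X0) //.
    have := (Hc (F 0)).1; have := normr_ge0 (F 0); rewrite !expr2.
    move=> H1 H2; set x := `|F 0| in H1 H2 *; set q := sqnorm _ in H2 *.
    have xe : 0 <= x * e by exact: mulr_ge0.
    have cx : 0 <= c * (x * e) by rewrite mulr_ge0 // ltW.
    have ce : 0 <= c * (e * e) by rewrite !mulr_ge0 // ltW.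
    have xx : 0 <= x * x by exact: mulr_ge0.
    by rewrite [leRHS](_ : _ = c * (x * x) + 2 * (c * (x * e)) + c * (e * e) + x * x + 2 * (x * e) + e * e); [lra|ring].
  rewrite [leRHS](_ : _ = c * ((c + 1) * (`|F 0| + e) ^+ 2 * X) + (`|F 0| + e) ^+ 2).
    by rewrite lerDl sqr_ge0.
  by ring.
have Fe0 : 0 <= `|F 0| + e by exact: addr_ge0.
rewrite -[`|F 0| + e]ger0_norm // -sqrtr_sqr -sqrtrM.
  by rewrite -[`|F t|]ger0_norm // -sqrtr_sqr ler_wsqrtr.
by rewrite addr_ge0 // !mulr_ge0 // ?addr_ge0 // ltW.
Qed.

(** Composition with [rho] extends a field from a ball to the whole space with the same bound and at
    most twice the Lipschitz constant. In a general norm the radial map need not be nonexpansive: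
    moving the vector and changing the scaling factor each cost up to [|y - x|], hence the 2. *)
Lemma radial_retraction E (x0 : E) (r : R) : 0 < r -> exists rho : E -> E,
  [/\ forall x y, `|rho y - rho x| <= 2 * `|y - x|,
      forall x, `|rho x - x0| <= r &
      forall x, `|x - x0| <= r -> rho x = x].
Proof.
move=> r0; pose m (x : E) := Num.max r `|x - x0|.
have m0 x : 0 < m x by rewrite lt_max r0.
have rm x : r <= m x by rewrite le_max lexx.
have xm x : `|x - x0| <= m x by rewrite le_max lexx orbT.
exists (fun x => x0 + (r / m x) *: (x - x0)); split.
- move=> x y.
  have mxy : `|m x - m y| <= `|y - x|.
    have H u v : m u <= m v + `|v - u|.
      rewrite {1}/m ge_max; apply/andP; split; first by rewrite ler_wpDr.
      rewrite (_ : u - x0 = (v - x0) - (v - u)); last by lmod R.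
      by rewrite (le_trans (ler_normB _ _)) // lerD2r.
    by rewrite ler_norml; have := H x y; have := H y x; rewrite (distrC x y); lra.
  have -> : x0 + (r / m y) *: (y - x0) - (x0 + (r / m x) *: (x - x0)) =
      (r / m x) *: (y - x) + (r / m y - r / m x) *: (y - x0) by lmod R.
  rewrite (le_trans (ler_normD _ _)) // mulr_natl mulr2n lerD //.
    rewrite normrZ ler_piMl // ger0_norm; first by rewrite ler_pdivrMr // mul1r.
    by rewrite divr_ge0 // ltW.
  have -> : r / m y - r / m x = (r / m x) * ((m x - m y) / m y).
    by field; rewrite !gt_eqF.
  rewrite normrZ normrM -mulrA.
  apply: (@le_trans _ _ (1 * `|y - x|)); last by rewrite mul1r.
  apply: ler_pM => //.
    rewrite ger0_norm; first by rewrite ler_pdivrMr // mul1r.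
    by rewrite divr_ge0 // ltW.
  rewrite normrM normfV [`|m y|]gtr0_norm // mulrAC ler_pdivrMr //.
  by apply: ler_pM.
- move=> x; rewrite addrC addKr normrZ ger0_norm; last by rewrite divr_ge0 // ltW.
  by rewrite mulrAC ler_pdivrMr // ler_wpM2l // ltW.
- move=> x xr; rewrite (_ : m x = r); last by rewrite /m max_l.
  by rewrite divff ?gt_eqF // scale1r addrC subrK.
Qed.

Lemma prod_norm_fst E F (x : E * F) : `|x.1| <= `|x|.
Proof. by rewrite [leRHS]prod_normE le_max lexx. Qed.

Lemma prod_norm_snd E F (x : E * F) : `|x.2| <= `|x|.
Proof. by rewrite [leRHS]prod_normE le_max lexx orbT. Qed.

Lemma prod_norm_le E F (x : E * F) (e : R) : `|x.1| <= e -> `|x.2| <= e -> `|x| <= e.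
Proof. by move=> H1 H2; rewrite prod_normE ge_max H1. Qed.

Lemma prod_norm_lt E F (x : E * F) (e : R) : `|x.1| < e -> `|x.2| < e -> `|x| < e.
Proof. by move=> H1 H2; rewrite prod_normE gt_max H1. Qed.

(** Splits the partial derivatives of a flow into the time direction and the parameter
    directions. *)
Lemma fbase_prod E F {hE : findim E} {hF : findim F} (i : 'I_(fdim (E * F)%type)) :
  (exists k, fbase i = (fbase (h := hE) k, 0)) \/ (exists k, fbase i = (0, fbase (h := hF) k)).
Proof.
rewrite /fbase /=; case: (splitP (i : 'I_(fdim E + fdim F))) => k ik; [left|right]; exists k.
  have -> : i = lshift _ k by exact/val_inj.
  congr (_, _).
    by congr (fvec _); apply/matrixP => a b; rewrite !mxE eq_lshift.
  rewrite -[RHS](linear0 (fvec (E := F))); congr (fvec _).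
  by apply/matrixP => a b; rewrite !mxE eq_rlshift andbF.
have -> : i = rshift _ k by exact/val_inj.
congr (_, _); last first.
  by congr (fvec _); apply/matrixP => a b; rewrite !mxE eq_rshift.
rewrite -[RHS](linear0 (fvec (E := E))); congr (fvec _).
by apply/matrixP => a b; rewrite !mxE eq_lrshift andbF.
Qed.

Lemma fbase_R (k : 'I_(fdim R^o)) : fbase k = 1 :> R^o.
Proof. by rewrite /fbase /= /R_vec mxE !ord1. Qed.

End Gronwall.

(** * Smooth dependence of flows on time and parameters *)

Section Flow.
Context {R : realType}.
Implicit Types E F G P : normedModType R.

Section Dependence.
Context {E P : normedModType R} {hE : findim E} {hP : findim P}.
Variables (f : E -> E) (O B : set E) (T : R) (A : set P) (phi : R^o * P -> E)
  (l : P -> E) (Lam : R).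
Hypotheses (oO : open O) (fC : Coo_on O f) (cB : compact B) (sB : segment_closed B)
  (BO : B `<=` O) (T0 : 0 < T) (oA : open A)
  (phiB : forall t a, `|t| < T -> A a -> B (phi (t, a)))
  (phi_ode : forall (t : R) a, `|t| < T -> A a ->
     is_derive t 1 (fun s : R => phi (s, a)) (f (phi (t, a))))
  (phi_init : forall a v (h : R), A a -> A (a + h *: v) ->
     phi (0, a + h *: v) = phi (0, a) + h *: l v)
  (lLam : forall v, `|l v| <= Lam * `|v|).

(** Gronwall's inequality for the difference of two trajectories. Bounding by the initial difference
    is what makes the quotients below uniformly bounded: by [phi_init] that difference is exactly
    [h *: l v]. *)
Lemma flow_diff_bound : exists2 C : R, 0 < C & forall t a b, `|t| < T -> A a -> A b ->
  `|phi (t, b) - phi (t, a)| <= C * `|phi (0, b) - phi (0, a)|.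
Proof.
have [K K0 HK] := C1_lipschitz cB sB BO (fC 1%N).
have [C C0 HC] := gronwall (E := E) T (ltW K0).
exists C => // t a b tT Aa Ab.
have := HC (fun s => phi (s, b) - phi (s, a)) (fun s => f (phi (s, b)) - f (phi (s, a))) 0 (lexx _).
rewrite addr0; apply=> // s sT; first by apply: is_deriveB; exact: phi_ode.
by rewrite addr0; apply: HK; exact: phiB.
Qed.

Lemma flow_time_lipschitz : exists2 M : R, 0 < M & forall s t a, `|s| < T -> `|t| < T -> A a ->
  `|phi (t, a) - phi (s, a)| <= M * `|t - s|.
Proof.
have [M M0 HM] := @compact_cont_bound _ _ _ B f cB (fun x Bx => fC 0%N x (BO Bx)).
exists M => // s t a sT tT Aa.
have := @mvt_norm R E (fun s => phi (s, a)) (fun s => f (phi (s, a))) 0 s t M.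
rewrite scaler0 subr0 => H.
have inT r : `|r - s| <= `|t - s| -> `|r - t| <= `|t - s| -> `|r| < T.
  move: sT tT; rewrite !ltr_norml !ler_norml => /andP[? ?] /andP[? ?].
  have [st|/ltW ts] := leP s t.
    by rewrite ger0_norm ?subr_ge0 // => /andP[? ?] /andP[? ?]; apply/andP; split; lra.
  rewrite (distrC t) ger0_norm ?subr_ge0 // => /andP[? ?] /andP[? ?].
  by apply/andP; split; lra.
apply: H => r rs rt; first by apply: phi_ode => //; exact: inT.
by rewrite subr0; apply: HM; apply: phiB => //; exact: inT.
Qed.

Lemma flow_continuous t a : `|t| < T -> A a -> {for (t, a), continuous phi}.
Proof.
move=> tT Aa.
have [C C0 HC] := flow_diff_bound; have [M M0 HM] := flow_time_lipschitz.
have [r r0 rA] := open_ball_sub oA Aa.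
apply: cont_of_ball => e e0.
pose c := C * `|Lam| + M.
have c0 : 0 < c by rewrite ltr_wpDl // mulr_ge0 // ltW.
exists (Num.min (e / c) (Num.min r (T - `|t|))).
  by rewrite !lt_min r0 subr_gt0 tT divr_gt0.
move=> [s b]; rewrite !lt_min => /andP[He /andP[Hr HT]].
have H1 : `|s - t| <= `|(s, b) - (t, a)| by exact: (prod_norm_fst ((s, b) - (t, a))).
have H2 : `|b - a| <= `|(s, b) - (t, a)| by exact: (prod_norm_snd ((s, b) - (t, a))).
have Ab : A b by apply: rA; exact: le_lt_trans H2 Hr.
have sT : `|s| < T.
  rewrite -(subrK t s) (le_lt_trans (ler_normD _ _)) // -ltrBrDr.
  exact: le_lt_trans H1 HT.
have -> : phi (s, b) - phi (t, a) = (phi (s, b) - phi (s, a)) + (phi (s, a) - phi (t, a)).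
  by lmod R.
rewrite (le_trans (ler_normD _ _)) //.
have H3 : `|phi (s, b) - phi (s, a)| <= C * `|Lam| * `|(s, b) - (t, a)|.
  rewrite (le_trans (HC _ _ _ sT Aa Ab)) // -mulrA ler_wpM2l ?(ltW C0) //.
  have bE : b = a + 1 *: (b - a) by rewrite scale1r addrC subrK.
  rewrite {1}bE phi_init //; last by rewrite -bE.
  rewrite [X in X - _]addrC addrK scale1r (le_trans (lLam _)) //.
  by apply: le_trans (ler_wpM2r _ (ler_norm _)) _ => //; exact: ler_wpM2l.
have H4 : `|phi (s, a) - phi (t, a)| <= M * `|(s, b) - (t, a)|.
  by rewrite (le_trans (HM _ _ _ tT sT Aa)) // ler_wpM2l // ltW.
apply: le_trans (lerD H3 H4) _; rewrite -mulrDl -/c mulrC -ler_pdivlMr //.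
exact: ltW.
Qed.

(* [psi] is the limit of the difference quotients [q h] as [h] tends to 0: they
   solve the variational equation up to O(h), so Gronwall's inequality makes
   them Cauchy, uniformly in time. *)
Lemma flow_direction v : exists (psi : R^o * P -> E) (C : R),
  [/\ forall (t : R) a, `|t| < T -> A a -> is_derive (t, a) (0, v) phi (psi (t, a)),
      forall a, A a -> psi (0, a) = l v,
      forall (t : R) a, `|t| < T -> A a ->
        is_derive t 1 (fun s : R => psi (s, a)) ('d f (phi (t, a)) (psi (t, a))) &
      forall t a, `|t| < T -> A a -> `|psi (t, a)| <= C].
Proof.
have [K1 K10 HK1] := C1_compact_bound cB BO (fC 1%N).
have [K2 K20 HK2] := C2_taylor cB sB BO (fC 2%N).
have [K3 K30 HK3] := C2_lipschitz_diff cB sB BO (fC 2%N).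
have [C C0 HC] := flow_diff_bound.
have [M M0 HM] := flow_time_lipschitz.
have [D D0 HD] := gronwall (E := E) T (ltW K10).
have [k k0 Hk] := geometric_limit (E := E).
pose L := C * `|l v|.
have L0 : 0 <= L by rewrite mulr_ge0 // ltW.
pose q (h : R) (t : R) (a : P) : E := h^-1 *: (phi (t, a + h *: v) - phi (t, a)).
have qL h t a : h != 0 -> `|t| < T -> A a -> A (a + h *: v) -> `|q h t a| <= L.
  move=> h0 tT Aa Ah; rewrite normrZ normfV -ler_pdivlMl ?invr_gt0 ?normr_gt0 //.
  rewrite invrK (le_trans (HC _ _ _ tT Aa Ah)) // phi_init //.
  by rewrite [X in X - _]addrC addrK normrZ mulrCA.
have q0 h a : h != 0 -> A a -> A (a + h *: v) -> q h 0 a = l v.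
  move=> h0 Aa Ah; rewrite /q phi_init // [X in X - _]addrC addrK scalerA mulVf //.
  by rewrite scale1r.
pose dq (h : R) (t : R) (a : P) : E := h^-1 *: (f (phi (t, a + h *: v)) - f (phi (t, a))).
have qd h (t : R) a : `|t| < T -> A a -> A (a + h *: v) ->
    is_derive t 1 (fun s : R => q h s a) (dq h t a).
  by move=> tT Aa Ah; apply: is_deriveZ; apply: is_deriveB; exact: phi_ode.
(* The Taylor remainder is quadratic in [h *: q h t a]; division by [h] leaves one factor [|h|],
   with this constant. *)
pose N := K2 * L ^+ 2.
have N0 : 0 <= N by rewrite mulr_ge0 ?exprn_ge0 // ltW.
have dqE h t a : h != 0 -> `|t| < T -> A a -> A (a + h *: v) ->
    `|dq h t a - 'd f (phi (t, a)) (q h t a)| <= N * `|h|.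
  move=> h0 tT Aa Ah.
  have h_gt0 : 0 < `|h| by rewrite normr_gt0.
  have := HK2 _ _ (phiB tT Aa) (phiB tT Ah); set d := _ - phi (t, a) => Hd.
  have dE : d = h *: q h t a by rewrite /q scalerA divff // scale1r.
  have -> : dq h t a - 'd f (phi (t, a)) (q h t a) =
      h^-1 *: (f (phi (t, a + h *: v)) - f (phi (t, a)) - 'd f (phi (t, a)) d).
    by rewrite [RHS]scalerBr /dq /q linearZ.
  rewrite normrZ normfV -ler_pdivlMl ?invr_gt0 // invrK (le_trans Hd) //.
  rewrite dE normrZ exprMn /N [leRHS](_ : _ = K2 * (`|h| ^+ 2 * L ^+ 2)); last by ring.
  rewrite ler_wpM2l ?(ltW K20) // ler_wpM2l ?exprn_ge0 // lerXn2r ?nnegrE //.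
  exact: qL.
have qC h h' t a : h != 0 -> h' != 0 -> `|t| < T -> A a -> A (a + h *: v) ->
    A (a + h' *: v) -> `|q h' t a - q h t a| <= D * N * (`|h'| + `|h|).
  move=> h0 h'0 tT Aa Ah Ah'.
  have := HD (fun s => q h' s a - q h s a) (fun s => dq h' s a - dq h s a)
    (N * (`|h'| + `|h|)).
  rewrite !q0 // subrr normr0 add0r mulrA; apply=> //.
  - by rewrite mulr_ge0 // addr_ge0.
  - by move=> s sT; apply: is_deriveB; exact: qd.
  move=> s sT.
  have -> : dq h' s a - dq h s a =
      'd f (phi (s, a)) (q h' s a - q h s a) +
      ((dq h' s a - 'd f (phi (s, a)) (q h' s a)) -
       (dq h s a - 'd f (phi (s, a)) (q h s a))).
    by rewrite linearB /=; lmod R.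
  rewrite (le_trans (ler_normD _ _)) // lerD ?HK1 //; first exact: phiB.
  by rewrite (le_trans (ler_normB _ _)) // mulrDr lerD // dqE.
pose c := D * N.
have c0 : 0 <= c by rewrite mulr_ge0 // ltW.
(* The limit is first taken along the dyadic sequence [h n], where the Cauchy estimate [qC] is
   geometric; [qC] then compares any other admissible [h] with that sequence. *)
have Ex (ta : R^o * P) : exists psi, `|ta.1| < T -> A ta.2 ->
    forall h, h != 0 -> A (ta.2 + h *: v) -> `|q h ta.1 ta.2 - psi| <= c * `|h|.
  case: (boolP (`|ta.1| < T)) => tT; last by exists 0.
  have [Aa|nA] := pselect (A ta.2); last by exists 0.
  case: ta tT Aa => t a /= tT Aa.
  have [r r0 rA] := open_ball_sub oA Aa.
  pose h1 := r / (2 * (`|v| + 1)).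
  have v1 : 0 < `|v| + 1 by rewrite ltr_wpDl.
  have h10 : 0 < h1 by rewrite divr_gt0 // mulr_gt0.
  pose h n : R := h1 * 2^-1 ^+ n.
  have hn0 n : 0 < h n by rewrite mulr_gt0 // exprn_gt0 // invr_gt0.
  have hle n : h n <= h1.
    rewrite ler_piMr ?(ltW h10) // exprn_ile1 ?invr_ge0 //.
    by rewrite invf_le1 // ler1n.
  have Ah n : A (a + h n *: v).
    apply: rA; rewrite [a + _]addrC addrK normrZ gtr0_norm //.
    apply: (@le_lt_trans _ _ (h1 * (`|v| + 1))).
      by apply: ler_pM => //; [exact: ltW|rewrite lerDl].
    by rewrite /h1 invfM mulrA divfK ?gt_eqF // ltr_pdivrMr // ltr_pMr // ltr1n.
  have step n : `|q (h n.+1) t a - q (h n) t a| <= 2 * c * h1 * 2^-1 ^+ n.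
    rewrite (le_trans (qC _ _ _ _ _ _ tT Aa _ _)) ?gt_eqF //.
    rewrite -/c !gtr0_norm // [leRHS](_ : _ = c * (h n + h n)); last by rewrite /h; ring.
    rewrite ler_wpM2l // lerD2r /h ler_wpM2l ?(ltW h10) //.
    rewrite exprS ler_piMl ?exprn_ge0 ?invr_ge0 //.
    by rewrite invf_le1 // ler1n.
  have [p Hp] := Hk _ _ step.
  exists p => _ _ g g0 Ag; apply/ler_addgt0Pr => e e0.
  have : (fun n => (k * (2 * c * h1) + c * h1) * 2^-1 ^+ n : R) @ \oo --> (0 : R).
    by apply: cvg_geometric; rewrite ger0_norm ?invr_ge0 // invf_lt1 // ltr1n.
  move=> /cvgrPdist_le/(_ _ e0)[n _ Hn]; have := Hn n (leqnn _).
  rewrite sub0r normrN => {}Hn.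
  have -> : q g t a - p = (q g t a - q (h n) t a) + (q (h n) t a - p) by lmod R.
  have Hg : `|q g t a - q (h n) t a| <= c * (`|g| + `|h n|).
    by apply: qC => //; rewrite gt_eqF.
  rewrite (le_trans (ler_normD _ _)) // (le_trans (lerD Hg (Hp n))) // mulrDr -addrA lerD2l.
  rewrite (le_trans _ Hn) // (le_trans _ (ler_norm _)) // gtr0_norm // /h.
  by rewrite le_eqVlt; apply/orP; left; apply/eqP; ring.
have [psi Hpsi'] := choice Ex.
have Hpsi t a h : `|t| < T -> A a -> h != 0 -> A (a + h *: v) ->
    `|q h t a - psi (t, a)| <= c * `|h|.
  by move=> tT Aa h0 Ah; exact: (Hpsi' (t, a)).
have small a (e : R) : A a -> 0 < e -> exists h : R, [/\ 0 < h, h <= e & A (a + h *: v)].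
  move=> Aa e0; have [r r0 rA] := open_ball_sub oA Aa.
  have v1 : 0 < 2 * (`|v| + 1) by rewrite mulr_gt0.
  exists (Num.min e (r / (2 * (`|v| + 1)))); split.
  - by rewrite lt_min e0 divr_gt0.
  - by rewrite ge_min lexx.
  apply: rA; rewrite [a + _]addrC addrK normrZ gtr0_norm; last by rewrite lt_min e0 divr_gt0.
  apply: (@le_lt_trans _ _ (r / (2 * (`|v| + 1)) * (`|v| + 1))).
    apply: ler_pM => //; [|by rewrite ge_min lexx orbT|by rewrite lerDl].
    by rewrite le_min ltW //= divr_ge0 // ltW.
  rewrite invfM mulrA divfK ?gt_eqF //.
  by rewrite ltr_pdivrMr // ltr_pMr // ltr1n.
exists psi, (L + c); split.
- move=> t a tT Aa; apply/is_deriveP => e e0.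
  have [r r0 rA] := open_ball_sub oA Aa.
  have v1 : 0 < `|v| + 1 by rewrite ltr_wpDl.
  near=> h; have [->|h0] := eqVneq h 0.
    by rewrite !scale0r addr0 subrr subr0 !normr0 mulr0.
  have Ah : A (a + h *: v).
    apply: rA; rewrite [a + _]addrC addrK normrZ.
    have hr : `|h| < r / (`|v| + 1) by near: h; apply: near0_ltR; rewrite divr_gt0.
    apply: (@le_lt_trans _ _ (`|h| * (`|v| + 1))).
      by rewrite ler_wpM2l // lerDl.
    by rewrite -ltr_pdivlMr.
  have -> : (t, a) + h *: (0, v) = (t, a + h *: v) :> R^o * P.
    by congr (_, _); rewrite /= scaler0 addr0.
  have -> : phi (t, a + h *: v) - phi (t, a) - h *: psi (t, a) =
      h *: (q h t a - psi (t, a)).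
    by rewrite scalerBr /q scalerA divff // scale1r.
  rewrite normrZ mulrC ler_wpM2r // (le_trans (Hpsi _ _ _ _ _ _ _)) //.
  have : `|h| < e / (c + 1) by near: h; apply: near0_ltR; rewrite divr_gt0 // ltr_wpDl.
  rewrite ltr_pdivlMr ?ltr_wpDl // mulrDr mulr1 [c * _]mulrC.
  by have := normr_ge0 h; lra.
- move=> a Aa; apply/eqP; rewrite -subr_eq0 -normr_le0; apply/ler_addgt0Pr => e e0.
  have e1 : 0 < e / (c + 1) by rewrite divr_gt0 // ltr_wpDl.
  have [h [h0 he Ah]] := small a _ Aa e1.
  have hn0 : h != 0 by rewrite gt_eqF.
  have := Hpsi 0 a h; rewrite normr0 q0 // => H.
  rewrite add0r distrC (le_trans (H _ _ _ _)) // gtr0_norm //.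
  move: he; rewrite ler_pdivlMr ?ltr_wpDl // mulrDr mulr1 [c * _]mulrC.
  by move: h0; lra.
- move=> t a tT Aa.
  have r0 : 0 < T - `|t| by rewrite subr_gt0.
  have inT s : `|s - t| < T - `|t| -> `|s| < T.
    by move=> st; rewrite -(subrK t s) (le_lt_trans (ler_normD _ _)) // -ltrBrDr.
  have psiL s : `|s| < T -> `|psi (s, a)| <= L + c.
    move=> sT; have [h [h0 h1 Ah]] := small a 1 Aa ltr01.
    have hn0 : h != 0 by rewrite gt_eqF.
    rewrite -(subrK (q h s a) (psi (s, a))) addrC (le_trans (ler_normD _ _)) // lerD ?qL //.
    rewrite distrC (le_trans (Hpsi _ _ _ _ _ _ _)) // gtr0_norm //.
    by rewrite ler_piMr.
  (* The quotients are Lipschitz in time with a constant independent of [h], so [psi] inherits it.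
     This gives the continuity of the right-hand side of the variational equation, as the passage to
     the limit in the derivatives requires. *)
  have psi_lip s : `|s - t| < T - `|t| ->
      `|psi (s, a) - psi (t, a)| <= (K1 * L + N) * `|s - t|.
    move=> st; apply/ler_addgt0Pr => e e0.
    have c2 : 0 < 2 * c + 1 by rewrite ltr_wpDl // mulr_ge0.
    have e1 : 0 < Num.min 1 (e / (2 * c + 1)).
      by rewrite lt_min ltr01 divr_gt0.
    have [h [h0 he Ah]] := small a _ Aa e1.
    have hn0 : h != 0 by rewrite gt_eqF.
    move: he; rewrite le_min => /andP[h1 he].
    have sT := inT s st.
    have Hq : `|q h s a - q h t a| <= (K1 * L + N) * `|s - t|.
      have := @mvt_norm R E (fun s => q h s a) (fun s => dq h s a) 0 t s (K1 * L + N).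
      rewrite scaler0 subr0; apply=> u ut us; have uT : `|u| < T.
          by apply: inT; exact: le_lt_trans ut st.
        exact: qd.
        by apply: inT; exact: le_lt_trans ut st.
      rewrite subr0 -(subrK ('d f (phi (u, a)) (q h u a)) (dq h u a)) addrC.
      rewrite (le_trans (ler_normD _ _)) // lerD //.
        rewrite (le_trans (HK1 _ _ _)) //; first exact: phiB.
        by rewrite ler_wpM2l ?(ltW K10) // qL.
      rewrite (le_trans (dqE _ _ _ _ _ _ _)) // gtr0_norm //.
      by rewrite ler_piMr.
    have -> : psi (s, a) - psi (t, a) = (q h s a - q h t a) +
       ((q h t a - psi (t, a)) - (q h s a - psi (s, a))) by lmod R.
    rewrite (le_trans (ler_normD _ _)) // lerD // (le_trans (ler_normB _ _)) //.
    rewrite (le_trans (lerD (Hpsi _ _ _ tT Aa hn0 Ah) (Hpsi _ _ _ sT Aa hn0 Ah))) //.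
    rewrite gtr0_norm //; move: he; rewrite ler_pdivlMr //.
    by move: h0; nra.
  have KLN : 0 <= K1 * L + N by rewrite addr_ge0 // mulr_ge0 // ltW.
  apply: (@is_derive_uniform_limit R E (fun s => psi (s, a))
    (fun s => 'd f (phi (s, a)) (psi (s, a))) t _ r0).
    apply: cont_of_ball => e e0.
    pose w := K3 * M * (L + c) + K1 * (K1 * L + N) + 1.
    have w0 : 0 < w.
      rewrite ltr_wpDl // addr_ge0 // mulr_ge0 ?(ltW K10) // ?mulr_ge0 ?(ltW K30) ?(ltW M0) //.
      by rewrite addr_ge0.
    exists (Num.min (T - `|t|) (e / w)); first by rewrite lt_min r0 divr_gt0.
    move=> s; rewrite lt_min => /andP[st se].
    have sT := inT s st.
    have -> : 'd f (phi (s, a)) (psi (s, a)) - 'd f (phi (t, a)) (psi (t, a)) =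
       ('d f (phi (s, a)) (psi (s, a)) - 'd f (phi (t, a)) (psi (s, a))) +
       'd f (phi (t, a)) (psi (s, a) - psi (t, a)).
      by rewrite linearB /=; lmod R.
    apply: (@le_trans _ _ (w * `|s - t|)); last first.
      by rewrite mulrC -ler_pdivlMr // ltW.
    rewrite (le_trans (ler_normD _ _)) // /w mulrDl mul1r ler_wpDr // mulrDl lerD //.
      rewrite (le_trans (HK3 _ _ _ (phiB tT Aa) (phiB sT Aa))) //.
      rewrite [leRHS](_ : _ = K3 * (M * `|s - t|) * (L + c)); last by ring.
      apply: ler_pM => //; first by rewrite mulr_ge0 // ltW.
        by rewrite ler_wpM2l ?(ltW K30) // HM.
      exact: psiL.
    rewrite (le_trans (HK1 _ _ (phiB tT Aa))) // -mulrA ler_wpM2l ?(ltW K10) //.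
    exact: psi_lip.
  move=> e e0.
  have e1 : 0 < e / (c + N + K1 * c + 1).
    by rewrite divr_gt0 // ltr_wpDl // !addr_ge0 // mulr_ge0 // ltW.
  have [h [h0 he Ah]] := small a _ Aa e1.
  have hn0 : h != 0 by rewrite gt_eqF.
  have K1c : 0 <= K1 * c by rewrite mulr_ge0 // ltW.
  have {}he : (c + N + K1 * c + 1) * h <= e.
    by rewrite mulrC -ler_pdivlMr // ltr_wpDl // !addr_ge0.
  exists (fun s => q h s a), (fun s => dq h s a) => s /inT sT; split.
  + exact: qd.
  + rewrite (le_trans (Hpsi _ _ _ sT Aa hn0 Ah)) // (le_trans _ he) // gtr0_norm //.
    by rewrite ler_wpM2r ?(ltW h0) // -!addrA lerDl !addr_ge0.
  + have -> : dq h s a - 'd f (phi (s, a)) (psi (s, a)) =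
      (dq h s a - 'd f (phi (s, a)) (q h s a)) +
      'd f (phi (s, a)) (q h s a - psi (s, a)).
      by rewrite linearB /=; lmod R.
    rewrite (le_trans (ler_normD _ _)) //.
    apply: le_trans (_ : _ <= N * h + K1 * (c * h)) _.
      apply: lerD; first by rewrite (le_trans (dqE _ _ _ hn0 sT Aa Ah)) // gtr0_norm.
      rewrite (le_trans (HK1 _ _ (phiB sT Aa))) // ler_wpM2l ?(ltW K10) //.
      by rewrite (le_trans (Hpsi _ _ _ sT Aa hn0 Ah)) // gtr0_norm.
    rewrite (le_trans _ he) // mulrA -mulrDl ler_wpM2r ?(ltW h0) //.
    by rewrite -!addrA ler_wpDl // lerD2l lerDl.
- move=> t a tT Aa; have [h [h0 h1 Ah]] := small a 1 Aa ltr01.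
  have hn0 : h != 0 by rewrite gt_eqF.
  rewrite -(subrK (q h t a) (psi (t, a))) addrC (le_trans (ler_normD _ _)) // lerD ?qL //.
  rewrite distrC (le_trans (Hpsi _ _ _ _ _ _ _)) // gtr0_norm //.
  by rewrite ler_piMr.
Unshelve. all: by end_near. Qed.

End Dependence.

Lemma is_derive_fst E P (phi : R^o * P -> E) (t : R) a d :
  is_derive t 1 (fun s : R => phi (s, a)) d -> is_derive (t, a) (1, 0) phi d.
Proof.
move=> /is_deriveP H; apply/is_deriveP => e e0.
have := H e e0; apply: filterS => h; set u := phi _; set w := phi _; set w' := phi _.
by have -> : w' = u by rewrite /w' /u; congr (phi (_, _)); rewrite /= scaler0 addr0.
Qed.

Lemma is_derive_pair E F (f : R -> E) (g : R -> F) (t : R) df dg :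
  is_derive t 1 f df -> is_derive t 1 g dg ->
  is_derive t 1 (fun s : R => (f s, g s)) (df, dg).
Proof.
move=> /is_deriveP Hf /is_deriveP Hg; apply/is_deriveP => e e0.
by near=> h; apply: prod_norm_le; near: h; [exact: Hf|exact: Hg].
Unshelve. all: by end_near. Qed.

Lemma segment_closed_setX E F (A : set E) (B : set F) :
  segment_closed A -> segment_closed B -> segment_closed (A `*` B).
Proof.
by move=> sA sB [x x'] [y y'] s [/= ? ?] [/= ? ?] s01; split; [exact: sA|exact: sB].
Qed.

Lemma Ck_on_diff_pair k E F {hE : findim E} (O : set E) (f : E -> F) : open O ->
  Coo_on O f -> Ck_on k (O `*` [set: E]) (fun y : E * E => 'd f (y.1) (y.2)).
Proof.
move=> oO fC.
have oD : open (O `*` [set: E]) by apply: open_setX => //; exact: openT.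
have cfst : continuous (fst : E * E -> E) by move=> x; exact: cvg_fst.
have csnd : continuous (snd : E * E -> E) by move=> x; exact: cvg_snd.
have C : Ck_on k (O `*` [set: E])
   (fun y : E * E => \sum_i fcoef (h := hE) i y.2 *: ('D_(fbase (h := hE) i) f \o fst) y).
  apply: Ck_on_sum => // i; apply: Ck_onZ => //.
    by apply: Ck_on_fcoef => //; exact: Ck_on_id_lin.
  apply: (@Ck_on_comp _ _ _ _ _ _ _ O) => //; first by move=> x [].
    exact: (fC k.+1).2.
  exact: Ck_on_id_lin.
apply: Ck_on_eq C => // y [Oy _].
have df : differentiable f y.1 by exact: (fC 1%N).1.
by rewrite /= -diff_sum_fbase // deriveE.
Qed.

Lemma open_flow_domain P (T : R) (A : set P) : open A ->
  open [set x : R^o * P | `|x.1| < T /\ A x.2].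
Proof.
move=> oA; have -> : [set x : R^o * P | `|x.1| < T /\ A x.2] = [set t : R^o | `|t| < T] `*` A.
  by [].
apply: open_setX => //.
apply: (@open_comp _ _ (fun t : R^o => `|t|) [set x | x < T]).
  by move=> t _; exact: norm_continuous.
exact: open_lt.
Qed.

(* Induction on [k] for all fields at once: [(phi, D_v phi)] follows the field
   [(x, w) |-> (f x, 'd f x w)], to which the induction hypothesis applies. *)
Lemma flow_Ck k P {hP : findim P} (A : set P) (T : R) : open A -> 0 < T ->
  forall E {hE : findim E} (f : E -> E) (O B : set E) (phi : R^o * P -> E)
    (l : P -> E) (Lam : R),
  open O -> Coo_on O f -> compact B -> segment_closed B -> B `<=` O ->
  (forall t a, `|t| < T -> A a -> B (phi (t, a))) ->
  (forall (t : R) a, `|t| < T -> A a ->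
     is_derive t 1 (fun s : R => phi (s, a)) (f (phi (t, a)))) ->
  (forall a v (h : R), A a -> A (a + h *: v) -> phi (0, a + h *: v) = phi (0, a) + h *: l v) ->
  (forall v, `|l v| <= Lam * `|v|) ->
  Ck_on k [set x : R^o * P | `|x.1| < T /\ A x.2] phi.
Proof.
move=> oA T0; elim: k => [|k IH] E hE f O B phi l Lam oO fC cB sB BO phiB phi_ode phi_init lLam.
  move=> [t a] [/= tT Aa].
  exact: (flow_continuous fC cB sB BO oA phiB phi_ode phi_init lLam).
have oD := @open_flow_domain P T A oA.
set D := [set x | _] in oD *.
have dt (t : R) a : `|t| < T -> A a -> is_derive (t, a) (1, 0) phi (f (phi (t, a))).
  by move=> tT Aa; apply: is_derive_fst; exact: phi_ode.
have dir v := flow_direction (hE := hE) fC cB sB BO T0 oA phiB phi_ode phi_init v.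
apply: Ck_on_partial => //.
  move=> [t a] i [/= tT Aa]; case: (fbase_prod i) => -[j ->].
    by rewrite fbase_R; case: (dt t a tT Aa).
  by have [psi [C [H _ _ _]]] := dir (fbase j); case: (H t a tT Aa).
move=> i; case: (fbase_prod i) => -[j ->].
  (* In the time direction the derivative is [f \o phi], which is C^k by the induction hypothesis
     for the same flow. *)
  rewrite fbase_R.
  have C : Ck_on k D (f \o phi).
    apply: (@Ck_on_comp _ _ _ _ _ _ _ O) => //; first by move=> [t a] [/= tT Aa]; exact/BO/phiB.
    exact: (IH E hE f O B phi l Lam).
  apply: Ck_on_eq C => // -[t a] [/= tT Aa].
  by case: (dt t a tT Aa) => _ ->.
have [psi [C [H1 H2 H3 H4]]] := dir (fbase j).
have [T00 C0] : `|0 : R| < T /\ True by rewrite normr0.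
have Ck2 : Ck_on k D (fun x => (phi x, psi x)).
  (* The bound [C] on [psi] provides the compact convex set for the second component. The pair
     starts at [(phi (0, a), l (fbase j))], which is affine in [a] with linear part
     [u |-> (l u, 0)]: for this reason initial values are allowed to be affine in the parameter
     instead of equal to it. *)
  apply: (IH _ _ (fun y => (f y.1, 'd f (y.1) (y.2))) (O `*` [set: E])
    (B `*` [set w : E | `|w - 0| <= C]) _ (fun u => (l u, 0)) Lam).
  - by apply: open_setX => //; exact: openT.
  - move=> n; have oO2 : open (O `*` [set: E]) by apply: open_setX => //; exact: openT.
    apply: Ck_on_pair => //; last exact: Ck_on_diff_pair.
    apply: (@Ck_on_comp _ n (E * E)%type E E hE (O `*` [set: E]) O f fst) => //.
    by move=> x [].
    by apply: Ck_on_id_lin => x; exact: cvg_fst.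
  - apply: compact_setX => //.
    exact: findim_closed_ball_compact.
  - by apply: segment_closed_setX => //; exact: ball_segment_closed.
  - by move=> [x w] [/= Bx _]; split=> //; exact: BO.
  - by move=> t a tT Aa; split=> /=; [exact: phiB|rewrite subr0; exact: H4].
  - by move=> t a tT Aa; apply: is_derive_pair; [exact: phi_ode|exact: H3].
  - move=> a v h Aa Ah; rewrite phi_init // !H2 //.
    by congr (_, _); rewrite /= scaler0 addr0.
  - move=> v; apply: prod_norm_le => //=; rewrite normr0.
    exact: le_trans (normr_ge0 _) (lLam v).
have csnd : continuous (snd : E * E -> E) by move=> x; exact: cvg_snd.
have C2 := Ck_on_lin oD csnd Ck2.
apply: Ck_on_eq C2 => // -[t a] [/= tT Aa].
by case: (H1 t a tT Aa) => _ ->.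
Qed.

(** The last clause, the variational equation for derivatives in the initial point, is the one from
    which the first variation of the action will be computed. *)
Lemma local_flow E {hE : findim E} (f : E -> E) (O : set E) (x0 : E) :
  open O -> Coo_on O f -> O x0 ->
  exists (T r : R) (phi : R^o * E -> E),
  let D := [set x : R^o * E | `|x.1| < T /\ `|x.2 - x0| < r] in
  [/\ 0 < T, 0 < r, Coo_on D phi,
      forall x, `|x - x0| < r -> phi (0, x) = x &
      forall (t : R) x, `|t| < T -> `|x - x0| < r ->
        [/\ O (phi (t, x)),
            is_derive t 1 (fun s : R => phi (s, x)) (f (phi (t, x))) &
            forall v, is_derive t 1 (fun s : R => 'D_(0, v) phi (s, x))
              ('d f (phi (t, x)) ('D_(0, v) phi (t, x)))]].
Proof.
move=> oO fC Ox0.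
have [r1 r10 r1O] := open_ball_sub oO Ox0.
(* Initial points lie within [r] of [x0] and trajectories move by at most [r], so they stay in the
   ball [B] of radius [2 * r], half the radius [r1] available in [O]. *)
pose r := r1 / 4; have r0 : 0 < r by rewrite divr_gt0.
pose B := [set x : E | `|x - x0| <= 2 * r].
have BO : B `<=` O.
  by move=> x; rewrite /B /= => xr; apply: r1O; rewrite (le_lt_trans xr) // /r; lra.
have cB : compact B by exact: findim_closed_ball_compact.
have sB : segment_closed B by exact: ball_segment_closed.
have r20 : 0 < 2 * r by rewrite mulr_gt0.
have [rho [rho_lip rhoB rho_id]] := radial_retraction x0 r20.
have [K K0 HK] := C1_lipschitz cB sB BO (fC 1%N).
have [M M0 HM] := @compact_cont_bound _ _ _ B f cB (fun x Bx => fC 0%N x (BO x Bx)).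
(* The first bound gives the contraction ratio 1/2 for the field [f \o rho], whose Lipschitz
   constant is [2 * K]; the second keeps the displacement, at most [M * |t|], below [r]. *)
pose T := Num.min (2 * (2 * K))^-1 (r / M).
have T0 : 0 < T by rewrite lt_min invr_gt0 divr_gt0 // !mulr_gt0.
have K20 : 0 < 2 * K by rewrite mulr_gt0.
(* [f \o rho] is globally bounded and Lipschitz; its trajectories starting near
   [x0] stay in [B], where [rho] is the identity. *)
have [|||||phi [phi0 phi_d phi_M phi_lip]] := @global_flow R E hE (f \o rho) M (2 * K) T.
- by move=> x; apply: HM; exact: rhoB.
- move=> x y; rewrite (le_trans (HK _ _ (rhoB _) (rhoB _))) //.
  by rewrite (mulrC 2) -mulrA ler_wpM2l ?(ltW K0).
- by [].
- by [].
- apply: (@le_trans _ _ (2 * K * (2 * (2 * K))^-1)).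
    by rewrite ler_wpM2l ?(ltW K20) // ge_min lexx.
  by rewrite [(2 * (2 * K))^-1]invfM mulrCA divff ?gt_eqF // mulr1.
have Bphi t a : `|t| < T -> `|a - x0| < r -> B (phi t a).
  move=> tT ar; rewrite /B /= -(subrK a (phi t a)) -addrA (le_trans (ler_normD _ _)) //.
  rewrite mulr_natl mulr2n lerD ?(ltW ar) // (le_trans (phi_M _ _ (ltW tT))) //.
  rewrite mulrC -ler_pdivlMr // (le_trans (ltW tT)) // ge_min lexx orbT //.
pose A := [set a : E | `|a - x0| < r].
have oA : open A by exact: open_norm_lt.
pose Phi (x : R^o * E) := phi x.1 x.2.
have Phi_ode (t : R) a : `|t| < T -> A a ->
    is_derive t 1 (fun s : R => Phi (s, a)) (f (Phi (t, a))).
  move=> tT Aa; have := phi_d t a tT; rewrite /= rho_id //; exact: Bphi.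
have Phi_init a v (h : R) : A a -> A (a + h *: v) -> Phi (0, a + h *: v) = Phi (0, a) + h *: v.
  by move=> _ _; rewrite /Phi !phi0.
have PhiB t a : `|t| < T -> A a -> B (Phi (t, a)) by exact: Bphi.
have l1 (v : E) : `|v| <= 1 * `|v| by rewrite mul1r.
exists T, r, Phi; split=> //.
- move=> k; exact: (@flow_Ck k E hE A T oA T0 E hE f O B Phi id 1).
- by move=> x _; exact: phi0.
move=> t x tT Ax; split; [exact/BO/Bphi|exact: Phi_ode|].
move=> v.
have [psi [C [H1 _ H3 _]]] :=
  @flow_direction E E hE f O B T A Phi id fC cB sB BO T0 oA PhiB Phi_ode Phi_init v.
have E1 (s : R) : `|s| < T -> 'D_(0, v) Phi (s, x) = psi (s, x).
  by move=> sT; case: (H1 s x sT Ax).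
rewrite E1 //.
apply: near_eq_is_derive (H3 t x tT Ax).
have Tt : 0 < T - `|t| by rewrite subr_gt0.
near=> s; rewrite E1 //.
rewrite -(subrK t s) (le_lt_trans (ler_normD _ _)) // -ltrBrDr.
rewrite distrC; near: s; apply/nbhs_ballP; exists (T - `|t|) => //=.
Unshelve. all: by end_near. Qed.

End Flow.

(** * The inverse function theorem *)

Section InverseFunction.
Context {R : realType}.
Implicit Types E F G P : normedModType R.

Lemma Ck_on_det k E (D : set E) n (M : E -> 'M[R]_n) : open D ->
  (forall i j, Ck_on k D (fun x => M x i j : R^o)) -> Ck_on k D (fun x => \det (M x) : R^o).
Proof.
move=> oD CM.
apply: (@Ck_on_sum _ k E R^o) => // s; apply: Ck_onM => //; first exact: Ck_on_cst.
exact: Ck_on_prod.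
Qed.

(** Cramer's rule: the entries of the inverse are cofactors divided by a determinant that does not
    vanish on [D]. *)
Lemma Ck_on_invmx k E (D : set E) n (M : E -> 'M[R]_n) : open D ->
  (forall i j, Ck_on k D (fun x => M x i j : R^o)) -> (forall x, D x -> M x \in unitmx) ->
  forall i j, Ck_on k D (fun x => invmx (M x) i j : R^o).
Proof.
move=> oD CM uM i j.
have Cdet := Ck_on_det oD CM.
have CV : Ck_on k D (fun x => (\det (M x))^-1 : R^o).
  by apply: Ck_onV => // x Dx; rewrite -unitfE; exact: uM.
have Cadj : Ck_on k D (fun x => cofactor (M x) j i : R^o).
  apply: (@Ck_onM _ k E D (fun=> (-1) ^+ (j + i)) (fun x => \det (row' j (col' i (M x))))) => //.
    exact: Ck_on_cst.
  apply: Ck_on_det => // a b.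
  by under eq_fun do rewrite !mxE.
apply: Ck_on_eq (Ck_onM oD CV Cadj) => // x Dx.
by rewrite /invmx uM // !mxE.
Qed.

Section FindimEndo.
Context {E : normedModType R} {h : findim E}.

Definition endo_mx (A : E -> E) : 'M[R]_(fdim E) :=
  \matrix_(i, j) fcoef j (A (fbase i)).

Lemma endo_mxP (A : {linear E -> E}) (x : E) : fcoord (A x) = fcoord x *m endo_mx A.
Proof.
rewrite {1}(fcoef_sum x) !linear_sum; apply/rowP => j; rewrite !mxE summxE.
by apply: eq_bigr => i _; rewrite !linearZ !mxE.
Qed.

Definition mx_endo (M : 'M[R]_(fdim E)) (x : E) : E := fvec (fcoord x *m M).

Lemma mx_endo_linear M : linear (mx_endo M).
Proof. by move=> a x y; rewrite /mx_endo linearP mulmxDl -scalemxAl linearP. Qed.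

HB.instance Definition _ M := GRing.isLinear.Build R E E _ (mx_endo M) (mx_endo_linear M).

Lemma endo_mx_unit (A : {linear E -> E}) :
  (forall w, A w = 0 -> w = 0) -> endo_mx A \in unitmx.
Proof.
move=> A0; rewrite -row_free_unit; apply: inj_row_free => v vM.
have : A (fvec v) = 0 by apply: (can_inj fcoordK); rewrite endo_mxP fvecK vM linear0.
by move=> /A0 v0; rewrite -(fvecK v) v0 linear0.
Qed.

Lemma endo_mxK (A : {linear E -> E}) : endo_mx A \in unitmx ->
  cancel A (mx_endo (invmx (endo_mx A))) /\ cancel (mx_endo (invmx (endo_mx A))) A.
Proof.
move=> uA; split=> x; rewrite /mx_endo.
  by rewrite endo_mxP mulmxK // fcoordK.
by apply: (can_inj fcoordK); rewrite endo_mxP fvecK mulmxKV.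
Qed.

End FindimEndo.

Section NearIdentity.
Context {E : normedModType R} {h : findim E}.
Variables (F : E -> E) (O : set E) (x0 : E) (r : R).
Hypotheses (oO : open O) (FC : Coo_on O F) (r0 : 0 < r)
  (rO : forall x, `|x - x0| <= r -> O x)
  (Fhalf : forall x w, `|x - x0| <= r -> `|'d F x w - w| <= 2^-1 * `|w|).

Lemma near_id_contraction x y : `|x - x0| <= r -> `|y - x0| <= r ->
  `|F y - F x - (y - x)| <= 2^-1 * `|y - x|.
Proof.
move=> xr yr; have sB := @ball_segment_closed R E x0 r.
apply: mvt_seg => s s01; have Hs := sB _ _ _ xr yr s01.
  by apply: (FC 1%N).1; exact: rO.
exact: Fhalf.
Qed.

Lemma near_id_expand x y : `|x - x0| <= r -> `|y - x0| <= r ->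
  `|y - x| <= 2 * `|F y - F x|.
Proof.
move=> xr yr; have := near_id_contraction xr yr.
have : `|y - x| <= `|F y - F x| + `|F y - F x - (y - x)|.
  rewrite {1}(_ : y - x = (F y - F x) - (F y - F x - (y - x))); last by lmod R.
  exact: ler_normB.
by lra.
Qed.

(** A solution is a fixed point of the contraction [Tm]. Compactness replaces iteration: at a
    minimiser [p] of [|Tm x - x|], passing to [Tm p] would at least halve the minimum, so it is 0.
    The radius [r / 2] for [y] is what keeps [Tm] inside the ball. *)
Lemma near_id_surj y : `|y - F x0| < r / 2 -> exists2 x, `|x - x0| < r & F x = y.
Proof.
move=> yr; pose B := [set x : E | `|x - x0| <= r].
pose Tm x := y - (F x - x).
have Tdiff x x' : B x -> B x' -> `|Tm x' - Tm x| <= 2^-1 * `|x' - x|.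
  move=> Bx Bx'; rewrite (_ : Tm x' - Tm x = - (F x' - F x - (x' - x))); last by rewrite /Tm; lmod R.
  by rewrite normrN; exact: near_id_contraction.
have Bx0 : B x0 by rewrite /B /= subrr normr0 ltW.
have TB x : B x -> `|Tm x - x0| < r.
  move=> Bx; rewrite (_ : Tm x - x0 = (Tm x - Tm x0) + (y - F x0)); last by rewrite /Tm; lmod R.
  rewrite (le_lt_trans (ler_normD _ _)) //.
  have := Tdiff _ _ Bx0 Bx; have : `|x - x0| <= r by []; move: yr.
  by move=> ? ? ?; rewrite [ltRHS]splitr; lra.
have cB : compact B by exact: findim_closed_ball_compact.
have [||p] := @compact_EVT_min E R (fun x => `|Tm x - x|) B _ cB.
- by exists x0.
- apply: continuous_in_subspaceT => x; rewrite inE => Bx.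
  apply: cvg_norm; apply: cvgB; last exact: cvg_id.
  apply: cvgB; first exact: cvg_cst.
  apply: cvgB; last exact: cvg_id.
  by apply: (FC 0%N); exact: rO.
rewrite inE => Bp pmin.
have TBp := TB p Bp.
have := pmin (Tm p); rewrite inE => /(_ (ltW TBp)).
have := Tdiff _ _ Bp (ltW TBp : B (Tm p)) => H1 H2.
have Tp0 : Tm p - p = 0.
  by apply/eqP; rewrite -normr_le0; move: (normr_ge0 (Tm p - p)); lra.
have TpE : Tm p = p by apply/eqP; rewrite -subr_eq0 Tp0.
exists p; first by rewrite -{1}TpE.
move: Tp0; rewrite /Tm => /eqP; rewrite subr_eq0 => /eqP H.
by apply/eqP; rewrite eq_sym -subr_eq0 -(subrK p (F p)) opprD addrA H subrr.
Qed.

Lemma near_id_inverse : exists g : E -> E,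
  (forall y, `|y - F x0| < r / 2 -> `|g y - x0| < r /\ F (g y) = y) /\
  Coo_on [set y | `|y - F x0| < r / 2] g.
Proof.
have H y : exists x, `|y - F x0| < r / 2 -> `|x - x0| < r /\ F x = y.
  case: (boolP (`|y - F x0| < r / 2)) => yr; last by exists x0.
  by have [x xr xE] := near_id_surj yr; exists x.
have [g Hg] := choice H.
exists g; split=> //.
pose V := [set y | `|y - F x0| < r / 2].
have oV : open V by exact: open_norm_lt.
pose U := [set x | `|x - x0| < r]; have oU : open U by exact: open_norm_lt.
have UO : U `<=` O by move=> x xr; apply: rO; exact: ltW.
have glip y y' : V y -> V y' -> `|g y' - g y| <= 2 * `|y' - y|.
  move=> /Hg[gy Fgy] /Hg[gy' Fgy']; rewrite -{2}Fgy -{2}Fgy'.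
  by apply: near_id_expand; exact: ltW.
pose M (x : E) : 'M[R]_(@fdim R E h) := @endo_mx E h ('d F x).
have uM x : U x -> M x \in unitmx.
  move=> Ux; apply: endo_mx_unit => w dw0; have := Fhalf w (ltW Ux).
  rewrite dw0 sub0r normrN => Hw; apply/eqP; rewrite -normr_le0.
  by move: (normr_ge0 w); lra.
have CM k i j : Ck_on k U (fun x => M x i j : R^o).
  have C : Ck_on k U (fun x => fcoef j ('D_(fbase i) F x) : R^o).
    by apply: Ck_on_fcoef => //; apply: Ck_on_subset UO _; exact: (FC k.+1).2.
  apply: Ck_on_eq C => // x Ux; rewrite mxE deriveE //.
  by apply: (FC 1%N).1; exact: UO.
have gd y : V y -> differentiable g y /\ 'd g y = mx_endo (invmx (M (g y))) :> (E -> E).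
  move=> Vy; have [gU Fg] := Hg y Vy.
  pose L : {linear E -> E} := @mx_endo E h (invmx (M (g y))).
  have [KL _] : cancel ('d F (g y)) L /\ cancel L ('d F (g y)).
    by apply: endo_mxK; exact: uM.
  apply: (@differentiable_of R E E g y L); first exact: findim_linear_continuous.
  move=> e e0.
  have [K K0 HK] := linear_lipschitz (@findim_linear_continuous R E E h L).
  have e1 : 0 < e / (2 * K) by rewrite divr_gt0 // mulr_gt0.
  have dF : differentiable F (g y) by apply: (FC 1%N).1; exact: UO.
  have /nbhs_ballP[d /= d0 dP] := differentiable_near dF e1.
  have [r1 r10 r1V] := open_ball_sub oV Vy.
  near=> k.
  have Vk : V (k + y).
    by apply: r1V; rewrite addrK; near: k; apply: nbhs0_lt.
  set u := g (k + y) - g y.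
  have uk : `|u| <= 2 * `|k| by have := glip _ _ Vy Vk; rewrite addrK.
  have ud : ball (0 : E) d u.
    rewrite -ball_normE /= sub0r normrN (le_lt_trans uk) //.
    rewrite mulrC -ltr_pdivlMr //; near: k; apply: nbhs0_lt; by rewrite divr_gt0.
  have := dP u ud; rewrite /= subrK (Hg _ Vk).2 Fg addrK => Hd.
  (* Since [L] inverts ['d F (g y)], the linearisation error of [g] is the image under [- L] of that
     of [F] at the increment [u], and [|u| <= 2 * |k|]. *)
  have -> : u - L k = - L (k - 'd F (g y) u) by rewrite linearB /= KL opprB.
  rewrite normrN (le_trans (HK _)) // mulrC -ler_pdivlMr // (le_trans Hd) //.
  apply: (@le_trans _ _ (e / (2 * K) * (2 * `|k|))).
    by rewrite ler_wpM2l // ltW.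
  rewrite le_eqVlt; apply/orP; left; apply/eqP; field; by rewrite gt_eqF.
(* Bootstrapping: the derivative of [g] is [invmx (M (g y))] in coordinates, so it is of class C^k
   whenever [g] is. *)
elim=> [|k IH].
  by move=> y Vy; apply: differentiable_continuous; exact: (gd y Vy).1.
split=> [y Vy|v]; first exact: (gd y Vy).1.
have C : Ck_on k V (fvec \o (fun y => fcoord v *m invmx (M (g y)))).
  apply: Ck_on_lin => //; first exact: fvec_continuous.
  apply: Ck_on_mx => // i j.
  have C : Ck_on k V (fun y => \sum_l fcoord v i l * invmx (M (g y)) l j : R^o).
    apply: (@Ck_on_sum _ k E R^o) => // l; apply: Ck_onM => //; first exact: Ck_on_cst.
    apply: (@Ck_on_comp _ k E E R^o h V U (fun x => invmx (M x) l j) g) => //.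
      by move=> y /Hg[].
    exact: Ck_on_invmx.
  by apply: Ck_on_eq C => // y _; rewrite mxE.
apply: Ck_on_eq C => // y Vy; have [dg dgE] := gd y Vy.
by rewrite deriveE // dgE.
Unshelve. all: by end_near. Qed.

End NearIdentity.

(** Composition with the inverse of ['d F x0] makes the derivative at [x0] the identity; by
    continuity it stays within 1/2 of the identity on a ball, where the previous lemmas apply. *)
Theorem inverse_function E {h : findim E} (F : E -> E) (O : set E) (x0 : E) :
  open O -> Coo_on O F -> O x0 -> (forall w, 'd F x0 w = 0 -> w = 0) ->
  exists (U V : set E) (g : E -> E),
  [/\ [/\ open U, U `<=` O & U x0], open V,
      forall x, U x -> V (F x) /\ g (F x) = x,
      forall y, V y -> U (g y) /\ F (g y) = y & Coo_on V g].
Proof.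
move=> oO FC Ox0 inj.
have uA := endo_mx_unit (h := h) inj.
pose L : {linear E -> E} := @mx_endo E h (invmx (@endo_mx E h ('d F x0))).
have [KL LK] : cancel ('d F x0) L /\ cancel L ('d F x0) by exact: endo_mxK.
have cL : continuous L by exact: findim_linear_continuous.
pose F2 := L \o F.
have F2C : Coo_on O F2 by move=> k; exact: Ck_on_lin (FC k).
have dF x : O x -> differentiable F x by exact: (FC 1%N).1.
have dL x : differentiable L x by exact: linear_differentiable.
have dLE x : 'd L x = L :> (E -> E) by exact: diff_lin.
have dF2 x w : O x -> 'd F2 x w = L ('d F x w).
  by move=> Ox; rewrite /F2 (diff_comp (dF x Ox) (dL _)) /= dLE.
pose N := F2 \- id.
have NC : Coo_on O N.
  move=> k; apply: Ck_onD => //.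
  by apply: (@Ck_on_id_lin _ k E E O -%R) => x; apply: cvgN; exact: cvg_id.
have [M M0 HM] := fcoef_bound (E := E).
pose n := @fdim R E h.
(* Ensures [n * M * e <= 1/2]: there are [n] partial derivatives of size at most [e], each weighted
   by a coordinate of size at most [M * |w|]. *)
pose e := 2^-1 / (n%:R * M + 1).
have nM : 0 < n%:R * M + 1 by rewrite ltr_wpDl // mulr_ge0 // ltW.
have e0 : 0 < e by rewrite divr_gt0 // invr_gt0.
have dN x w : O x -> 'd N x w = 'd F2 x w - w.
  move=> Ox; have dF2x : differentiable F2 x by exact: (F2C 1%N).1.
  rewrite -deriveE; last exact: (NC 1%N).1.
  rewrite /N deriveB; [|exact: diff_derivable|exact: derivable_id].
  by rewrite derive_id deriveE.
have DN0 i : 'D_(fbase (h := h) i) N x0 = 0.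
  rewrite deriveE; last exact: (NC 1%N).1.
  by rewrite dN // dF2 // KL subrr.
have [r r0 rP] : exists2 r : R, 0 < r & forall x, `|x - x0| <= r ->
    O x /\ forall i, `|'D_(fbase (h := h) i) N x| <= e.
  have [r r0 rO] := open_ball_sub oO Ox0.
  have Hd i : exists2 d : R, 0 < d &
      forall y, `|y - x0| < d -> `|'D_(fbase i) N y| <= e.
    have [d d0 dP] := cont_ball ((NC 1%N).2 (fbase i) x0 Ox0) e0.
    by exists d => // y /dP; rewrite DN0 subr0.
  have H : \forall d \near 0^'+, forall i : 'I_n, forall y, `|y - x0| < d ->
      `|'D_(fbase i) N y| <= e.
    apply: filter_forall => i; have [d d0 dP] := Hd i.
    near=> z => y yz; apply: dP; apply: lt_le_trans yz _.
    by near: z; exact: nbhs_right_le.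
  near (0 : R)^'+ => d; have d0 : 0 < d by [].
  have dP : forall i : 'I_n, forall y, `|y - x0| < d -> `|'D_(fbase i) N y| <= e.
    by near: d.
  have m0 : 0 < Num.min r d by rewrite lt_min r0.
  exists (Num.min r d / 2); first by rewrite divr_gt0.
  move=> x xr; have : `|x - x0| < Num.min r d by lra.
  by rewrite lt_min => /andP[/rO Ox xd]; split=> // i; exact: dP.
have F2half x w : `|x - x0| <= r -> `|'d F2 x w - w| <= 2^-1 * `|w|.
  move=> /rP[Ox DN]; rewrite -dN //.
  have dNx : differentiable N x by exact: (NC 1%N).1.
  rewrite -deriveE // diff_sum_fbase // (le_trans (ler_norm_sum _ _ _)) //.
  apply: (@le_trans _ _ (\sum_(i < n) (M * `|w| * e))).
    by apply: ler_sum => i _; rewrite normrZ; apply: ler_pM.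
  rewrite sumr_const card_ord -[_ *+ n]mulr_natl.
  rewrite [leLHS](_ : _ = n%:R * M * e * `|w|); last by ring.
  rewrite ler_wpM2r // /e mulrCA ler_piMr ?invr_ge0 // ler_pdivrMr // mul1r.
  by rewrite lerDl.
have rO x : `|x - x0| <= r -> O x by move=> /rP[].
have [g [Hg gC]] := near_id_inverse (h := h) F2C r0 rO F2half.
pose V2 := [set y | `|y - F2 x0| < r / 2].
have oV2 : open V2 by exact: open_norm_lt.
pose U0 := [set x | `|x - x0| < r]; have oU0 : open U0 by exact: open_norm_lt.
have U0O : U0 `<=` O by move=> x xr; apply: rO; exact: ltW.
have oV : open (L @^-1` V2) by apply: open_comp => // x _; exact: cL.
exists (U0 `&` F2 @^-1` V2), (L @^-1` V2), (g \o L); split.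
- split.
  + rewrite openE => x [U0x V2x]; apply: filterI; first exact: open_nbhs_nbhs.
    have cF2 : {for x, continuous F2} by apply: (F2C 0%N); exact: U0O.
    by apply: cF2; exact: open_nbhs_nbhs.
  + by move=> x [/U0O].
  + by split; rewrite /U0 /V2 /= subrr normr0 // divr_gt0.
- exact: oV.
- move=> x [U0x V2x]; split=> //=.
  have [gr gE] := Hg _ V2x.
  have := near_id_expand F2C rO F2half (ltW gr) (ltW U0x).
  rewrite -/F2 gE subrr normr0 mulr0 normr_le0 subr_eq0 => /eqP xE.
  by rewrite {2}xE.
- move=> y V2y; have [gr gE] := Hg _ V2y; split=> /=.
    by split=> //; rewrite /= gE.
  by apply: (can_inj LK); rewrite -gE.
- move=> k; apply: (@Ck_on_comp _ k E E E h _ V2 g L) => //.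
  exact: Ck_on_id_lin.
Unshelve. all: by end_near. Qed.

End InverseFunction.

(** * Local Hamilton-Jacobi theory *)

Section ChainRules.
Context {R : realType}.
Implicit Types E F G P : normedModType R.

Lemma Ck_onN k E F (D : set E) (f : E -> F) : open D ->
  Ck_on k D f -> Ck_on k D (fun x => - f x).
Proof.
move=> oD Cf; have C := Ck_onZ oD (Ck_on_cst k D (-1 : R^o)) Cf.
by apply: Ck_on_eq C => // x _; rewrite /cst scaleN1r.
Qed.

Lemma is_derive_lineP E F (f : E -> F) x v d :
  is_derive x v f d <-> is_derive (0 : R) 1 (fun t : R => f (x + t *: v)) d.
Proof.
split=> [H|/is_deriveP H]; first by apply: is_derive_line; rewrite scale0r addr0.
apply/is_deriveP => e e0; have := H e e0; apply: filterS => h.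
rewrite scale0r addr0.
by rewrite add0r (_ : h%:A = h) //; exact: mulr1.
Qed.

(** Only [f] along [v] matters: on that line derivability and differentiability coincide, and the
    usual chain rule applies. *)
Lemma is_derive_comp_diff E F G (f : E -> F) (g : F -> G) x v d :
  is_derive x v f d -> differentiable g (f x) -> is_derive x v (g \o f) ('d g (f x) d).
Proof.
move=> /is_derive_lineP H dg; apply/is_derive_lineP.
pose u (t : R) := f (x + t *: v).
have u0 : u 0 = f x by rewrite /u scale0r addr0.
have du : differentiable u 0 by apply/derivable1_diffP; case: H.
have dgu : differentiable g (u 0) by rewrite u0.
have -> : d = 'd u 0 1 by case: H => _ <-; rewrite -deriveE.
rewrite -u0; have -> : 'd g (u 0) ('d u 0 1) = 'd (g \o u) 0 1.
  by rewrite (diff_comp du dgu).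
have D : is_derive (0 : R) 1 (g \o u) ('d (g \o u) 0 1).
  by apply: diff_is_derive; exact: differentiable_comp du dgu.
exact: D.
Qed.

Lemma is_derive_lin E F G (f : E -> F) (l : {linear F -> G}) x v d :
  continuous l -> is_derive x v f d -> is_derive x v (l \o f) (l d).
Proof.
move=> lc H; have dl : differentiable l (f x) by exact: linear_differentiable.
have dlE : 'd l (f x) = l :> (F -> G) by exact: diff_lin.
by have := is_derive_comp_diff H dl; rewrite dlE.
Qed.

Lemma is_derive_fstc E F G (f : E -> F * G) x v d :
  is_derive x v f d -> is_derive x v (fun y => (f y).1) d.1.
Proof.
move=> H; have cfst : continuous (fst : F * G -> F) by move=> y; exact: cvg_fst.
exact: (@is_derive_lin E (F * G)%type F f fst x v d cfst H).
Qed.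

Lemma is_derive_sndc E F G (f : E -> F * G) x v d :
  is_derive x v f d -> is_derive x v (fun y => (f y).2) d.2.
Proof.
move=> H; have csnd : continuous (snd : F * G -> G) by move=> y; exact: cvg_snd.
exact: (@is_derive_lin E (F * G)%type G f snd x v d csnd H).
Qed.

Lemma is_derive_scalel E F (f : E -> R^o) (c : F) x v d :
  is_derive x v f d -> is_derive x v (fun y => f y *: c) (d *: c).
Proof.
move=> H; have ll : linear (fun a : R^o => a *: c).
  by move=> a u w; rewrite scalerDl scalerA.
pose l : {linear R^o -> F} := HB.pack (fun a : R^o => a *: c)
  (GRing.isLinear.Build _ _ _ _ _ ll).
by apply: (is_derive_lin (l := l) _ H); exact: findim_linear_continuous.
Qed.

Lemma is_derive_pairc E F G (f : E -> F) (g : E -> G) x v df dg :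
  is_derive x v f df -> is_derive x v g dg -> is_derive x v (fun y => (f y, g y)) (df, dg).
Proof.
move=> /is_derive_lineP Hf /is_derive_lineP Hg; apply/is_derive_lineP.
exact: is_derive_pair.
Qed.

Lemma is_derive_unique E F (f : E -> F) x v d d' :
  is_derive x v f d -> is_derive x v f d' -> d = d'.
Proof. by move=> [_ <-] [_ <-]. Qed.

Lemma is_derive_const E F (c : F) (x v : E) : is_derive x v (fun=> c) 0.
Proof. exact: is_derive_cst. Qed.

Lemma constant_derive0 F (u : R -> F) (T : R) :
  (forall t : R, `|t| < T -> is_derive t 1 u 0) -> forall t, `|t| < T -> u t = u 0.
Proof.
move=> ud t tT.
apply: (@is_derive_eq0 R F u (fun=> u 0) (fun=> 0) T) => // s _; exact: is_derive_const.
Qed.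

Lemma affine_derive F (u : R -> F) (c : F) (T : R) :
  (forall t : R, `|t| < T -> is_derive t 1 u c) -> forall t, `|t| < T -> u t = u 0 + t *: c.
Proof.
move=> ud t tT; apply: (@is_derive_eq0 R F u (fun t => u 0 + t *: c) (fun=> c) T) => //.
  by rewrite scale0r addr0.
move=> s _; apply/is_deriveP => e e0; near=> h.
have -> : u 0 + (s + h%:A) *: c - (u 0 + s *: c) - h *: c = 0.
  by rewrite [h%:A]mulr1; lmod R.
by rewrite normr0 mulr_ge0 // ltW.
Unshelve. all: by end_near. Qed.

Context {s : nat}.
Implicit Types (v : 'rV[R]_s) (p : 'cV[R]_s).

Definition dot v p : R^o := (v *m p) 0 0.

Lemma dotE v p : dot v p = \sum_i v 0 i * p i 0.
Proof. by rewrite /dot mxE. Qed.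

Lemma dotDl u v p : dot (u + v) p = dot u p + dot v p.
Proof. by rewrite /dot mulmxDl mxE. Qed.
Lemma dotNr v p : dot v (- p) = - dot v p.
Proof. by rewrite /dot mulmxN mxE. Qed.
Lemma dotZl a v p : dot (a *: v) p = a * dot v p.
Proof. by rewrite /dot -scalemxAl mxE. Qed.
Lemma dot0l p : dot 0 p = 0.
Proof. by rewrite /dot mul0mx mxE. Qed.

Lemma is_derive_entry E m n (f : E -> 'M[R]_(m, n)) (x w : E) d i j :
  is_derive x w f d -> is_derive x w (fun y => f y i j : R^o) (d i j).
Proof.
move=> H.
pose l : {linear 'M[R]_(m, n) -> R^o} := HB.pack (fun A : 'M[R]_(m, n) => A i j : R^o)
  (GRing.isLinear.Build _ _ _ _ _ (mx_entry_linear i j)).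
by apply: (is_derive_lin (l := l) _ H); exact: findim_linear_continuous.
Qed.

Lemma is_derive_dot E (f : E -> 'rV[R]_s) (g : E -> 'cV[R]_s) x w df dg :
  is_derive x w f df -> is_derive x w g dg ->
  is_derive x w (fun y => dot (f y) (g y)) (dot df (g x) + dot (f x) dg).
Proof.
move=> Hf Hg.
have -> : (fun y => dot (f y) (g y)) = \sum_(i < s) (fun y => f y 0 i * g y i 0).
  by apply/funext => y; rewrite fct_sumE dotE.
have -> : dot df (g x) + dot (f x) dg = \sum_(i < s) (df 0 i * g x i 0 + f x 0 i * dg i 0).
  by rewrite !dotE big_split.
apply: is_derive_sum => i.
have := @is_deriveM R _ _ _ x w _ _ (is_derive_entry 0 i Hf) (is_derive_entry i 0 Hg).
move=> H; apply: (is_derive_eq H).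
by rewrite /GRing.scale /= addrC; congr (_ + _); rewrite mulrC.
Qed.

Lemma Ck_on_dot k E (D : set E) (f : E -> 'rV[R]_s) (g : E -> 'cV[R]_s) : open D ->
  Ck_on k D f -> Ck_on k D g -> Ck_on k D (fun y => dot (f y) (g y)).
Proof.
move=> oD Cf Cg.
have C : Ck_on k D (fun y => \sum_i f y 0 i * g y i 0 : R^o).
  apply: (@Ck_on_sum _ k E R^o) => // i; apply: Ck_onM => //; exact: Ck_on_entry.
by apply: Ck_on_eq C => // y _; rewrite dotE.
Qed.

End ChainRules.

(** * The Hamiltonian flow with its action coordinate *)

Section Hamiltonian.
Context {R : realType} {s : nat}.
Local Notation Ph := ('rV[R]_s * 'cV[R]_s)%type.
Local Notation Z := (Ph * R^o)%type.
Variables (H : Ph -> R^o) (O : set Ph).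
Hypotheses (oO : open O) (HC : Coo_on O H).

Definition Hp (z : Ph) : 'rV[R]_s := \row_i 'D_(0, delta_mx i 0) H z.
Definition Hq (z : Ph) : 'cV[R]_s := \col_i 'D_(delta_mx 0 i, 0) H z.

Lemma diff_H (z : Ph) v w : O z -> 'd H z (v, w) = dot v (Hq z) + dot (Hp z) w.
Proof.
move=> Oz; have dH : differentiable H z by exact: (HC 1%N).1.
have -> : (v, w) = \sum_i v 0 i *: (delta_mx 0 i, 0) + \sum_i w i 0 *: (0, delta_mx i 0) :> Ph.
  have Hs (I : finType) (F : I -> Ph) : \sum_i F i = (\sum_i (F i).1, \sum_i (F i).2).
    elim/big_rec3: _ => //= i a b c _ ->; by congr (_, _).
  rewrite !Hs /=; congr (_, _).
    rewrite [X in _ + X]big1 => [|i _]; last by rewrite scaler0.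
    by rewrite addr0 -row_sum_delta.
  rewrite [X in X + _]big1 => [|i _]; last by rewrite scaler0.
  rewrite add0r {1}(matrix_sum_delta w); apply: eq_bigr => i _.
  by rewrite big_ord1.
rewrite linearD !linear_sum !dotE; congr (_ + _); apply: eq_bigr => i _.
  by rewrite linearZ /= mxE deriveE.
by rewrite linearZ /= mxE mulrC deriveE.
Qed.

Lemma Hp_C k : Ck_on k O Hp.
Proof.
apply: Ck_on_mx => // i j; apply: Ck_on_eq ((HC k.+1).2 (0, delta_mx j 0)) => // x _.
by rewrite mxE.
Qed.

Lemma Hq_C k : Ck_on k O Hq.
Proof.
apply: Ck_on_mx => // i j; apply: Ck_on_eq ((HC k.+1).2 (delta_mx 0 i, 0)) => // x _.
by rewrite mxE.
Qed.

(* The Hamiltonian vector field together with [S' = p . dH/dp], so that the last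
   component integrates the Liouville form along the trajectories. *)
Definition hfield (y : Z) : Z := ((Hp y.1, - Hq y.1), dot (Hp y.1) y.1.2).

Lemma open_hdomain : open (O `*` [set: R^o]).
Proof. by apply: open_setX => //; exact: openT. Qed.

Lemma hfield_C : Coo_on (O `*` [set: R^o]) hfield.
Proof.
move=> k; have oD := open_hdomain.
have C1 : Ck_on k (O `*` [set: R^o]) (fst : Z -> Ph).
  by apply: Ck_on_id_lin => x; exact: cvg_fst.
have CHp : Ck_on k (O `*` [set: R^o]) (fun y : Z => Hp y.1).
  apply: (@Ck_on_comp _ k Z Ph _ _ (O `*` [set: R^o]) O Hp fst) => //; last exact: Hp_C.
  by move=> x [].
have CHq : Ck_on k (O `*` [set: R^o]) (fun y : Z => Hq y.1).
  apply: (@Ck_on_comp _ k Z Ph _ _ (O `*` [set: R^o]) O Hq fst) => //; last exact: Hq_C.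
  by move=> x [].
apply: Ck_on_pair => //; first apply: Ck_on_pair => //.
  exact: Ck_onN.
apply: Ck_on_dot => //.
by apply: (@Ck_on_lin _ k Z Ph _ _ _ snd) => // x; exact: cvg_snd.
Qed.

Variables (z0 : Ph) (T r : R) (phi : R^o * Z -> Z).
Hypotheses (T0 : 0 < T) (r0 : 0 < r)
  (phiC : Coo_on [set x : R^o * Z | `|x.1| < T /\ `|x.2 - (z0, 0)| < r] phi)
  (phi0 : forall x, `|x - (z0, 0)| < r -> phi (0, x) = x)
  (phi_ode : forall (t : R) x, `|t| < T -> `|x - (z0, 0)| < r ->
    [/\ (O `*` [set: R^o]) (phi (t, x)),
        is_derive t 1 (fun s : R => phi (s, x)) (hfield (phi (t, x))) &
        forall v, is_derive t 1 (fun s : R => 'D_(0, v) phi (s, x))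
          ('d hfield (phi (t, x)) ('D_(0, v) phi (t, x)))]).

Lemma energy (t : R) x : `|t| < T -> `|x - (z0, 0)| < r -> H (phi (t, x)).1 = H x.1.
Proof.
move=> tT xr; rewrite -[in RHS](phi0 xr).
apply: (@constant_derive0 R R^o (fun t => H (phi (t, x)).1) T) => // u uT.
have [[Oz _] D _] := phi_ode uT xr.
have := is_derive_comp_diff (is_derive_fstc D) ((HC 1%N).1 _ Oz).
rewrite /= diff_H //= dotNr.
by rewrite subrr.
Qed.

(** The product rule for p . dH/dp, with the second derivatives of [H] left implicit: the variation
    of [Hp] is read off from the first component of ['d hfield]. *)
Lemma hfield_action y d : O y.1 ->
  ('d hfield y d).2 = dot ('d hfield y d).1.1 y.1.2 + dot (Hp y.1) d.1.2.
Proof.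
move=> Oy.
have df : differentiable hfield y by exact: (hfield_C 1%N).1.
have D := diff_is_derive d df.
have D2 := is_derive_sndc D.
have Did : is_derive y d id d by exact: is_derive_id.
have D3 := is_derive_dot (is_derive_fstc (is_derive_fstc D)) (is_derive_sndc (is_derive_fstc Did)).
exact: is_derive_unique D2 D3.
Qed.

Lemma flow_domain_open : open [set x : R^o * Z | `|x.1| < T /\ `|x.2 - (z0, 0)| < r].
Proof.
apply: (@open_flow_domain _ Z T [set x | `|x - (z0, 0)| < r]).
exact: open_norm_lt.
Qed.

Lemma flow_diff t x : `|t| < T -> `|x - (z0, 0)| < r -> differentiable phi (t, x).
Proof. by move=> tT xr; apply: (phiC 1%N).1. Qed.

Lemma flow_diff_init x w : `|x - (z0, 0)| < r -> 'D_(0, w) phi (0, x) = w.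
Proof.
move=> xr.
have T00 : `|0 : R| < T by rewrite normr0.
have D := is_derive_line (s := 0) (x := (0, x)) (v := (0, w) : R^o * Z)
  (f := phi) (d := 'D_(0, w) phi (0, x)).
have {}D : is_derive (0 : R) 1 (fun t : R => phi ((0, x) + t *: (0, w))) ('D_(0, w) phi (0, x)).
  apply: D; rewrite scale0r addr0; split=> //.
  by apply: diff_derivable; exact: flow_diff.
have D' : is_derive (0 : R) 1 (fun t : R => x + t *: w) w.
  apply: (@is_derive_line R Z Z id); exact: is_derive_id.
suff D'' : is_derive (0 : R) 1 (fun t : R => phi ((0, x) + t *: (0, w))) w.
  exact: is_derive_unique D D''.
apply: near_eq_is_derive D'.
have e0 : 0 < (r - `|x - (z0, 0)|) / (`|w| + 1) by rewrite divr_gt0 ?subr_gt0 // ltr_wpDl.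
near=> t.
have -> : (0, x) + t *: (0, w) = (0, x + t *: w) :> R^o * Z.
  by congr (_, _); rewrite /= scaler0 addr0.
rewrite phi0 //.
have -> : x + t *: w - (z0, 0) = (x - (z0, 0)) + t *: w by lmod R.
rewrite (le_lt_trans (ler_normD _ _)) // -ltrBrDl normrZ.
have : `|t| < (r - `|x - (z0, 0)|) / (`|w| + 1) by near: t; exact: near0_ltR.
rewrite ltr_pdivlMr // mulrDr mulr1.
by have := normr_ge0 t; lra.
Unshelve. all: by end_near. Qed.

(* First variation of the action: with [theta = p dq], the form [dS - theta] is
   transported by the flow up to [t dH]. *)
Lemma flow_action t x w : `|t| < T -> `|x - (z0, 0)| < r ->
  let d := 'D_(0, w) phi (t, x) in
  d.2 = dot d.1.1 (phi (t, x)).1.2 + (w.2 - dot w.1.1 x.1.2) + t * 'd H (x.1) (w.1).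
Proof.
move=> tT xr; cbv zeta.
have oD := flow_domain_open.
pose mu (u : R) : R^o := ('D_(0, w) phi (u, x)).2 -
   dot ('D_(0, w) phi (u, x)).1.1 (phi (u, x)).1.2.
(* In the time derivative of dS - p dq the terms containing the variation of [Hp] cancel, and dH
   evaluated on the transported vector remains. By conservation of energy this number does not
   depend on time, so [mu] is affine. *)
have mud (u : R) : `|u| < T -> is_derive u 1 mu ('d H (x.1) (w.1)).
  move=> uT; have [[Oz _] D1 /(_ w) D2] := phi_ode uT xr.
  have := is_deriveB (is_derive_sndc D2) (is_derive_dot (is_derive_fstc (is_derive_fstc D2))
    (is_derive_sndc (is_derive_fstc D1))).
  set d := 'D_(0, w) phi (u, x).
  rewrite hfield_action // => Dm; apply: (is_derive_eq Dm).
  have dphi := flow_diff uT xr.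
  have Dw : is_derive (u, x) (0, w) phi d by split=> //; exact: diff_derivable.
  have DH := is_derive_comp_diff (is_derive_fstc Dw) ((HC 1%N).1 _ Oz).
  have Dx : is_derive (u, x) (0, w) (fun y : R^o * Z => y.2.1) w.1.
    by have := is_derive_fstc (is_derive_sndc (is_derive_id (u, x) ((0, w) : R^o * Z))).
  have Ox : O x.1.
    have T00 : `|0 : R| < T by rewrite normr0.
    by have [[+ _] _ _] := phi_ode T00 xr; rewrite phi0.
  have DH' := is_derive_comp_diff Dx ((HC 1%N).1 x.1 Ox).
  (* Energy conservation holds on a neighbourhood, so it can be differentiated in the initial point:
     dH on the transported vector equals dH on the initial one. *)
  have HE : \forall y \near ((u, x) : R^o * Z), H (phi y).1 = H y.2.1.
    have : nbhs ((u, x) : R^o * Z) [set y | `|y.1| < T /\ `|y.2 - (z0, 0)| < r].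
      by apply: open_nbhs_nbhs; split.
    by apply: filterS => -[v y] [/= vT yr]; exact: energy.
  have <- := is_derive_unique (near_eq_is_derive HE DH) DH'.
  case: (d) => -[dq dp] dS /=; rewrite diff_H // dotNr.
  by rewrite opprD opprK; ring.
have := affine_derive mud tT.
have T00 : `|0 : R| < T by rewrite normr0.
rewrite /mu flow_diff_init // phi0 // => /eqP.
rewrite subr_eq => /eqP ->.
by rewrite /GRing.scale /=; ring.
Qed.

End Hamiltonian.

(** * The complete integral in coordinates *)

Section LocalHamiltonJacobi.
Context {R : realType} {s : nat}.
Local Notation Ph := ('rV[R]_s * 'cV[R]_s)%type.
Local Notation Z := (Ph * R^o)%type.

Lemma diff_is_derive_eq (E F : normedModType R) (f : E -> F) (x v : E) d :
  differentiable f x -> is_derive x v f d -> 'd f x v = d.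
Proof. by move=> df [_ <-]; rewrite deriveE. Qed.

Lemma Coo_cont_open (E F : normedModType R) (f : E -> F) (D : set E) (V : set F) :
  open D -> Coo_on D f -> open V -> open (D `&` f @^-1` V).
Proof.
move=> oD fC oV; rewrite openE => x [Dx Vx]; apply: filterI; first exact: open_nbhs_nbhs.
by apply: (fC 0%N x Dx); exact: open_nbhs_nbhs.
Qed.

(** [P] and [G] accompany [W] because they carry the diffeomorphism: [(q, l) |-> (q, P (q, l))] and
    [z |-> (z.1, G z)] are mutually inverse. The energy function [e] is kept abstract; in the
    construction it is component [i0] of the parameter. *)
Theorem local_complete_integral (H : Ph -> R^o) (O : set Ph) (q0 : 'rV[R]_s) (p0 : 'cV[R]_s)
    (i0 : 'I_s) : open O -> Coo_on O H -> O (q0, p0) ->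
  'd H (q0, p0) (0, delta_mx i0 0) != 0 ->
  exists (V : set 'rV[R]_s) (L : set 'cV[R]_s) (l0 : 'cV[R]_s) (U : set Ph)
    (W : Ph -> R^o) (P : Ph -> 'cV[R]_s) (G : Ph -> 'cV[R]_s) (e : 'cV[R]_s -> R^o),
  [/\ [/\ open V, V q0, open L, L l0 & P (q0, l0) = p0],
      [/\ open U, U `<=` O,
        forall q l, V q -> L l -> U (q, P (q, l)) /\ G (q, P (q, l)) = l &
        forall z, U z -> [/\ V z.1, L (G z) & P (z.1, G z) = z.2]],
      [/\ Coo_on (V `*` L) W, Coo_on (V `*` L) P & Coo_on U G],
      forall q l u, V q -> L l -> is_derive (q, l) (u, 0) W (dot u (P (q, l))) &
      forall q l, V q -> L l -> H (q, P (q, l)) = e l].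
Proof.
move=> oO HC Oz0 Hi0.
have oD0 := open_hdomain oO.
have [T [r [phi [T0 r0 phiC phi0 phi_ode]]]] :=
  @local_flow R Z _ (hfield H) (O `*` [set: R^o]) ((q0, p0), 0) oD0 (hfield_C oO HC) (conj Oz0 I).
pose z0 : Ph := (q0, p0).
pose D := [set x : R^o * Z | `|x.1| < T /\ `|x.2 - (z0, 0)| < r].
have oD : open D by exact: flow_domain_open.
pose e0 : 'rV[R]_s := delta_mx 0 i0.
(* A point [y] is flowed for the time [tau y] from the point [sg y] of the
   hyperplane through [q0] on which coordinate [i0] is constant, with momentum
   [y.2].  The action starts at [(sg y - q0) . p], whose differential minus
   [p dq] is [(sg y - q0) . dp]. *)
pose tau (y : Ph) : R^o := (y.1 - q0) 0 i0.
pose sg (y : Ph) : 'rV[R]_s := y.1 - tau y *: e0.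
pose st (y : Ph) : Z := ((sg y, y.2), dot (sg y - q0) y.2).
pose ts (y : Ph) : R^o * Z := (tau y, st y).
have C1 k : Ck_on k [set: Ph] (fst : Ph -> 'rV[R]_s).
  by apply: Ck_on_id_lin => x; exact: cvg_fst.
have C2 k : Ck_on k [set: Ph] (snd : Ph -> 'cV[R]_s).
  by apply: Ck_on_id_lin => x; exact: cvg_snd.
have Cst k (F : normedModType R) (c : F) : Ck_on k [set: Ph] (fun=> c) by exact: Ck_on_cst.
have oT : open [set: Ph] by exact: openT.
have Ctau k : Ck_on k [set: Ph] tau.
  by apply: Ck_on_entry => //; apply: Ck_onD => //; apply: Ck_onN.
have Csg k : Ck_on k [set: Ph] sg.
  by apply: Ck_onD => //; apply: Ck_onN => //; apply: Ck_onZ.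
have Cts k : Ck_on k [set: Ph] ts.
  apply: Ck_on_pair => //; apply: Ck_on_pair => //; first exact: Ck_on_pair.
  apply: Ck_on_dot => //; apply: Ck_onD => //; exact: Ck_onN.
have tau0 : tau z0 = 0 by rewrite /tau /= subrr mxE.
have sg0 : sg z0 = q0 by rewrite /sg tau0 scale0r subr0.
have ts0 : ts z0 = (0, (z0, 0)).
  by rewrite /ts /st tau0 sg0 subrr dot0l.
have z0r : `|(z0, 0) - (z0, 0) : Z| < r by rewrite subrr normr0.
have Y0 : D (ts z0) by rewrite ts0; split; rewrite /= ?normr0.
pose Y := [set: Ph] `&` ts @^-1` D.
have oY : open Y by apply: Coo_cont_open => //; exact: Cts.
have Yz0 : Y z0 by split.
pose X := phi \o ts.
have XC k : Ck_on k Y X.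
  apply: (@Ck_on_comp _ k _ _ _ _ Y D phi ts) => //; last first.
    by apply: Ck_on_subset (Cts k).
  by move=> y [].
have XY y : Y y -> `|tau y| < T /\ `|st y - (z0, 0)| < r by case.
have X0 : X z0 = (z0, 0) by rewrite /X /= ts0 phi0.
have phi_O t x : `|t| < T -> `|x - (z0, 0)| < r -> O (phi (t, x)).1.
  by move=> tT xr; case: (phi_ode t x tT xr) => -[].
have Osg y : Y y -> O (sg y, y.2).
  move=> /XY[_ yr]; have T00 : `|0 : R^o| < T by rewrite normr0.
  by have := phi_O 0 (st y) T00 yr; rewrite phi0.
pose en (y : Ph) : R^o := H (sg y, y.2).
have enC k : Ck_on k Y en.
  apply: (@Ck_on_comp _ k _ _ _ _ Y O H (fun y => (sg y, y.2))) => //.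
  by apply: Ck_on_subset (Ck_on_pair oT (Csg k) (C2 k)).
have XH y : Y y -> H (X y).1 = en y.
  by move=> /XY[yT yr]; rewrite /X /= (energy HC phi0 phi_ode).
(* The parameters: the initial momentum with its component [i0], which is
   transverse to the hyperplane, replaced by the energy. *)
pose lam (y : Ph) : 'cV[R]_s := y.2 + (en y - y.2 i0 0) *: delta_mx i0 0.
have lamC k : Ck_on k Y lam.
  have Y2 : Ck_on k Y (snd : Ph -> 'cV[R]_s) by apply: Ck_on_subset (C2 k).
  apply: Ck_onD => //; apply: Ck_onZ => //; last exact: Ck_on_cst.
  apply: Ck_onD => //; apply: Ck_onN => //; exact: Ck_on_entry.
have lam_i0 y : lam y i0 0 = en y.
  by rewrite /lam !mxE !eqxx mulr1 addrC subrK.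
pose dsg (v : Ph) : 'rV[R]_s := v.1 - v.1 0 i0 *: e0.
have Dfst (y v : Ph) : is_derive y v (fst : Ph -> 'rV[R]_s) v.1.
  exact: (is_derive_fstc (is_derive_id y v)).
have Dsnd (y v : Ph) : is_derive y v (snd : Ph -> 'cV[R]_s) v.2.
  exact: (is_derive_sndc (is_derive_id y v)).
have Dtau (y v : Ph) : is_derive y v tau (v.1 0 i0).
  have := is_derive_entry 0 i0 (is_deriveB (Dfst y v) (is_derive_const q0 y v)).
  by move=> HD; apply: (is_derive_eq HD); rewrite subr0.
have Dsg (y v : Ph) : is_derive y v sg (dsg v).
  by apply: is_deriveB => //; exact: is_derive_scalel.
pose dst (y v : Ph) : Z := ((dsg v, v.2), dot (dsg v) y.2 + dot (sg y - q0) v.2).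
have Dst (y v : Ph) : is_derive y v st (dst y v).
  apply: is_derive_pairc; first exact: is_derive_pairc.
  have := is_derive_dot (is_deriveB (Dsg y v) (is_derive_const q0 y v)) (Dsnd y v).
  by rewrite subr0.
have Dts (y v : Ph) : is_derive y v ts (v.1 0 i0, dst y v) by exact: is_derive_pairc.
pose del (y v : Ph) : Z := 'D_(0, dst y v) phi (ts y).
have DX (y v : Ph) : Y y -> is_derive y v X (v.1 0 i0 *: hfield H (X y) + del y v).
  move=> Yy; have [yT yr] := XY y Yy.
  have dphi : differentiable phi (ts y) by exact: (flow_diff phiC yT yr).
  have := is_derive_comp_diff (Dts y v) dphi.
  have -> : (v.1 0 i0, dst y v) = v.1 0 i0 *: (1, 0) + (0, dst y v) :> R^o * Z.
    by congr (_, _); rewrite /= ?scaler0 ?add0r ?addr0 // [RHS]mulr1.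
  rewrite linearD linearZ.
  have [_ D1 _] := phi_ode _ _ yT yr.
  have -> : 'd phi (ts y) (1, 0) = hfield H (X y).
    exact: (diff_is_derive_eq dphi (is_derive_fst D1)).
  by rewrite /del deriveE.
have Den (y v : Ph) : Y y -> is_derive y v en ('d H (sg y, y.2) (dsg v, v.2)).
  move=> Yy; apply: (is_derive_comp_diff (is_derive_pairc (Dsg y v) (Dsnd y v))).
  by apply: (HC 1%N).1; exact: Osg.
pose dE y v : R^o := 'd H (sg y, y.2) (dsg v, v.2).
have Dlam (y v : Ph) : Y y ->
    is_derive y v lam (v.2 + (dE y v - v.2 i0 0) *: delta_mx i0 0).
  move=> Yy; apply: is_deriveD => //.
  apply: is_derive_scalel; apply: is_deriveB; first exact: Den.
  exact: is_derive_entry.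
have sgq y : (sg y - q0) 0 i0 = 0.
  by rewrite /sg /tau /e0 !mxE !eqxx mulr1; ring.
(* The time direction adds [v.1 0 i0] times p . dH/dp to both sides. The rest is [flow_action] for
   the initial data [st y], whose action varies by [dot (sg y - q0) v.2] beyond p dq. *)
have action (y v : Ph) : Y y ->
   (v.1 0 i0 *: hfield H (X y) + del y v).2 =
   dot (v.1 0 i0 *: hfield H (X y) + del y v).1.1 (X y).1.2 + dot (sg y - q0) v.2
   + tau y * dE y v.
  move=> Yy; have [yT yr] := XY y Yy.
  have := flow_action oO HC T0 phiC phi0 phi_ode (dst y v) yT yr.
  rewrite -/(del y v) /= => ->.
  rewrite -[phi (tau y, st y)]/(X y) (dotDl (v.1 0 i0 *: Hp H (X y).1)) dotZl.
  by rewrite -[_ *: dot _ _]/(_ * _) -/(dE y v); ring.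
pose dX (y v : Ph) : Z := v.1 0 i0 *: hfield H (X y) + del y v.
pose dlam (y v : Ph) : 'cV[R]_s := v.2 + (dE y v - v.2 i0 0) *: delta_mx i0 0.
have dlam0 y v : dlam y v = 0 -> dE y v = 0 /\ forall i, i != i0 -> v.2 i 0 = 0.
  move=> l0; split=> [|i ii0].
    have := congr1 (fun A : 'cV[R]_s => A i0 0) l0.
    by rewrite /dlam !mxE !eqxx mulr1 addrC subrK.
  have := congr1 (fun A : 'cV[R]_s => A i 0) l0.
  by rewrite /dlam !mxE (negbTE ii0) mulr0 addr0.
pose G y : Ph := ((X y).1.1, lam y).
pose Psi y : Ph := (X y).1.
have PsiC : Coo_on Y Psi.
  move=> k; apply: (@Ck_on_lin _ k Ph Z Ph Y X fst) => // x; exact: cvg_fst.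
have QC k : Ck_on k Y (fun y => (X y).1.1).
  apply: (@Ck_on_lin _ k Ph Ph _ Y Psi fst) => // x; exact: cvg_fst.
have GC : Coo_on Y G by move=> k; exact: Ck_on_pair.
have SC k : Ck_on k Y (fun y => (X y).2).
  apply: (@Ck_on_lin _ k Ph Z _ Y X snd) => // x; exact: cvg_snd.
have dGE y v : Y y -> 'd G y v = ((dX y v).1.1, dlam y v).
  move=> Yy; apply: diff_is_derive_eq; first exact: (GC 1%N).1.
  apply: is_derive_pairc; last exact: Dlam.
  exact: (is_derive_fstc (is_derive_fstc (DX y v Yy))).
have dPsiE y v : Y y -> 'd Psi y v = (dX y v).1.
  move=> Yy; apply: diff_is_derive_eq; first exact: (PsiC 1%N).1.
  exact: (is_derive_fstc (DX y v Yy)).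
have dX0 v : dX z0 v = v.1 0 i0 *: hfield H (z0, 0) + dst z0 v.
  by rewrite /dX X0 /del ts0 (flow_diff_init T0 phiC phi0).
have hp0 : Hp H z0 0 i0 != 0.
  by rewrite mxE deriveE //; exact: (HC 1%N).1.
(* Component [i0] of [dsg v] is 0, so that component of the equation reads [v.1 0 i0] times dH/dp_i0
   equals 0. Hence the time variation vanishes, and the remaining components give [dsg v = 0]. *)
have v1_0 v : (dX z0 v).1.1 = 0 -> v.1 = 0 /\ dsg v = 0.
  rewrite dX0 /= => Q0.
  have := congr1 (fun A : 'rV[R]_s => A 0 i0) Q0.
  rewrite !mxE /= !eqxx mulr1 subrr addr0 => /eqP.
  rewrite mulf_eq0 => /orP[/eqP v0|]; last first.
    by move: hp0; rewrite mxE => /negbTE ->.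
  move: Q0; rewrite v0 scale0r add0r => Q0; split=> //.
  by move: Q0; rewrite /dsg v0 scale0r subr0.
(* Once [v.1 = 0], the vanishing of [dlam] leaves only [v.2 i0 0]; the energy then varies by this
   number times dH/dp_i0, so it is 0 as well. *)
have injG v : 'd G z0 v = 0 -> v = 0.
  rewrite dGE // => -[/v1_0[v10 dsg0] /dlam0[dE0 v2]].
  case: v v10 dsg0 dE0 v2 => v w /= -> dsg0 dE0 v2; congr (_, _).
  have wE : w = w i0 0 *: delta_mx i0 0.
    apply/matrixP => i j; rewrite !mxE ord1 eqxx andbT.
    by case: eqVneq => [->|/v2 ->]; rewrite ?mulr1 ?mulr0.
  move: dE0; rewrite /dE sg0 dsg0 /= wE.
  have -> : (0, w i0 0 *: delta_mx i0 0) = w i0 0 *: (0, delta_mx i0 0) :> Ph.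
    by congr (_, _); rewrite /= scaler0.
  rewrite linearZ => /eqP; rewrite mulf_eq0 (negbTE Hi0) orbF => /eqP ->.
  by rewrite scale0r.
have injPsi v : 'd Psi z0 v = 0 -> v = 0.
  rewrite dPsiE // => E1; have [v10 dsg0] := v1_0 v (congr1 fst E1).
  have := congr1 snd E1; rewrite dX0 /= v10 mxE scale0r add0r.
  by case: v {E1 dsg0} v10 => v w /= -> ->.
have [U1 [V1 [g1 [[oU1 U1Y U1z0] oV1 GK1 g1K g1C]]]] := inverse_function oY GC Yz0 injG.
have [U2 [V2 [g2 [[oU2 U2Y U2z0] oV2 PsiK g2K g2C]]]] := inverse_function oY PsiC Yz0 injPsi.
have [V1Gz0 g1Gz0] := GK1 z0 U1z0.
(* On [N1] both inverses are available: [g1] recovers the data from (endpoint, parameters) and lands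
   where [Psi] is invertible. A box [V] times [L] is then fitted into it. *)
pose N1 := V1 `&` g1 @^-1` U2.
have oN1 : open N1 by exact: Coo_cont_open.
have N1G : N1 (G z0) by split; rewrite /= ?g1Gz0.
have [rho rho0 rhoN] := open_ball_sub oN1 N1G.
have Gz0 : G z0 = (q0, lam z0) by rewrite /G X0.
pose V := [set q : 'rV[R]_s | `|q - q0| < rho].
pose L := [set l : 'cV[R]_s | `|l - lam z0| < rho].
have oV : open V by exact: open_norm_lt.
have oL : open L by exact: open_norm_lt.
have oVL : open (V `*` L) by exact: open_setX.
have VLN x : (V `*` L) x -> N1 x.
  by case: x => q l [/= Vq Ll]; apply: rhoN; rewrite Gz0; exact: prod_norm_lt.
have VLG x : (V `*` L) x -> [/\ V1 x, U1 (g1 x), U2 (g1 x) & G (g1 x) = x].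
  by move=> /VLN[V1x U2x]; have [U1x GE] := g1K x V1x.
pose A := U1 `&` G @^-1` (V `*` L).
have GC1 : Coo_on U1 G by move=> k; exact: Ck_on_subset (GC k).
have oA : open A by exact: Coo_cont_open.
pose P x := (Psi (g1 x)).2.
have PsiE x : (V `*` L) x -> Psi (g1 x) = (x.1, P x).
  move=> /VLG[_ _ _ GE]; have <- : (G (g1 x)).1 = x.1 by rewrite GE.
  exact: surjective_pairing.
have g1CVL k : Ck_on k (V `*` L) g1.
  by apply: Ck_on_subset (g1C k) => x /VLG[].
have g1Y x : (V `*` L) x -> Y (g1 x) by move=> /VLG[_ U1x _ _]; exact: U1Y.
exists V, L, (lam z0), (V2 `&` g2 @^-1` A), (fun x => (X (g1 x)).2), P,
  (fun z => lam (g2 z)), (fun l => l i0 0); split.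
- split=> //; rewrite /V /L /= ?subrr ?normr0 //.
  by rewrite /P -Gz0 g1Gz0 /Psi X0.
- split.
  + exact: Coo_cont_open.
  + move=> z [V2z [U1z _]]; have [_ <-] := g2K z V2z.
    by have [yT yr] := XY _ (U1Y _ U1z); exact: phi_O.
  + move=> q l Vq Ll; have VL : (V `*` L) (q, l) by [].
    have [_ U1x U2x GE] := VLG _ VL.
    have [V2p pE] := PsiK _ U2x.
    move: V2p pE; rewrite (PsiE _ VL) /= => V2p pE.
    split; last by rewrite pE; have := congr1 snd GE.
    split; first exact: V2p.
    by rewrite pE; split; first exact: U1x; rewrite /preimage /mkset GE.
  + move=> z [V2z [/= U1z [/= V1' L1]]]; have [_ zE] := g2K z V2z.
    have zE1 : (G (g2 z)).1 = z.1 by rewrite -[in RHS]zE.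
    split=> //; first by rewrite -zE1.
    rewrite -zE1 -[(_, lam _)]/(G (g2 z)) /P.
    by have [_ ->] := GK1 _ U1z; rewrite zE.
- split.
  + move=> k; exact: (@Ck_on_comp _ k Ph Ph _ _ _ Y (fun y => (X y).2) g1).
  + move=> k.
    apply: (@Ck_on_comp _ k Ph Ph _ _ _ Y (fun y => (Psi y).2) g1) => //.
    apply: (@Ck_on_lin _ k Ph Ph _ Y Psi snd) => // x; exact: cvg_snd.
  + move=> k; apply: (@Ck_on_comp _ k Ph Ph _ _ _ Y lam g2) => //.
    * exact: Coo_cont_open.
    * by move=> z [_ [U1z _]]; exact: U1Y.
    * by apply: Ck_on_subset (g2C k) => z [].
- move=> q l u Vq Ll; have VL : (V `*` L) (q, l) by [].
  have [_ U1x U2x GE] := VLG _ VL; have Yx := g1Y _ VL.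
  have dg1 : differentiable g1 (q, l) by exact: (g1CVL 1%N).1.
  pose v := 'd g1 (q, l) (u, 0).
  have Dg1 : is_derive (q, l) (u, 0) g1 v by exact: diff_is_derive.
  have DXg : is_derive (q, l) (u, 0) (X \o g1) (dX (g1 (q, l)) v).
    have := is_derive_comp_diff Dg1 ((XC 1%N).1 _ Yx).
    by rewrite (diff_is_derive_eq ((XC 1%N).1 _ Yx) (DX _ v Yx)).
  have DGg : is_derive (q, l) (u, 0) (G \o g1) ('d G (g1 (q, l)) v).
    exact: (is_derive_comp_diff Dg1 ((GC 1%N).1 _ Yx)).
  have Did : is_derive (q, l) (u, 0) (id : Ph -> Ph) (u, 0) by exact: is_derive_id.
  have GgE : \forall x \near ((q, l) : Ph), (G \o g1) x = id x.
    have : nbhs ((q, l) : Ph) (V `*` L) by exact: open_nbhs_nbhs.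
    by apply: filterS => x /VLG[].
  have := is_derive_unique (near_eq_is_derive GgE DGg) Did.
  (* Differentiating [G \o g1 = id] along [(u, 0)] keeps the parameters fixed: the endpoint moves by
     [u], the energy does not vary, and neither do the momentum components other than [i0]. *)
  rewrite dGE // => -[Q1 /dlam0[dE0 v2]].
  have E2 : (dX (g1 (q, l)) v).2 = dot u (X (g1 (q, l))).1.2 +
      dot (sg (g1 (q, l)) - q0) v.2 + tau (g1 (q, l)) * dE (g1 (q, l)) v.
    by rewrite -[in RHS]Q1; exact: action.
  have := is_derive_sndc DXg; rewrite E2 dE0 mulr0 addr0.
  (* In component [i0] the first factor vanishes by the choice of the hyperplane, in all others the
     second does because the parameters are fixed. *)
  have -> : dot (sg (g1 (q, l)) - q0) v.2 = 0.
    rewrite dotE big1 // => i _; have [->|/v2 ->] := eqVneq i i0.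
      by rewrite sgq mul0r.
    by rewrite mulr0.
  by rewrite addr0.
- move=> q l Vq Ll; have VL : (V `*` L) (q, l) by [].
  have Yx := g1Y _ VL; have [_ _ _ GE] := VLG _ VL.
  rewrite -[(q, P _)](PsiE _ VL) XH // -lam_i0.
  by have := congr1 snd GE => /= ->.
Qed.

End LocalHamiltonJacobi.

(** * Charts and manifolds *)

Section SmoothAtlas.
Context {R : realType}.
Implicit Types E F G : normedModType R.

Lemma atlas_openE E (M : charted_space E) (A : set M) : open A = atlas_open A.
Proof. by []. Qed.

(** Isolates the chart conditions of [smooth_manifold], which products and cotangent bundles inherit
    from their factors and base. *)
Definition smooth_atlas E (M : charted_space E) : Prop :=
  (forall c : chart M E, atlas c -> is_chart c) /\
  (forall c d : chart M E, atlas c -> atlas d -> compatible c d).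

Lemma atlas_open_chart E (M : charted_space E) (c : chart M E) (B : set E) :
  smooth_atlas M -> atlas c -> open B -> open (chart_dom c `&` chart_map c @^-1` B).
Proof.
move=> [_ cp] ac oB; rewrite atlas_openE => d ad.
have [oD tC] := cp d c ad ac.
have -> : chart_cod d `&` chart_inv d @^-1` (chart_dom c `&` chart_map c @^-1` B) =
    (chart_cod d `&` chart_inv d @^-1` chart_dom c) `&` (chart_map c \o chart_inv d) @^-1` B.
  by apply/seteqP; split=> y; [move=> [? [? ?]]|move=> [[? ?] ?]]; split.
exact: Coo_cont_open.
Qed.

(** One pair of charts covering [A] and its image decides smoothness: in any other pair the
    representative is this one composed with transition maps on both sides, on the corresponding
    preimage. *)
Lemma smooth_on_chart E F {hE : findim E} {hF : findim F} (M : charted_space E)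
    (N : charted_space F) (A : set M) (f : M -> N) (c : chart M E) (d : chart N F) :
  smooth_atlas M -> smooth_atlas N -> atlas c -> atlas d ->
  A `<=` chart_dom c -> (forall x, A x -> chart_dom d (f x)) ->
  open (chart_cod c `&` chart_inv c @^-1` A) ->
  Coo_on (chart_cod c `&` chart_inv c @^-1` A) (chart_map d \o f \o chart_inv c) ->
  smooth_on A f.
Proof.
move=> [chM cpM] [chN cpN] ac ad Ac fAd oA0 fC c' d' ac' ad'; cbv zeta.
set A0 := _ `&` _ in oA0 fC; set D := _ `&` _.
have [oD1 tC] := cpM c' c ac' ac; have [oD2 sC] := cpN d d' ad ad'.
set D1 := _ `&` _ in oD1 tC; set D2 := _ `&` _ in oD2 sC.
have [cm ci cK cK'] := chM c ac; have [dm di dK dK'] := chN d ad.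
set t := chart_map c \o chart_inv c' in tC.
set u := chart_map d \o f \o chart_inv c in fC.
set v := chart_map d' \o chart_inv d in sC.
have oB : open (A0 `&` u @^-1` D2) by exact: Coo_cont_open.
have DE : D = D1 `&` t @^-1` (A0 `&` u @^-1` D2).
  apply/seteqP; split=> y.
    move=> [c'y [Ax d'x]]; have cx := Ac _ Ax; have dx := fAd _ Ax.
    rewrite /t /u; split; first by []; split; first split=> /=.
    - exact: cm.
    - by rewrite cK.
    - by split=> /=; rewrite cK //; [exact: dm|rewrite dK].
  move=> [[c'y cx] [[ctx Ax] [dx d'x]]]; split=> //.
  move: Ax d'x; rewrite /t /u /= cK // => Ax d'x; split=> //.
  by move: d'x; rewrite dK //; exact: fAd.
have oD : open D by rewrite DE; exact: Coo_cont_open.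
split=> // k.
have C : Ck_on k D (v \o (u \o t)).
  apply: (@Ck_on_comp R k E F F hF D D2) => //; first by rewrite DE => y [_ []].
  apply: (@Ck_on_comp R k E E F hE D A0) => //; first by rewrite DE => y [_ []].
  by apply: Ck_on_subset (tC k) => y; rewrite DE => -[].
apply: Ck_on_eq C => // y [c'y [Ax d'x]].
by rewrite /v /u /t /= cK ?dK //; [exact: fAd|exact: Ac].
Qed.

Lemma smooth_atlas_prod E F {hE : findim E} {hF : findim F} (M : charted_space E)
    (N : charted_space F) :
  smooth_atlas M -> smooth_atlas N -> smooth_atlas (prod_manifold M N).
Proof.
move=> [chM cpM] [chN cpN]; split.
  move=> _ [c [d [ac ad ->]]].
  have [cm ci cK cK'] := chM c ac; have [dm di dK dK'] := chN d ad.
  split.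
  - by move=> [x y] [/= ? ?]; split; [exact: cm|exact: dm].
  - by move=> [x y] [/= ? ?]; split; [exact: ci|exact: di].
  - by move=> [x y] [/= ? ?]; rewrite /= cK // dK.
  - by move=> [x y] [/= ? ?]; rewrite /= cK' // dK'.
move=> _ _ [c [d [ac ad ->]]] [c' [d' [ac' ad' ->]]].
have [oD1 tC] := cpM c c' ac ac'; have [oD2 sC] := cpN d d' ad ad'.
rewrite /compatible.
have -> : chart_cod (prod_chart c d) `&` chart_inv (prod_chart c d) @^-1`
    chart_dom (prod_chart c' d') =
  (chart_cod c `&` chart_inv c @^-1` chart_dom c') `*`
  (chart_cod d `&` chart_inv d @^-1` chart_dom d').
  by apply/seteqP; split=> -[x y] [] [/= ? ?] [/= ? ?].
set D1 := _ `&` _ in oD1 tC *; set D2 := _ `&` _ in oD2 sC *.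
have oD : open (D1 `*` D2) by exact: open_setX.
split=> // k; apply: Ck_on_pair => //.
  apply: (@Ck_on_comp R k (E * F)%type E E hE (D1 `*` D2) D1 (chart_map c' \o chart_inv c) fst) => //.
    by move=> x [].
  by apply: Ck_on_id_lin => x; exact: cvg_fst.
apply: (@Ck_on_comp R k (E * F)%type F F hF (D1 `*` D2) D2 (chart_map d' \o chart_inv d) snd) => //.
  by move=> x [].
by apply: Ck_on_id_lin => x; exact: cvg_snd.
Qed.

Lemma smooth_atlas_model E : smooth_atlas (model_space E).
Proof.
split=> [_ ->|_ _ -> ->]; first by split.
split; first by rewrite /= preimage_setT setTI; exact: openT.
move=> k; apply: (@Ck_on_id_lin R k E E _ idfun) => x; exact: cvg_id.
Qed.

End SmoothAtlas.

(** * An open set of row vectors as a parameter manifold *)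

Section OpenSubset.
Context {R : realType} {s : nat} (L : set 'rV[R]_s) (l0 : 'rV[R]_s).
Hypotheses (oL : open L) (Ll0 : L l0).

Definition open_point : Type := {x : 'rV[R]_s | L x}.

(** The inverse of a chart is a total function, so points outside [L] need some value; [l0] provides
    it. *)
Definition open_point_of (x : 'rV[R]_s) : open_point :=
  if pselect (L x) is left Lx then exist _ x Lx else exist _ l0 Ll0.

Definition open_point_val (x : open_point) : 'rV[R]_s := proj1_sig x.

Lemma open_point_ofK x : L x -> open_point_val (open_point_of x) = x.
Proof. by rewrite /open_point_of; case: pselect. Qed.

Lemma open_point_valP (x : open_point) : L (open_point_val x).
Proof. by case: x. Qed.

Lemma open_point_val_inj : injective open_point_val.
Proof. by move=> [x Lx] [y Ly] /= xy; apply: eq_exist. Qed.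

Lemma open_point_valK : cancel open_point_val open_point_of.
Proof.
by move=> x; apply: open_point_val_inj; rewrite open_point_ofK //; exact: open_point_valP.
Qed.

Definition open_chart : chart open_point 'rV[R]_s :=
  @Chart R open_point 'rV[R]_s setT L open_point_val open_point_of oL.

Definition open_submanifold : charted_space 'rV[R]_s :=
  @ChartedSpace R 'rV[R]_s open_point [set open_chart] (fun=> open_chart).

Lemma smooth_atlas_open : smooth_atlas open_submanifold.
Proof.
split=> [_ ->|_ _ -> ->].
  split=> //= x.
  - by move=> _; exact: open_point_valP.
  - by move=> _; exact: open_point_valK.
  - exact: open_point_ofK.
have DE : chart_cod open_chart `&` chart_inv open_chart @^-1` chart_dom open_chart = L.
  by rewrite /= preimage_setT setIT.
rewrite /compatible DE; split=> // k.
have C : Ck_on k L (idfun : 'rV[R]_s -> 'rV[R]_s).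
  by apply: Ck_on_id_lin => x; exact: cvg_id.
by apply: Ck_on_eq C => // x Lx; rewrite /= open_point_ofK.
Qed.

Lemma open_val_preimage (B : set 'rV[R]_s) : open B ->
  open (open_point_val @^-1` B : set open_submanifold).
Proof.
move=> oB; rewrite atlas_openE => _ ->.
have -> : chart_cod open_chart `&` chart_inv open_chart @^-1` (open_point_val @^-1` B) = L `&` B.
  by apply/seteqP; split=> x [/= Lx]; rewrite /preimage /= open_point_ofK.
exact: openI.
Qed.

Lemma open_val_image (A : set open_submanifold) : open A ->
  open [set x | L x /\ A (open_point_of x)].
Proof. by move=> oA; exact: (oA _ (erefl open_chart)). Qed.

Lemma open_hausdorff_space : hausdorff_space open_submanifold.
Proof.
rewrite open_hausdorff => x y xy.
have vxy : open_point_val x != open_point_val y.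
  by apply: contra xy => /eqP /open_point_val_inj ->.
have := @norm_hausdorff R 'rV[R]_s; rewrite open_hausdorff => /(_ _ _ vxy).
move=> [[A B] /= [xA yB] [oA oB AB]].
exists (open_point_val @^-1` A, open_point_val @^-1` B) => /=.
  by move: xA yB; rewrite !inE.
split; [exact: open_val_preimage|exact: open_val_preimage|].
apply/eqP; rewrite -preimage_setI.
by move/eqP: AB => ->; rewrite preimage_set0.
Qed.

Definition rational_ball (qn : 'rV[rat]_s * nat) : set 'rV[R]_s :=
  [set y | `|y - map_mx ratr qn.1| < qn.2.+1%:R^-1].

Lemma rational_ball_sub (x : 'rV[R]_s) (r : R) : 0 < r -> exists qn,
  rational_ball qn x /\ rational_ball qn `<=` [set y | `|y - x| < r].
Proof.
move=> r0.
(* With radius [d < r / 2] and a centre within [d / 2] of [x], the rational ball contains [x] and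
   stays within [3 * d / 2 < r] of it. *)
have [n] := @ltr_add_invr R 0 (r / 2) ltac:(by rewrite divr_gt0).
rewrite add0r => nr; pose d : R := n.+1%:R^-1.
have d0 : 0 < d by rewrite invr_gt0.
have H i : exists q : rat, `|x 0 i - ratr q| < d / 2.
  have [|q] := @rat_in_itvoo R (x 0 i - d / 2) (x 0 i + d / 2); first by lra.
  rewrite in_itv /= => /andP[q1 q2]; exists q.
  by rewrite ltr_norml; apply/andP; split; lra.
have [q Hq] := choice H.
pose c : 'rV[rat]_s := \row_i q i.
have xc : `|x - map_mx ratr c| <= d / 2.
  apply: mx_norm_le; first by rewrite ltW // divr_gt0.
  by move=> i j; rewrite ord1 !mxE ltW.
exists (c, n); split.
  by rewrite /rational_ball /= -/d (le_lt_trans xc) //; lra.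
move=> y; rewrite /rational_ball /= -/d => yc.
rewrite (_ : y - x = (y - map_mx ratr c) - (x - map_mx ratr c)); last by lmod R.
by rewrite (le_lt_trans (ler_normB _ _)) //; rewrite -/d in nr; lra.
Qed.

Lemma rational_ball_open qn : open (rational_ball qn).
Proof.
exact: open_norm_lt.
Qed.

Lemma open_second_countable : @second_countable open_submanifold.
Proof.
exists (range (fun qn => open_point_val @^-1` rational_ball qn : set open_submanifold)).
  by apply: card_le_trans (card_image_le _ _) _; exact: countableP.
split.
  by move=> _ [qn _ <-]; apply: open_val_preimage; exact: rational_ball_open.
move=> x A; rewrite nbhsE => -[B [oB Bx] BA].
have oB' := open_val_image oB.
have B'x : [set y | L y /\ B (open_point_of y)] (open_point_val x).
  by split; [exact: open_point_valP|rewrite open_point_valK].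
have [r r0 rB] := open_ball_sub oB' B'x.
have [qn [qx qr]] := rational_ball_sub (open_point_val x) r0.
exists (open_point_val @^-1` rational_ball qn); first by split=> //; exists qn.
move=> y /qr/rB[_]; rewrite open_point_valK; exact: BA.
Qed.

Lemma smooth_manifold_open : smooth_manifold open_submanifold.
Proof.
have [ch cp] := smooth_atlas_open.
by split=> //; [exact: open_hausdorff_space|exact: open_second_countable].
Qed.

End OpenSubset.

(** * The cotangent bundle *)

Section Jacobians.
Context {R : realType}.

(** Jacobians act on row vectors from the right, hence the order of the product. *)
Lemma jacobian_comp n m p (f : 'rV[R]_n -> 'rV[R]_m) (g : 'rV[R]_m -> 'rV[R]_p) x y :
  f x = y -> differentiable f x -> differentiable g y ->
  jacobian f x *m jacobian g y = jacobian (g \o f) x.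
Proof.
move=> <- df dg; apply/row_matrixP => i.
by rewrite !rowE mulmxA !mul_rV_lin1 (diff_comp df dg).
Qed.

Lemma near_eq_jacobian n m (f g : 'rV[R]_n -> 'rV[R]_m) x : (\near x, f x = g x) ->
  differentiable f x -> jacobian g x = jacobian f x.
Proof.
move=> fg df; have [_ dE] := near_eq_differentiable fg df.
exact: (congr1 (fun h => lin1_mx h) dE).
Qed.

Lemma jacobian_id n (x : 'rV[R]_n) : jacobian idfun x = 1%:M.
Proof.
have dE : 'd idfun x = idfun :> ('rV[R]_n -> 'rV[R]_n).
  by apply: diff_lin => y; exact: cvg_id.
by apply/row_matrixP => i; rewrite !rowE mulmx1 mul_rV_lin1 dE.
Qed.

Lemma mulmxK_comp n m p q (A : 'M[R]_(n, m)) (B : 'M[R]_(m, p)) (C : 'M[R]_(n, p))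
  (D : 'M[R]_(p, q)) : A *m B = C -> A *m (B *m D) = C *m D.
Proof. by rewrite mulmxA => ->. Qed.

Lemma Ck_on_mulmx (E : normedModType R) k (D : set E) m n p (f : E -> 'M[R]_(m, n))
    (g : E -> 'M[R]_(n, p)) : open D -> Ck_on k D f -> Ck_on k D g ->
  Ck_on k D (fun x => f x *m g x).
Proof.
move=> oD Cf Cg; apply: Ck_on_mx => // i j.
have C : Ck_on k D (fun x => \sum_l f x i l * g x l j : R^o).
  apply: (@Ck_on_sum _ k E R^o) => // l.
  by apply: Ck_onM => //; exact: Ck_on_entry.
by apply: Ck_on_eq C => // x _; rewrite mxE.
Qed.

End Jacobians.

(** * Transition maps of the cotangent bundle *)

Section CotangentAtlas.
Context {R : realType} {s : nat} (Q : charted_space 'rV[R]_s).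
Local Notation Ph := ('rV[R]_s * 'cV[R]_s)%type.
Hypothesis saQ : smooth_atlas Q.
Hypothesis atQ : forall q : Q, atlas (chart_at q) /\ chart_dom (chart_at q) q.
Implicit Types (c d e : chart Q 'rV[R]_s) (q : Q).

(** The transition Jacobian from [c] to [d], indexed by the point [q] rather than by its
    coordinates, so that the cocycle rule takes a clean form. Tangent rows change by [tj c d q] on
    the right, momentum columns by [tj d c q] on the left. *)
Definition tj c d q : 'M[R]_s := jacobian (chart_map d \o chart_inv c) (chart_map c q).

Lemma mul_tj c d q (v : 'rV[R]_s) : v *m tj c d q = 'd (chart_map d \o chart_inv c) (chart_map c q) v.
Proof. exact: mul_rV_lin1. Qed.

Lemma chart_domain c d q : atlas c -> chart_dom c q -> chart_dom d q ->
  (chart_cod c `&` chart_inv c @^-1` chart_dom d) (chart_map c q).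
Proof.
move=> ac cq dq; have [cm _ cK _] := saQ.1 c ac.
by split; [exact: cm|rewrite /preimage /= cK].
Qed.

Lemma transition_differentiable c d q : atlas c -> atlas d -> chart_dom c q -> chart_dom d q ->
  differentiable (chart_map d \o chart_inv c) (chart_map c q).
Proof.
move=> ac ad cq dq; have [_ /(_ 1%N)[df _]] := saQ.2 c d ac ad.
exact/df/chart_domain.
Qed.

Lemma tj_comp c d e q : atlas c -> atlas d -> atlas e ->
  chart_dom c q -> chart_dom d q -> chart_dom e q ->
  tj c d q *m tj d e q = tj c e q.
Proof.
move=> ac ad ae cq dq eq.
have [_ _ cK _] := saQ.1 c ac; have [_ _ dK _] := saQ.1 d ad.
have [oD _] := saQ.2 c d ac ad.
have df := transition_differentiable ac ad cq dq.
have dg := transition_differentiable ad ae dq eq.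
have fx : (chart_map d \o chart_inv c) (chart_map c q) = chart_map d q by rewrite /= cK.
apply: etrans (jacobian_comp fx df dg) _.
apply/esym/near_eq_jacobian; last by apply: differentiable_comp; rewrite ?fx.
near=> y; have [_ dy] : (chart_cod c `&` chart_inv c @^-1` chart_dom d) y.
  by near: y; apply: open_nbhs_nbhs; split=> //; exact: chart_domain.
by rewrite /= dK.
Unshelve. all: by end_near. Qed.

Lemma tj_id c q : atlas c -> chart_dom c q -> tj c c q = 1%:M.
Proof.
move=> ac cq; have [cm _ _ cK'] := saQ.1 c ac.
rewrite -(jacobian_id (chart_map c q)).
apply: near_eq_jacobian; last exact: ex_diff.
near=> y; rewrite /= cK' //; near: y; apply: open_nbhs_nbhs.
by split; [exact: open_chart_cod|exact: cm].
Unshelve. all: by end_near. Qed.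

Lemma tj_inv c d q : atlas c -> atlas d -> chart_dom c q -> chart_dom d q ->
  tj c d q *m tj d c q = 1%:M.
Proof. by move=> *; rewrite tj_comp // tj_id. Qed.

Lemma cotangent_mapE c (a : cotangent Q) : chart_map (cotangent_chart c) a =
  (chart_map c (base_point a), tj c (chart_at (base_point a)) (base_point a) *m components a).
Proof. by []. Qed.

Lemma cotangent_invE c y : chart_inv (cotangent_chart c) y =
  Covector (chart_inv c y.1) (tj (chart_at (chart_inv c y.1)) c (chart_inv c y.1) *m y.2).
Proof. by []. Qed.

Lemma cotangent_is_chart c : atlas c -> is_chart (cotangent_chart c).
Proof.
move=> ac; have [cm ci cK cK'] := saQ.1 c ac; split.
- by move=> [q p] /= cq; split=> //; exact: cm.
- by move=> [y p] [/= yc _]; exact: ci.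
- move=> [q p] cq; rewrite cotangent_mapE cotangent_invE /= cK //; congr Covector.
  have [ak kq] := atQ q.
  by rewrite -[RHS]mul1mx; apply: mulmxK_comp; exact: tj_inv.
- move=> y [yc _]; rewrite cotangent_invE cotangent_mapE /= cK' //.
  have [ak kq] := atQ (chart_inv c y.1).
  rewrite [RHS]surjective_pairing; congr (_, _); rewrite -[RHS]mul1mx.
  by apply: mulmxK_comp; apply: tj_inv => //; exact: ci.
Qed.

(** The components of a covector are stored in the preferred chart at its base point; the cocycle
    rule eliminates that chart, which may change from point to point in no regular way. *)
Lemma cotangent_transition c d (y : Ph) : atlas c -> atlas d ->
  (chart_cod c `&` chart_inv c @^-1` chart_dom d) y.1 ->
  chart_map (cotangent_chart d) (chart_inv (cotangent_chart c) y) =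
  (chart_map d (chart_inv c y.1), tj d c (chart_inv c y.1) *m y.2).
Proof.
move=> ac ad [yc dy]; have [_ ci _ cK'] := saQ.1 c ac.
have [ak kq] := atQ (chart_inv c y.1).
rewrite cotangent_invE cotangent_mapE; congr (_, _) => /=.
by apply: mulmxK_comp; apply: tj_comp => //; exact: ci.
Qed.

Lemma smooth_atlas_cotangent : smooth_atlas (cotangent Q).
Proof.
split=> [_ [c ac <-]|_ _ [c ac <-] [d ad <-]]; first exact: cotangent_is_chart.
have [oD tC] := saQ.2 c d ac ad; have [_ sC] := saQ.2 d c ad ac.
have [cm ci cK cK'] := saQ.1 c ac; have [dm di dK dK'] := saQ.1 d ad.
set D := _ `&` _ in oD tC; set D' := _ `&` _ in sC.
have oDT : open (D `*` [set: 'cV[R]_s]) by apply: open_setX => //; exact: openT.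
have DE : chart_cod (cotangent_chart c) `&`
    chart_inv (cotangent_chart c) @^-1` chart_dom (cotangent_chart d) =
  D `*` [set: 'cV[R]_s].
  by apply/seteqP; split=> -[y p] [] [/= ? ?].
rewrite /compatible DE; split=> // k.
have C1 : Ck_on k (D `*` [set: 'cV[R]_s]) (fst : Ph -> 'rV[R]_s).
  by apply: Ck_on_id_lin => x; exact: cvg_fst.
have C2 : Ck_on k (D `*` [set: 'cV[R]_s]) (snd : Ph -> 'cV[R]_s).
  by apply: Ck_on_id_lin => x; exact: cvg_snd.
(* The entries are derivatives of the opposite transition, from [d] to [c], evaluated along the
   transition from [c] to [d]. *)
have CJ : Ck_on k D (fun y => tj d c (chart_inv c y)).
  apply: Ck_on_mx => // i j.
  have C : Ck_on k D (fun y =>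
      ('D_(delta_mx 0 i) (chart_map c \o chart_inv d) (chart_map d (chart_inv c y))) 0 j : R^o).
    apply: Ck_on_entry => //.
    apply: (@Ck_on_comp R k _ _ _ _ D D' ('D_(delta_mx 0 i) (chart_map c \o chart_inv d))
      (chart_map d \o chart_inv c)) => //.
    + move=> y [yc dy]; apply: chart_domain => //; exact: ci.
    + exact: (sC k.+1).2.
  apply: Ck_on_eq C => // y [yc dy].
  rewrite deriveEjacobian; last by apply: transition_differentiable => //; exact: ci.
  by rewrite -/(tj _ _ _) -rowE mxE.
have C : Ck_on k (D `*` [set: 'cV[R]_s])
    (fun y => (chart_map d (chart_inv c y.1), tj d c (chart_inv c y.1) *m y.2)).
  apply: Ck_on_pair => //.
    by apply: (@Ck_on_comp R k _ _ _ _ _ D (chart_map d \o chart_inv c) fst) => // -[y p] [].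
  apply: Ck_on_mulmx => //.
  by apply: (@Ck_on_comp R k _ _ _ _ _ D (fun y => tj d c (chart_inv c y)) fst) => // -[y p] [].
by apply: Ck_on_eq C => // y [Dy _]; rewrite /= -cotangent_transition.
Qed.

End CotangentAtlas.

(** * Canonical forms, Hamiltonian fields and exact sections in coordinates *)

Section CotangentForms.
Context {R : realType} {s : nat} (Q : charted_space 'rV[R]_s).
Local Notation Ph := ('rV[R]_s * 'cV[R]_s)%type.
Hypothesis saQ : smooth_atlas Q.
Hypothesis atQ : forall q : Q, atlas (chart_at q) /\ chart_dom (chart_at q) q.
Implicit Types (c : chart Q 'rV[R]_s) (q : Q) (a : cotangent Q).

Lemma tangent_projE a (v : Ph) :
  tangent_map (@cotangent_proj R s Q) (v : tangent_space a) = v.1.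
Proof.
have [ak kq] := atQ (base_point a); set k := chart_at (base_point a) in ak kq.
have [km _ _ kK'] := saQ.1 k ak.
have cfst : continuous (fst : Ph -> 'rV[R]_s) by move=> y; exact: cvg_fst.
have [||_ dE] := near_eq_differentiable (f := (fst : Ph -> 'rV[R]_s))
  (g := chart_map k \o @cotangent_proj R s Q \o chart_inv (cotangent_chart k))
  (x := chart_map (cotangent_chart k) a).
- near=> y; rewrite /= kK' //.
  suff [] : (chart_cod k `*` [set: 'cV[R]_s]) y by [].
  near: y; apply: open_nbhs_nbhs; split; first exact: (open_chart_cod (cotangent_chart k)).
  by split=> //; exact: km.
- exact: linear_differentiable.
- apply: etrans (congr1 (fun h => h v) dE) _.
  by rewrite diff_lin.
Unshelve. all: by end_near. Qed.

(** The form is p dq in every chart: the tangent row and the stored momentum column change by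
    mutually inverse matrices, which cancel in the pairing. *)
Lemma tautological_form_in_chart c (v y : Ph) : atlas c -> chart_cod c y.1 ->
  form_in_chart (@tautological_form R s Q) (cotangent_chart c) v y = dot v.1 y.2.
Proof.
move=> ac yc; have [_ ci _ cK'] := saQ.1 c ac.
set q := chart_inv c y.1; have [ak kq] := atQ q; set k := chart_at q in ak kq.
have cq : chart_dom c q by exact: ci.
have yE : y.1 = chart_map c q by rewrite cK'.
rewrite /form_in_chart /tautological_form /pairing tangent_projE.
have df : differentiable (chart_map k \o chart_inv c) y.1.
  by rewrite yE; exact: transition_differentiable.
have cfst : continuous (fst : Ph -> 'rV[R]_s) by move=> z; exact: cvg_fst.
have dg : differentiable (chart_map (cotangent_chart k) \o chart_inv (cotangent_chart c)) y.
  have [_ /(_ 1%N)[D _]] := (smooth_atlas_cotangent saQ atQ).2 _ _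
    (imageP _ ac) (imageP (@cotangent_chart R s Q) ak).
  by apply: D; split; first split.
have D1 := is_derive_fstc (diff_is_derive v dg).
have D2 := is_derive_comp_diff
  (is_derive_lin (l := (fst : Ph -> 'rV[R]_s)) cfst (is_derive_id y v)) df.
have -> := is_derive_unique D1 D2.
rewrite cotangent_invE -/q -/k /= yE -mul_tj -mulmxA /dot.
by rewrite (mulmxK_comp _ (tj_inv saQ ac ak cq kq)) mul1mx.
Qed.

(** Differentiating p dq with constant coefficients dq sees only the momentum part of the
    direction. *)
Lemma canonical_formE a (u v : Ph) :
  canonical_form (u : tangent_space a) (v : tangent_space a) = dot u.1 v.2 - dot v.1 u.2.
Proof.
have [ak kq] := atQ (base_point a); set k := chart_at (base_point a) in ak kq.
have [km _ _ _] := saQ.1 k ak.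
have D (w w' : Ph) : 'D_w (form_in_chart (@tautological_form R s Q) (cotangent_chart k) w')
    (chart_map (cotangent_chart k) a) = dot w'.1 w.2.
  set z := chart_map _ _.
  have csnd : continuous (snd : Ph -> 'cV[R]_s) by move=> y; exact: cvg_snd.
  have H : is_derive z w (fun y : Ph => dot w'.1 y.2) (dot w'.1 w.2).
    have := is_derive_dot (is_derive_const w'.1 z w)
      (is_derive_lin (l := (snd : Ph -> 'cV[R]_s)) csnd (is_derive_id z w)).
    by rewrite dot0l add0r.
  case: H => _ <-; apply: near_eq_derive; near=> y; rewrite tautological_form_in_chart //.
  suff [] : (chart_cod k `*` [set: 'cV[R]_s]) y by [].
  near: y; apply: open_nbhs_nbhs; split; first exact: (open_chart_cod (cotangent_chart k)).
  by split=> //; exact: km.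
by rewrite /canonical_form /exterior_derivative opprB !D.
Unshelve. all: by end_near. Qed.

Lemma hamiltonian_field_transverse (H : cotangent Q -> R) a :
  ~ ker_tangent_proj (hamiltonian_field H a) ->
  exists i, 'd (H \o chart_inv (cotangent_chart (chart_at (base_point a))) : Ph -> R^o)
    (chart_map (cotangent_chart (chart_at (base_point a))) a) (0, delta_mx i 0) != 0.
Proof.
rewrite /ker_tangent_proj /hamiltonian_field /=.
(* The default value 0 of [xget] lies in the kernel of the projection, so the hypothesis guarantees
   that the defining equation of the field has a solution and that [X] satisfies it. *)
case: xgetP => [X _ XE|_]; last by rewrite tangent_projE.
rewrite tangent_projE => X1.
have [i Xi] : exists i, X.1 0 i != 0.
  apply: contrapT => /forallNP X0; apply: X1; apply/rowP => i.
  by rewrite mxE; apply/eqP; apply: contrapT => /negP; exact: X0.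
exists i; suff <- : X.1 0 i = 'd (H \o chart_inv (cotangent_chart (chart_at (base_point a))) : Ph -> R^o)
    (chart_map (cotangent_chart (chart_at (base_point a))) a) (0, delta_mx i 0) by [].
(* Testing the defining equation on a vertical basis vector gives dq_i(X) = dH/dp_i. *)
apply: etrans _ (XE (0, delta_mx i 0)).
by rewrite canonical_formE dot0l subr0 /dot -colE mxE.
Qed.

(** The differential is stored in the preferred chart at [q]; the chain rule through the transition
    to [c] produces the same Jacobian as the inverse of the cotangent chart. *)
Lemma diff_sectionE c q (w : 'rV[R]_s -> R^o) (p : 'cV[R]_s) : atlas c -> chart_dom c q ->
  differentiable w (chart_map c q) -> (forall u, 'd w (chart_map c q) u = dot u p) ->
  diff_section (w \o chart_map c) q = chart_inv (cotangent_chart c) (chart_map c q, p).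
Proof.
move=> ac cq dw wE; have [_ _ cK _] := saQ.1 c ac.
have [ak kq] := atQ q; rewrite cotangent_invE /= cK //; congr Covector.
have [_ _ kK _] := saQ.1 _ ak.
set k := chart_at q in ak kq kK *.
have dt := transition_differentiable saQ ak ac kq cq.
have tq : (chart_map c \o chart_inv k) (chart_map k q) = chart_map c q by rewrite /= kK.
have dw' : differentiable w ((chart_map c \o chart_inv k) (chart_map k q)) by rewrite tq.
apply/colP => i; rewrite mxE.
have D := is_derive_comp_diff (diff_is_derive (delta_mx 0 i) dt) dw'.
have D' := diff_is_derive (delta_mx 0 i) (differentiable_comp dt dw').
apply: etrans (is_derive_unique D' D) _.
by rewrite tq wE -mul_tj /dot -mulmxA -rowE mxE.
Qed.

End CotangentForms.

(** * The complete family *)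

Section CompleteFamily.
Context {R : realType} {s : nat} (Q : charted_space 'rV[R]_s).
Local Notation Ph := ('rV[R]_s * 'cV[R]_s)%type.
Hypothesis saQ : smooth_atlas Q.
Hypothesis atQ : forall q : Q, atlas (chart_at q) /\ chart_dom (chart_at q) q.

Variables (H : cotangent Q -> R) (c : chart Q 'rV[R]_s).
Hypothesis ac : atlas c.
Variables (V : set 'rV[R]_s) (L : set 'cV[R]_s) (l0 : 'cV[R]_s) (U : set Ph)
  (W : Ph -> R^o) (P : Ph -> 'cV[R]_s) (G : Ph -> 'cV[R]_s) (e : 'cV[R]_s -> R^o).
Hypotheses (oV : open V) (oL : open L) (Ll0 : L l0) (oU : open U)
  (UO : U `<=` chart_cod c `*` setT)
  (PU : forall q l, V q -> L l -> U (q, P (q, l)) /\ G (q, P (q, l)) = l)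
  (UP : forall z, U z -> [/\ V z.1, L (G z) & P (z.1, G z) = z.2])
  (WC : Coo_on (V `*` L) W) (PC : Coo_on (V `*` L) P) (GC : Coo_on U G)
  (dW : forall q l u, V q -> L l -> is_derive (q, l) (u, 0) W (dot u (P (q, l))))
  (He : forall q l, V q -> L l -> H (chart_inv (cotangent_chart c) (q, P (q, l))) = e l).

(* Parameter manifolds are modelled on row vectors, momenta are columns. *)
Definition row_set : set 'rV[R]_s := [set x | L x^T].

Lemma open_row_set : open row_set.
Proof.
apply: (@open_comp _ _ (trmx : 'rV[R]_s -> 'cV[R]_s) L) => // x _.
exact: (@findim_linear_continuous R _ _ _ (trmx : 'rV[R]_s -> 'cV[R]_s)).
Qed.

Lemma row_set0 : row_set l0^T.
Proof. by rewrite /row_set /= trmxK. Qed.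

Local Notation LM := (open_submanifold open_row_set row_set0).

Definition family_pullback (l : LM) (q : Q) : R :=
  W (chart_map c q, (open_point_val l)^T).

Definition family_image : set (cotangent Q) :=
  chart_dom (cotangent_chart c) `&` chart_map (cotangent_chart c) @^-1` U.

Local Notation f := (fun x : Q * LM => diff_section (family_pullback x.2) x.1).
Local Notation C := (cotangent_chart c).

Let aC : @atlas R _ (cotangent Q) C.
Proof. exact: imageP. Qed.

Let saC := smooth_atlas_cotangent saQ atQ.

Lemma family_image_open : open family_image.
Proof. exact: atlas_open_chart. Qed.

Lemma family_proj : @cotangent_proj R s Q @` family_image = chart_dom c `&` chart_map c @^-1` V.
Proof.
have [cm _ cK _] := saQ.1 c ac; have [_ _ _ CK'] := saC.1 C aC.
apply/seteqP; split=> [_ [a [ca /UP[Va _ _]] <-]|q [cq Vq]]; first by split.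
(* A parameter is needed to lift [q] to the cotangent bundle; [l0] shows that the projection covers
   all of [V]. *)
exists (chart_inv C (chart_map c q, P (chart_map c q, l0))); last exact: cK.
split; first by rewrite /= cK.
by rewrite /preimage /mkset CK';
  [case: (PU Vq Ll0)|split=> //; exact: cm].
Qed.

Lemma family_slice k l : L l -> Ck_on k V (fun y : 'rV[R]_s => W (y, l)).
Proof.
move=> Ll; apply: (@Ck_on_comp R k _ _ _ _ V (V `*` L) W (fun y => (y, l))) => //.
apply: Ck_on_pair => //; last exact: Ck_on_cst.
by apply: (@Ck_on_id_lin R k _ _ V idfun) => x; exact: cvg_id.
Qed.

Lemma family_section (l : LM) q : chart_dom c q -> V (chart_map c q) ->
  diff_section (family_pullback l) q =
  chart_inv C (chart_map c q, P (chart_map c q, (open_point_val l)^T)).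
Proof.
move=> cq Vq; have Ll := open_point_valP l.
have dw : differentiable (fun y => W (y, (open_point_val l)^T)) (chart_map c q).
  by apply: (family_slice 1 Ll).1.
apply: (diff_sectionE saQ atQ ac cq dw) => u; apply: diff_is_derive_eq => //.
have /is_derive_lineP D := dW u Vq Ll; apply/is_derive_lineP.
have -> // : (fun t : R => W (chart_map c q + t *: u, (open_point_val l)^T)) =
  (fun t : R => W ((chart_map c q, (open_point_val l)^T) + t *: (u, 0))).
by apply/funext => t; congr (W (_, _)); rewrite /= scaler0 addr0.
Qed.

Lemma family_section_chart (l : LM) q : chart_dom c q -> V (chart_map c q) ->
  chart_map C (diff_section (family_pullback l) q) =
  (chart_map c q, P (chart_map c q, (open_point_val l)^T)).
Proof.
move=> cq Vq; have [_ _ _ CK'] := saC.1 C aC; have [cm _ _ _] := saQ.1 c ac.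
by rewrite family_section // CK' //; split=> //; exact: cm.
Qed.

Lemma family_section_image (l : LM) q : chart_dom c q -> V (chart_map c q) ->
  family_image (diff_section (family_pullback l) q).
Proof.
move=> cq Vq; split=> //.
rewrite /preimage /mkset family_section_chart //.
by have [] := PU Vq (open_point_valP l).
Qed.

Lemma family_constant (l : LM) q : chart_dom c q -> V (chart_map c q) ->
  H (diff_section (family_pullback l) q) = e (open_point_val l)^T.
Proof. by move=> cq Vq; rewrite family_section // He //; exact: (open_point_valP l). Qed.

(** On [family_image] the column passed to [open_point_of] lies in [L] after transposition;
    elsewhere the fallback value may occur and is immaterial. *)
Definition family_inv (a : cotangent Q) : prod_manifold Q LM :=
  (base_point a, open_point_of row_set0 (G (chart_map C a))^T).

Lemma family_invK (x : Q * LM) : chart_dom c x.1 -> V (chart_map c x.1) ->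
  family_inv (f x) = x.
Proof.
case: x => q l /= cq Vq; rewrite /family_inv family_section_chart //=; congr (_, _).
have [_ ->] := PU Vq (open_point_valP l).
by rewrite trmxK open_point_valK.
Qed.

Lemma family_inv_image a : family_image a ->
  (chart_dom c `&` chart_map c @^-1` V) (family_inv a).1 /\ f (family_inv a) = a.
Proof.
move=> [ca Ua]; have [Va LG PE] := UP Ua; have [_ _ CK _] := saC.1 C aC.
split; first by split.
have LG' : row_set (G (chart_map C a))^T by rewrite /row_set /= trmxK.
apply: etrans (family_section _ ca Va) _; rewrite -[RHS](CK a ca) open_point_ofK // trmxK.
congr (chart_inv C _).
by rewrite [RHS]surjective_pairing -PE.
Qed.

Lemma family_smooth_function (l : LM) :
  smooth_on (N := real_line) (chart_dom c `&` chart_map c @^-1` V) (family_pullback l).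
Proof.
have [_ ci _ cK'] := saQ.1 c ac.
have DE : chart_cod c `&` chart_inv c @^-1` (chart_dom c `&` chart_map c @^-1` V) =
    chart_cod c `&` V.
  apply/seteqP; split=> y [yc]; rewrite /preimage /= cK' //; first by case.
  by move=> Vy; split=> //; split=> //; exact: ci.
have oD : open (chart_cod c `&` V) by apply: openI => //; exact: open_chart_cod.
apply: (@smooth_on_chart R _ _ _ _ Q real_line _ (family_pullback l) c
  (model_chart (R^o : normedModType R))) => //.
- exact: smooth_atlas_model.
- by rewrite DE.
- rewrite DE => k.
  have Cw : Ck_on k (chart_cod c `&` V) (fun y => W (y, (open_point_val l)^T)).
    apply: Ck_on_subset (family_slice k (open_point_valP l)); by move=> y [].
  by apply: Ck_on_eq Cw => // y [yc _]; rewrite /= /family_pullback cK'.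
Qed.

Lemma family_diffeomorphism :
  diffeomorphism (M := prod_manifold Q LM) (N := cotangent Q)
    ((chart_dom c `&` chart_map c @^-1` V) `*` [set: LM]) family_image f.
Proof.
have [_ ci _ cK'] := saQ.1 c ac; have [Cm Ci CK CK'] := saC.1 C aC.
have saL : smooth_atlas LM by exact: smooth_atlas_open.
have saP := smooth_atlas_prod saQ saL.
pose d : chart (prod_manifold Q LM) _ := prod_chart c (open_chart open_row_set row_set0).
have ad : @atlas R _ (prod_manifold Q LM) d by exists c, (open_chart open_row_set row_set0).
have Ctr k (E : normedModType R) (D : set E) (g : E -> 'rV[R]_s) : open D -> Ck_on k D g ->
    Ck_on k D (fun y => (g y)^T).
  move=> oD; apply: (@Ck_on_lin R k E _ _ D g (trmx : 'rV[R]_s -> 'cV[R]_s)) => //.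
  exact: findim_linear_continuous.
have Ctr' k (E : normedModType R) (D : set E) (g : E -> 'cV[R]_s) : open D -> Ck_on k D g ->
    Ck_on k D (fun y => (g y)^T).
  move=> oD; apply: (@Ck_on_lin R k E _ _ D g (trmx : 'cV[R]_s -> 'rV[R]_s)) => //.
  exact: findim_linear_continuous.
have inv_chart x : family_image x -> (chart_dom c `&` chart_map c @^-1` V) (family_inv x).1.
  by move=> /family_inv_image[].
split.
- have DE : chart_cod d `&` chart_inv d @^-1`
      ((chart_dom c `&` chart_map c @^-1` V) `*` [set: LM]) =
    (chart_cod c `&` V) `*` row_set.
    apply/seteqP; split=> -[y l] /=; rewrite /preimage /=.
      by move=> [[yc Ll] [[_ Vy] _]]; split=> //; split=> //=; rewrite cK' in Vy.
    move=> [[yc Vy] Ll]; split=> //; split=> //=; split; [exact: ci|by rewrite /= cK'].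
  have oD : open ((chart_cod c `&` V) `*` row_set).
    apply: open_setX; last exact: open_row_set.
    by apply: openI => //; exact: open_chart_cod.
  apply: (@smooth_on_chart R _ _ _ _ (prod_manifold Q LM) (cotangent Q) _ f d C) => //.
  + exact: saP.
  + by move=> x [[]].
  + by move=> x [[cx _] _].
  + by rewrite DE.
  + rewrite DE => k.
    have C1 : Ck_on k ((chart_cod c `&` V) `*` row_set) (fst : 'rV[R]_s * 'rV[R]_s -> 'rV[R]_s).
      by apply: Ck_on_id_lin => x; exact: cvg_fst.
    have C2 : Ck_on k ((chart_cod c `&` V) `*` row_set) (snd : 'rV[R]_s * 'rV[R]_s -> 'rV[R]_s).
      by apply: Ck_on_id_lin => x; exact: cvg_snd.
    have CP : Ck_on k ((chart_cod c `&` V) `*` row_set)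
        (fun y : 'rV[R]_s * 'rV[R]_s => (y.1, P (y.1, y.2^T))).
      apply: Ck_on_pair => //.
      apply: (@Ck_on_comp R k _ Ph _ _ _ (V `*` L) P
        (fun y : 'rV[R]_s * 'rV[R]_s => (y.1, y.2^T))) => //.
        by move=> y [[_ Vy] Ly].
      by apply: Ck_on_pair => //; exact: Ctr.
    apply: Ck_on_eq CP => // -[y l] [[/= yc Vy] Ll].
    apply: etrans _ (esym (family_section_chart (open_point_of row_set0 l) _ _)).
    * by rewrite cK' // open_point_ofK.
    * exact: ci.
    * by rewrite cK'.
- split.
  + by move=> x [[cx Vx] _]; exact: family_section_image.
  + move=> x y; rewrite !inE => -[[cx Vx] _] [[cy Vy] _] fxy.
    by rewrite -(family_invK cx Vx) -(family_invK cy Vy) fxy.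
  + move=> a /family_inv_image[ia fa]; exists (family_inv a) => //; by split.
exists family_inv; split; last by move=> x [[cx Vx] _]; exact: family_invK.
have DE : chart_cod C `&` chart_inv C @^-1` family_image = U.
  apply/seteqP; split=> z; first by move=> [zC [_]]; rewrite /preimage /mkset CK'.
  move=> Uz; have zC := UO Uz; split=> //.
  by split; [exact: Ci|rewrite /preimage /mkset CK'].
apply: (@smooth_on_chart R _ _ _ _ (cotangent Q) (prod_manifold Q LM) _ family_inv C d) => //.
- exact: saP.
- by move=> a [].
- by move=> a /inv_chart[ca _]; split.
- by rewrite DE.
- rewrite DE => k.
  have CG : Ck_on k U (fun z : Ph => (z.1, (G z)^T)).
    apply: Ck_on_pair => //; last by apply: Ctr' => //; exact: GC.
    by apply: Ck_on_id_lin => x; exact: cvg_fst.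
  apply: Ck_on_eq CG => // z Uz; have zC := UO Uz; have [_ LG _] := UP Uz.
  rewrite /comp /family_inv CK' //= cK'; last by case: zC.
  by rewrite open_point_ofK // /row_set /= trmxK.
Qed.

Lemma family_complete : complete_family H family_image family_pullback.
Proof.
rewrite /complete_family family_proj; split.
- exact: family_smooth_function.
- move=> l q [cq Vq] v; rewrite /differential /tangent_map /=.
  have [ak kq] := atQ q; set k := chart_at q in ak kq *.
  have [km ki kK _] := saQ.1 k ak.
  (* The differential at [q] is taken in the preferred chart there, which may differ from [c].
     Openness of the domain makes the composite with [H] constant near [q] in that chart as well. *)
  have oVQ : open (chart_dom c `&` chart_map c @^-1` V : set Q) by exact: atlas_open_chart.
  rewrite atlas_openE in oVQ; have oB := oVQ k ak.
  have [||_ dE] := near_eq_differentiable (f := cst (e (open_point_val l)^T))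
    (g := idfun \o (H \o diff_section (family_pullback l)) \o chart_inv k)
    (x := chart_map k q).
  + near=> y; have [ky [cy Vy]] : (chart_cod k `&` chart_inv k @^-1`
        (chart_dom c `&` chart_map c @^-1` V)) y.
      near: y; apply: open_nbhs_nbhs; split=> //; split; first exact: km.
      by rewrite /preimage /= kK.
    by rewrite /= family_constant.
  + exact: differentiable_cst.
  apply: etrans (congr1 (fun h => h v) dE) _.
  by rewrite diff_cst.
- exact: family_diffeomorphism.
Unshelve. all: by end_near. Qed.

End CompleteFamily.

Theorem corollary1 (R : realType) (s : nat) (Q : charted_space 'rV[R]_s)
  (HQ : smooth_manifold Q) (H : cotangent Q -> R)
  (smoothH : smooth_on (N := real_line) [set: cotangent Q] H)
  (m : cotangent Q)
  (Hm : ~ ker_tangent_proj (hamiltonian_field H m)) :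
  exists (U : set (cotangent Q)) (L : charted_space 'rV[R]_s) (W : L -> Q -> R),
    [/\ open_nbhs m U, smooth_manifold L & complete_family H U W].
Proof.
have [atQ chQ cpQ _ _] := HQ; have saQ : smooth_atlas Q by split.
have [ac cm] := atQ (base_point m); set c := chart_at (base_point m) in ac cm.
have [cc ci cK cK'] := chQ c ac.
have [i0 Hi0] := hamiltonian_field_transverse saQ atQ Hm.
pose O := chart_cod c `*` [set: 'cV[R]_s].
have oO : open O by apply: open_setX; [exact: open_chart_cod|exact: openT].
have aC : @atlas R _ (cotangent Q) (cotangent_chart c) by exact: imageP.
(* The line carries the identity chart and [H] is smooth everywhere, so the domain in [smooth_on]
   reduces to the chart codomain [O]. *)
have HC : Coo_on O (H \o chart_inv (cotangent_chart c)).
  have [_ C] := smoothH _ (model_chart (R^o : normedModType R)) aC (erefl _).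
  by move: C; rewrite /= preimage_setT setIT /= preimage_setT setIT.
set z := chart_map _ m in Hi0.
have Oz : O (z.1, z.2) by split=> //; exact: cc.
rewrite [z]surjective_pairing in Hi0.
have [V [L [l0 [U [W [P [G [e [[oV Vz oL Ll0 Pz] [oU UO PU UP] [WC PC GC] dW He]]]]]]]]] :=
  local_complete_integral oO HC Oz Hi0.
exists (family_image c U), (open_submanifold (open_row_set oL) (row_set0 Ll0)),
  (family_pullback (oL := oL) (Ll0 := Ll0) c W); split.
- split; first exact: family_image_open.
  split=> //; have [] := PU _ _ Vz Ll0.
  by rewrite Pz -surjective_pairing.
- exact: smooth_manifold_open.
- exact: (family_complete saQ atQ ac oV oL Ll0 oU UO PU UP WC PC GC dW He).
Qed.
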